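(* Let $0<1/n\ll\varepsilon\ll\gamma\ll 1/r$ where $n,r\in\mathbb N$, $r\ge 3$ and $r$ divides $n$, and let $T\in\mathcal T_r\setminus\{C_3\}$. Suppose that $G$ is a digraph on $n$ vertices with $\delta^0(G)\ge (1-1/r-\varepsilon)n$, and that $G$ does not contain any $\gamma$-independent set of size at least $n/r$. Then $G$ contains a perfect $T$-packing.
   Context: Hierarchy notation: $0<a\ll b\ll c$ means the constants are chosen from right to left, each sufficiently small in terms of those to its right. A digraph has no loops and at most one edge in each direction between any two vertices; $\delta^0(G)$ is the minimum of the minimum out- and indegree. $\mathcal T_r$ is the set of tournaments on $r$ vertices; $C_3$ is the cyclic triangle. A perfect $T$-packing is a collection of vertex-disjoint (not necessarily induced) copies of $T$ covering all vertices. For $G$ on $n$ vertices, $S\subseteq V(G)$ is $\gamma$-independent if $G[S]$ has at most $\gamma n^2$ edges. *)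

(* Defs.v *)
From mathcomp Require Import all_boot all_order all_algebra.
From mathcomp Require Import reals.

Set Implicit Arguments.
Unset Strict Implicit.
Unset Printing Implicit Defensive.

Import Order.TTheory GRing.Theory Num.Theory.

(* [G x y] is the edge from x to y; a pair x, y may carry both edges. *)
Record digraph (V : finType) := Digraph {
  edge :> rel V;
  edge_irr : irreflexive edge
}.

Definition outdeg (V : finType) (G : digraph V) (x : V) : nat :=
  #|[set y | G x y]|.

Definition indeg (V : finType) (G : digraph V) (x : V) : nat :=
  #|[set y | G y x]|.

(* The base value #|V| exceeds every degree, so it does not affect the
   minimum unless V is empty (in which case the value is 0). *)
Definition min_semidegree (V : finType) (G : digraph V) : nat :=
  \big[minn/#|V|]_(x : V) minn (outdeg G x) (indeg G x).

Definition edges_in (V : finType) (G : digraph V) (S : {set V}) : nat :=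
  #|[set p : V * V | [&& p.1 \in S, p.2 \in S & G p.1 p.2]]|.

Definition gamma_independent (R : realType) (V : finType) (G : digraph V)
    (gamma : R) (S : {set V}) : Prop :=
  ((edges_in G S)%:R <= gamma * #|V|%:R ^+ 2)%R.

Definition is_tournament (W : finType) (T : digraph W) : Prop :=
  forall x y : W, x != y -> T x y (+) T y x.

Definition digraph_iso (V W : finType) (G : digraph V) (H : digraph W) : Prop :=
  exists f : V -> W, bijective f /\ forall x y : V, H (f x) (f y) = G x y.

Definition C3_edge : rel 'I_3 := fun i j => j == ordS i.

Lemma C3_irr : irreflexive C3_edge.
Proof. by case=> [[|[|[|m]]] Hm]. Qed.

Definition C3 : digraph 'I_3 := Digraph C3_irr.

(* A (not necessarily induced) copy of T in G, given by an embedding. *)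
Definition is_copy (W V : finType) (T : digraph W) (G : digraph V)
    (f : {ffun W -> V}) : Prop :=
  injective f /\ forall x y : W, T x y -> G (f x) (f y).

(* When W is nonempty, disjointness of the images of distinct members forces
   each copy, as a subgraph of G, to be listed by a single embedding. *)
Definition perfect_packing (W V : finType) (T : digraph W) (G : digraph V)
    (P : {set {ffun W -> V}}) : Prop :=
  [/\ forall f, f \in P -> is_copy T G f,
      forall f g, f \in P -> g \in P -> f != g ->
        [disjoint codom f & codom g]
    & forall v : V, exists2 f, f \in P & v \in codom f].

(* Main.v *)
(** Almost perfect packings.  If a vertex weighting bounded by 1 has nonnegative total, then a
    positive proportion of all copies of [T] have almost nonnegative weight.  Repeatedly adding a
    measure on such copies for the current vector of deficiencies gives a bounded measure on
    copies whose vertex degrees are nearly uniform.  Divide the vertices into blocks, namely the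
    copies of a maximum packing and arbitrary [r]-sets of leftover vertices.  For a random sample
    of blocks indexed by [r * q] points, distribute the measure over the lines of an affine plane
    on these points; two lines share at most one point, so the degrees in the sample concentrate
    and the sample has a fractional packing by more copies than it contains.  By Erdős' theorem
    the same happens for all samples in some complete [r * q]-partite family of blocks, where the
    fractional packing can be made integral, against maximality.

    Absorption.  Let [w] be a role with two outneighbours [a] and [b] in [T]; for [r = 3] such a
    role exists because [T] is not the cyclic triangle.  Given vertices [x] and [y], fill the other
    roles greedily with vertices fitting both [x] and [y] in role [w].  Either [a] and [b] can then
    be filled in many ways, or almost no edge goes from the candidates [A] for [a] to the
    candidates [B] for [b].  Since sets of size [n / r] are not almost independent, the latter
    forces [r >= 4] and an almost complete digraph on a large set [K], through which any two
    vertices can be linked.  So all pairs of vertices are linked by a positive proportion of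
    [(5 * r - 1)]-tuples; a copy of [T] with all its vertices linked to those of an [r]-set absorbs
    this set, and a family of disjoint absorbers that is rich for all [r]-sets is found greedily. *)

Require Import Defs.
From mathcomp Require Import all_boot all_order all_algebra.
From mathcomp Require Import boolp reals ring lra zify.

Set Implicit Arguments.
Unset Strict Implicit.
Unset Printing Implicit Defensive.

Import Order.TTheory GRing.Theory Num.Theory.
Local Open Scope ring_scope.

(** * Counting *)

Ltac nlia := repeat match goal with H : ?P |- _ =>
  lazymatch P with
  | is_true (leq _ _) => fail
  | is_true (andb (leq _ _) (leq _ _)) => fail
  | @eq nat _ _ => fail
  | _ => clear H
  end end; lia.

Ltac glra := clear; lra.

Ltac pos := solve [repeat first [done | assumption | by apply: ltW
  | apply: mulr_ge0 | apply: divr_ge0 | apply: exprn_ge0 | apply: addr_ge0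
  | apply: mulr_gt0 | apply: divr_gt0 | apply: exprn_gt0 | apply: addr_gt0
  | rewrite invr_ge0 | rewrite invr_gt0 ]].

Section RealCard.
Variable R : realType.
Implicit Type T : finType.

Lemma lecard T (A B : {set T}) : A \subset B -> #|A|%:R <= #|B|%:R :> R.
Proof. by move=> sAB; rewrite ler_nat subset_leq_card. Qed.

Lemma cardR_U T (A B : {set T}) : #|A :|: B|%:R <= #|A|%:R + #|B|%:R :> R.
Proof. by rewrite -natrD ler_nat cardsU leq_subr. Qed.

Lemma cardR_ID T (A B : {set T}) : #|A|%:R = #|A :&: B|%:R + #|A :\: B|%:R :> R.
Proof. by rewrite -natrD cardsID. Qed.

Lemma cardR_D T (A B : {set T}) : #|A|%:R - #|B|%:R <= #|A :\: B|%:R :> R.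
Proof. by rewrite (cardR_ID A B) lerBlDr [X in _ <= X]addrC lerD2r lecard ?subsetIr. Qed.

Lemma cardR_C T (A : {set T}) : #|A|%:R + #|~: A|%:R = #|T|%:R :> R.
Proof. by rewrite -natrD cardsC. Qed.

Lemma cardR_bigcup (I T : finType) (P : pred I) (F : I -> {set T}) :
  #|\bigcup_(i | P i) F i|%:R <= \sum_(i | P i) #|F i|%:R :> R.
Proof.
elim/big_rec2: _ => [|i u B Pi IH]; first by rewrite cards0.
by apply: le_trans (cardR_U _ _) _; rewrite lerD2l.
Qed.

Lemma sum_card_fst (A B : finType) (S : {set A * B}) :
  #|S| = (\sum_(a : A) #|[set b | (a, b) \in S]|)%N.
Proof.
rewrite -sum1_card (eq_bigl (fun p : A * B => (p.1, p.2) \in S)); last by case.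
rewrite -(pair_big_dep xpredT (fun a b => (a, b) \in S) (fun _ _ => 1%N)) /=.
by apply: eq_bigr => a _; rewrite -sum1dep_card.
Qed.

Lemma cardR_sum (A : finType) (X : {set A}) (P : pred A) :
  #|[set a in X | P a]|%:R = \sum_(a in X) (P a)%:R :> R.
Proof.
rewrite -sum1_card natr_sum (eq_bigl (fun a => (a \in X) && P a)); last by move=> a; rewrite inE.
by rewrite big_mkcondr; apply: eq_bigr => a _; case: (P a).
Qed.

Lemma double_count (A B : finType) (X : {set A}) (Y : {set B}) (P : A -> B -> bool) :
  \sum_(a in X) #|[set b in Y | P a b]|%:R = \sum_(b in Y) #|[set a in X | P a b]|%:R :> R.
Proof.
under eq_bigr do rewrite cardR_sum.
by rewrite exchange_big; apply: eq_bigr => b _; rewrite cardR_sum.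
Qed.

Lemma card_markov (A : finType) (X : {set A}) (F : A -> R) (s : R) :
  (forall a, a \in X -> 0 <= F a) ->
  s * #|[set a in X | s <= F a]|%:R <= \sum_(a in X) F a.
Proof.
move=> F0; rewrite cardR_sum mulr_sumr; apply: ler_sum => a aX.
by case: (leP s (F a)) => h; rewrite ?mulr1 ?mulr0 //; exact: F0.
Qed.

Lemma pigeonhole (A B : finType) (f : A -> B) (X : {set A}) : (0 < #|B|)%N ->
  exists b, #|X|%:R <= #|B|%:R * #|[set a in X | f a == b]|%:R :> R.
Proof.
move=> B0; case/card_gt0P: (B0) => b0 _.
have [b _ bmax] := @arg_maxnP B b0 xpredT (fun b => #|[set a in X | f a == b]|) isT.
exists b; rewrite -natrM ler_nat.
rewrite -sum1_card (partition_big f xpredT) //=.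
apply: (@leq_trans (\sum_(c : B) #|[set a in X | f a == b]|)); last by rewrite sum_nat_const.
by apply: leq_sum => c _; rewrite sum1dep_card; exact: bmax.
Qed.

Lemma eventually_ge (x : R) (b : R) : 0 < x -> exists N : nat, forall n, (N <= n)%N -> b <= x * n%:R.
Proof.
move=> x0; exists (Num.bound (`|b| / x)) => n Nn.
have h : `|b| / x < n%:R.
  by apply: lt_le_trans (archi_boundP _) _; rewrite ?divr_ge0 ?(ltW x0) // ler_nat.
by rewrite (le_trans (ler_norm _)) // mulrC -ler_pdivrMr // ltW.
Qed.

End RealCard.

Section Update.
Variables (I V : finType).
Implicit Types (f : {ffun I -> V}) (k : I) (v : V).

Definition upd f k v : {ffun I -> V} := [ffun i => if i == k then v else f i].

Lemma updE f k v i : upd f k v i = if i == k then v else f i.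
Proof. by rewrite ffunE. Qed.

Lemma upd_eq f k v : upd f k v k = v.
Proof. by rewrite updE eqxx. Qed.

Lemma upd_neq f k v i : i != k -> upd f k v i = f i.
Proof. by rewrite updE => /negbTE->. Qed.

Lemma upd_id f k : upd f k (f k) = f.
Proof. by apply/ffunP => i; rewrite updE; case: eqP => [->|]. Qed.

Lemma upd_upd f k u v : upd (upd f k u) k v = upd f k v.
Proof. by apply/ffunP => i; rewrite !updE; case: eqP. Qed.

Variable R : realType.
Local Notation n := (#|V|%:R : R).

Lemma step_count (X Y : {set {ffun I -> V}}) k (h : R) :
  (forall f, f \in X -> h <= #|[set v | upd f k v \in Y]|%:R) ->
  h * #|X|%:R <= #|Y|%:R * n.
Proof.
move=> hX.
have -> : h * #|X|%:R = \sum_(f in X) h by rewrite sumr_const mulr_natr.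
apply: (le_trans (ler_sum _ hX)).
pose D := [set p : {ffun I -> V} * V | (p.1 \in X) && (upd p.1 k p.2 \in Y)].
have -> : \sum_(f in X) #|[set v | upd f k v \in Y]|%:R = #|D|%:R :> R.
  rewrite sum_card_fst natr_sum [RHS](bigID (mem X)) /= [X in _ + X]big1 ?addr0.
    by apply: eq_bigr => f fX; congr (_%:R); apply: eq_card => v; rewrite !inE fX.
  by move=> f nfX; rewrite (_ : [set _ | _] = set0) ?cards0 //; apply/setP => v;
    rewrite !inE (negbTE nfX).
pose F (p : {ffun I -> V} * V) := (upd p.1 k p.2, p.1 k).
rewrite -natrM ler_nat -(cardsT V) -cardsX.
have Finj : {in D &, injective F}.
  move=> [f u] [g v] _ _; rewrite /F /= => -[e1 e2].
  have -> : f = g by rewrite -(upd_id f k) -(upd_id g k) -e2 -(upd_upd f k u) e1 upd_upd.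
  by rewrite -(upd_eq f k u) e1 upd_eq.
rewrite -(card_in_imset Finj); apply: subset_leq_card.
by apply/subsetP => p /imsetP[[f u]]; rewrite !inE /= => /andP[_ uY] ->; rewrite /= uY.
Qed.

Lemma step_count2 (X Y : {set {ffun I -> V}}) k l (h : R) : k != l ->
  (forall f, f \in X -> h <= #|[set p : V * V | upd (upd f k p.1) l p.2 \in Y]|%:R) ->
  h * #|X|%:R <= #|Y|%:R * n ^+ 2.
Proof.
move=> nkl hX.
have -> : h * #|X|%:R = \sum_(f in X) h by rewrite sumr_const mulr_natr.
apply: (le_trans (ler_sum _ hX)).
pose D := [set p : {ffun I -> V} * (V * V) |
  (p.1 \in X) && (upd (upd p.1 k p.2.1) l p.2.2 \in Y)].
have -> : \sum_(f in X) #|[set p : V * V | upd (upd f k p.1) l p.2 \in Y]|%:R = #|D|%:R :> R.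
  rewrite sum_card_fst natr_sum [RHS](bigID (mem X)) /= [X in _ + X]big1 ?addr0.
    by apply: eq_bigr => f fX; congr (_%:R); apply: eq_card => v; rewrite !inE fX.
  by move=> f nfX; rewrite (_ : [set _ | _] = set0) ?cards0 //; apply/setP => v;
    rewrite !inE (negbTE nfX).
pose F (p : {ffun I -> V} * (V * V)) := (upd (upd p.1 k p.2.1) l p.2.2, (p.1 k, p.1 l)).
rewrite -natrX -natrM ler_nat -mulnn -card_prod -(cardsT (V * V)%type) -cardsX.
have Finj : {in D &, injective F}.
  move=> [f [u1 u2]] [g [v1 v2]] _ _; rewrite /F /= => -[e1 e2 e3].
  have eu1 : u1 = v1.
    by move/ffunP/(_ k): e1; rewrite !updE (negbTE nkl) eqxx.
  have eu2 : u2 = v2 by move/ffunP/(_ l): e1; rewrite !updE eqxx.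
  rewrite eu1 eu2; congr (_, _); apply/ffunP => i.
  have [->//|nik] := eqVneq i k; have [->//|nil] := eqVneq i l.
  by move/ffunP/(_ i): e1; rewrite !updE (negbTE nik) (negbTE nil).
rewrite -(card_in_imset Finj); apply: subset_leq_card.
by apply/subsetP => p /imsetP[[f u]]; rewrite !inE /= => /andP[_ uY] ->; rewrite /= uY.
Qed.

Lemma greedy_iter (P : nat -> pred {ffun I -> V}) (pos : nat -> I) (h : R) (p k : nat) :
  0 <= h ->
  (forall j f, (p <= j < p + k)%N -> P j f ->
     h <= #|[set v | P j.+1 (upd f (pos j) v)]|%:R) ->
  h ^+ k * #|[set f | P p f]|%:R <= #|[set f | P (p + k)%N f]|%:R * n ^+ k.
Proof.
move=> h0; elim: k => [|k IH] hP; first by rewrite !expr0 mul1r mulr1 addn0.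
have {}IH := IH (fun j f jk => hP j f ltac:(lia)).
have st : h * #|[set f | P (p + k)%N f]|%:R <= #|[set f | P (p + k.+1)%N f]|%:R * n.
  apply: (@step_count _ _ (pos (p + k)%N)) => f; rewrite inE => Pf.
  have := hP (p + k)%N f ltac:(lia) Pf; rewrite addnS.
  by move=> /le_trans; apply; apply/lecard/subsetP => v; rewrite !inE.
rewrite [h ^+ _]exprS [n ^+ _]exprS -mulrA.
apply: (le_trans (ler_wpM2l h0 IH)).
by rewrite !mulrA ler_wpM2r // exprn_ge0.
Qed.

Lemma greedy_set (P : {set I} -> pred {ffun I -> V}) (L0 M : {set I}) (h : R) :
  0 <= h -> L0 \subset M ->
  (forall (L : {set I}) k f, L0 \subset L -> L \subset M -> k \in M -> k \notin L -> P L f ->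
     h <= #|[set v | P (k |: L) (upd f k v)]|%:R) ->
  h ^+ #|M :\: L0| * #|[set f | P L0 f]|%:R <= #|[set f | P M f]|%:R * n ^+ #|M :\: L0|.
Proof.
move=> h0; move: {2}#|M :\: L0| (leqnn #|M :\: L0|) => m.
elim: m L0 => [|m IH] L0 mle sL hP.
  move: mle; rewrite leqn0 cards_eq0 setD_eq0 => sM.
  by have -> : L0 = M by [apply/eqP; rewrite eqEsubset sL]; rewrite setDv cards0 !expr0 mul1r mulr1.
have [eM|/set0Pn[k]] := eqVneq (M :\: L0) set0.
  by apply: IH; rewrite ?eM ?cards0.
rewrite inE => /andP[kL kM].
have cE : #|M :\: L0| = #|M :\: (k |: L0)|.+1.
  by rewrite (cardsD1 k) inE kL kM setDDl setUC.
have sL' : k |: L0 \subset M by rewrite subUset sub1set kM.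
have {}IH : h ^+ #|M :\: (k |: L0)| * #|[set f | P (k |: L0) f]|%:R
   <= #|[set f | P M f]|%:R * n ^+ #|M :\: (k |: L0)|.
  apply: IH => //; first by rewrite -ltnS -cE.
  move=> L k' f sLL; apply: hP => //.
  by apply: subset_trans sLL; apply: subsetUr.
have st : h * #|[set f | P L0 f]|%:R <= #|[set f | P (k |: L0) f]|%:R * n.
  apply: (@step_count _ _ k) => f; rewrite inE => Pf.
  apply: (le_trans (hP L0 k f _ _ _ _ Pf)) => //.
  by apply/lecard/subsetP => v; rewrite !inE.
rewrite cE !exprSr -[X in X <= _]mulrA.
apply: (le_trans (ler_wpM2l (exprn_ge0 _ h0) st)).
by rewrite !mulrA ler_wpM2r.
Qed.

End Update.

(** * Partial copies and near-cliques *)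

Section Copies.
Variables (R : realType) (r : nat) (T : rel 'I_r) (V : finType) (G : rel V).
Hypothesis tourT : forall i j, i != j -> T i j (+) T j i.
Hypothesis irrG : irreflexive G.
Local Notation n := (#|V|%:R : R).
Implicit Types (i j k : 'I_r) (x y v : V) (f : {ffun 'I_r -> V}) (L M : {set 'I_r}).

Definition nonout x := [set y | ~~ G x y].
Definition nonin x := [set y | ~~ G y x].

Definition compat i j x y := (T i j ==> G x y) && (T j i ==> G y x).
Definition ncompat i j x := [set y | ~~ compat i j x y].

Lemma compat_sym i j x y : compat i j x y = compat j i y x.
Proof. by rewrite /compat andbC. Qed.

Lemma compatW i j x y : G x y -> G y x -> compat i j x y.
Proof. by rewrite /compat => -> ->; rewrite !implybT. Qed.

Lemma compat_out i j x y : i != j -> T i j -> compat i j x y = G x y.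
Proof. by move=> /tourT; rewrite /compat; case: (T i j); case: (T j i) => //=; rewrite andbT. Qed.

Lemma compat_in i j x y : i != j -> T j i -> compat i j x y = G y x.
Proof. by move=> nij Tji; rewrite compat_sym compat_out // eq_sym. Qed.

Lemma ncompatE i j x : i != j -> ncompat i j x = if T i j then nonout x else nonin x.
Proof.
move=> nij; apply/setP => y; have := tourT nij; case: ifP => Tij; rewrite !inE.
  by rewrite compat_out.
by rewrite /= => Tji; rewrite compat_in.
Qed.

Definition partial L f :=
  [forall i in L, forall j in L, (i != j) ==> compat i j (f i) (f j)].

Definition copy f := partial setT f.

Lemma partialP L f :
  reflect (forall i j, i \in L -> j \in L -> i != j -> compat i j (f i) (f j)) (partial L f).
Proof.
apply: (iffP 'forall_implyP) => [h i j iL jL|h i iL].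
  by move/'forall_implyP: (h i iL) => /(_ j jL)/implyP; apply.
by apply/'forall_implyP => j jL; apply/implyP; apply: h.
Qed.

Lemma partial0 f : partial set0 f.
Proof. by apply/partialP => i j; rewrite inE. Qed.

Lemma partialS L M f : L \subset M -> partial M f -> partial L f.
Proof. by move=> /subsetP sLM /partialP h; apply/partialP => i j /sLM iM /sLM; apply: h. Qed.

Lemma partial_upd L k f v : k \notin L -> partial L f ->
  (forall i, i \in L -> compat i k (f i) v) -> partial (k |: L) (upd f k v).
Proof.
move=> kL /partialP h hk; apply/partialP => i j; rewrite !inE !updE.
case: (eqVneq i k) => [->|nik] /=; case: (eqVneq j k) => [->|njk] //=.
- by move=> _ jL _; rewrite compat_sym hk.
- by move=> iL _ _; rewrite hk.
- exact: h.
Qed.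

Lemma copy_upd f k v : partial [set~ k] f -> (forall i, i != k -> compat i k (f i) v) ->
  copy (upd f k v).
Proof.
move=> pf hk; rewrite /copy (_ : setT = k |: [set~ k]).
  by apply: partial_upd => // [|i]; rewrite !inE ?eqxx //; apply: hk.
by apply/setP => i; rewrite !inE; case: eqP.
Qed.

Lemma copy_inj f : copy f -> injective f.
Proof.
move=> /partialP h i j eij; apply/eqP/negP => /negP nij.
have := h i j; rewrite !inE => /(_ isT isT nij); rewrite /compat eij irrG.
by have := tourT nij; case: (T i j); case: (T j i).
Qed.

Lemma cand_card (S : {set V}) L k f (D : R) :
  (forall i, i \in L -> #|S :&: ncompat i k (f i)|%:R <= D) ->
  #|S|%:R - #|L|%:R * D <= #|[set v in S | [forall i in L, compat i k (f i) v]]|%:R.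
Proof.
move=> hD; set C := [set v in S | _].
have sub : S :\: C \subset \bigcup_(i in L) (S :&: ncompat i k (f i)).
  apply/subsetP => v; rewrite !inE => /andP[]; case vS: (v \in S) => //= + _.
  rewrite negb_forall => /existsP[i]; rewrite negb_imply => /andP[iL nc].
  by apply/bigcupP; exists i => //; rewrite !inE vS.
have h1 := le_trans (lecard R sub) (cardR_bigcup R _ _).
have h2 : \sum_(i in L) #|S :&: ncompat i k (f i)|%:R <= #|L|%:R * D.
  by rewrite mulr_natl -sumr_const; apply: ler_sum.
have := cardR_D R S (S :\: C).
have : #|S :\: (S :\: C)|%:R <= #|C|%:R :> R.
  by rewrite setDDr setDv set0U lecard // subsetIr.
by move: (le_trans h1 h2); lra.
Qed.

Lemma greedy_place (S : {ffun 'I_r -> V} -> 'I_r -> {set V}) (Q : pred {ffun 'I_r -> V})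
    (L0 M : {set 'I_r}) (h : R) :
  0 <= h -> L0 \subset M ->
  (forall f k v, k \in M -> k \notin L0 -> Q f -> Q (upd f k v)) ->
  (forall f k v, k \in M -> k \notin L0 -> S (upd f k v) =1 S f) ->
  (forall L k f, L0 \subset L -> L \subset M -> k \in M -> k \notin L ->
     partial L f -> Q f -> (forall i, i \in L -> i \notin L0 -> f i \in S f i) ->
     h <= #|[set v in S f k | [forall i in L, compat i k (f i) v]]|%:R) ->
  h ^+ #|M :\: L0| * #|[set f | partial L0 f && Q f]|%:R <=
  #|[set f | [&& partial M f, Q f & [forall i in M :\: L0, f i \in S f i]]]|%:R
    * n ^+ #|M :\: L0|.
Proof.
move=> h0 sLM hQ hS hh.
pose P L f := [&& partial L f, Q f & [forall i in L :\: L0, f i \in S f i]].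
have -> : [set f | partial L0 f && Q f] = [set f | P L0 f].
  apply/setP => f; rewrite !inE /P setDv; case: (partial L0 f) => //=; case: (Q f) => //=.
  by apply/esym/forall_inP => i; rewrite inE.
apply: (@greedy_set _ _ R P) => // L k f sL0 sL kM kL /and3P[pf qf /forall_inP sf].
have kL0 : k \notin L0 by apply: contra kL; apply/subsetP.
apply: le_trans (hh L k f sL0 sL kM kL pf qf _) _.
  by move=> i iL iL0; apply: sf; rewrite inE iL0.
apply/lecard/subsetP => v; rewrite !inE => /andP[vS /forall_inP vc].
apply/and3P; split; [exact: partial_upd|exact: hQ|].
apply/forall_inP => i; rewrite !inE hS // updE.
case: (eqVneq i k) => [->//|_] /= /andP[iL0 iL].
by apply: sf; rewrite inE iL0.
Qed.

Definition robust (theta gam : R) :=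
  [/\ forall x, #|nonout x|%:R <= (r%:R^-1 + theta) * n,
      forall x, #|nonin x|%:R <= (r%:R^-1 + theta) * n
    & forall S : {set V}, (r%:R^-1 - gam) * n <= #|S|%:R ->
        gam * n ^+ 2 <= #|[set p : V * V | [&& p.1 \in S, p.2 \in S & G p.1 p.2]]|%:R].

Lemma ncompat_card theta gam i k x : robust theta gam -> i != k ->
  #|ncompat i k x|%:R <= (r%:R^-1 + theta) * n.
Proof. by move=> [h1 h2 _] nik; rewrite ncompatE //; case: ifP. Qed.

(* [K] is almost a complete digraph, and the out-nonneighbourhoods of its vertices all
   essentially coincide with [B]. *)
Record near_clique (gam ze : R) (A B K : {set V}) : Prop := NearClique {
  nc_sub : K \subset A :\: B;
  nc_big : gam / 4 * n <= #|K|%:R;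
  nc_AleK : #|A|%:R <= #|A :&: B|%:R + #|K|%:R + ze * n;
  nc_Age : (r%:R^-1 - ze) * n <= #|A|%:R;
  nc_Ble : #|B|%:R <= (r%:R^-1 + ze) * n;
  nc_exc : #|[set v in A | ze * n < #|nonout v :\: B|%:R]|%:R <= ze * n;
  nc_out : forall v, v \in K -> #|nonout v :\: B|%:R <= ze * n;
  nc_in : forall v, v \in K -> #|nonin v :&: K|%:R <= ze * n
}.

(* If almost no edge goes from [A] to [B], then [A :&: B] is almost independent, hence small;
   and the out-nonneighbourhood of a typical vertex of [A] is essentially [B], so the vertices
   of [A :\: B] are joined to each other. *)
Lemma near_clique_of_sparse (gam theta xi ze kap : R) (A B : {set V}) :
  0 < n -> robust theta gam -> 0 < ze -> ze <= gam / 8 -> ze <= 1 ->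
  0 <= theta -> 0 <= xi -> theta + xi <= ze ^+ 2 / 4 -> 0 < kap -> kap <= ze ^+ 3 / 8 ->
  (r%:R^-1 - xi) * n <= #|A|%:R -> (r%:R^-1 - xi) * n <= #|B|%:R ->
  #|[set p : V * V | [&& p.1 \in A, p.2 \in B & G p.1 p.2]]|%:R <= kap * n ^+ 2 ->
  exists K, near_clique gam ze A B K.
Proof.
move=> n0 [ro ri ind] ze0 zeg ze1 th0 xi0 thxi kap0 kapz hA hB sparse.
have z2 : ze ^+ 2 <= ze by rewrite expr2 ler_piMl // ltW.
have z3 : ze ^+ 3 <= ze by rewrite exprS ler_piMr // ?(ltW ze0) // (le_trans z2).
have n20 : 0 < n ^+ 2 by rewrite exprn_gt0.
set rr := r%:R^-1 in ro ri ind hA hB *.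
have AB : #|A :&: B|%:R <= (rr - gam) * n.
  rewrite leNgt; apply/negP => hAB; have := ind _ (ltW hAB).
  have : #|[set p : V * V | [&& p.1 \in A :&: B, p.2 \in A :&: B & G p.1 p.2]]|%:R
     <= kap * n ^+ 2.
    apply: le_trans sparse; apply/lecard/subsetP => p; rewrite !inE.
    by move=> /and3P[/andP[-> _] /andP[_ ->] ->].
  have kg : (gam - kap) * n ^+ 2 > 0 by rewrite mulr_gt0 //; lra.
  by move: kg; rewrite mulrBl; lra.
pose sg := ze ^+ 2 / 4.
have sg0 : 0 < sg by rewrite divr_gt0 ?exprn_gt0.
pose E := [set v in A | sg * n <= #|[set y in B | G v y]|%:R].
have En : #|E|%:R <= ze / 2 * n.
  have hm : sg * n * #|E|%:R <= \sum_(v in A) #|[set y in B | G v y]|%:R.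
    by rewrite /E; apply: card_markov.
  have es : \sum_(v in A) #|[set y in B | G v y]|%:R =
     #|[set p : V * V | [&& p.1 \in A, p.2 \in B & G p.1 p.2]]|%:R :> R.
    rewrite sum_card_fst natr_sum [RHS](bigID (mem A)) /= [X in _ = _ + X]big1 ?addr0.
      by apply: eq_bigr => v vA; congr (_%:R); apply: eq_card => y; rewrite !inE vA.
    move=> v nvA; rewrite (_ : [set _ | _] = set0) ?cards0 //.
    by apply/setP => y; rewrite !inE (negbTE nvA).
  have e3 : ze ^+ 3 / 8 = sg * (ze / 2) by rewrite /sg; field.
  have : sg * n * #|E|%:R <= sg * n * (ze / 2 * n).
    apply: (le_trans hm); rewrite es; apply: (le_trans sparse).
    have -> : sg * n * (ze / 2 * n) = ze ^+ 3 / 8 * n ^+ 2 by rewrite e3; ring.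
    by rewrite ler_wpM2r // ltW.
  by rewrite ler_pM2l // mulr_gt0.
have good v : v \in A -> v \notin E ->
    (rr - xi - sg) * n <= #|nonout v :&: B|%:R /\ #|B|%:R - sg * n <= #|nonout v :&: B|%:R.
  move=> vA; rewrite inE vA /= -ltNge => hv.
  suff h : #|B|%:R - sg * n <= #|nonout v :&: B|%:R by split => //; move: h; lra.
  have e : [set y in B | G v y] = B :\: nonout v.
    by apply/setP => y; rewrite !inE negbK andbC.
  by have := cardR_ID R B (nonout v); rewrite -e setIC; lra.
have outB v : v \in A -> v \notin E -> #|nonout v :\: B|%:R <= (theta + xi + sg) * n.
  move=> vA vE; have [h _] := good v vA vE.
  by have := cardR_ID R (nonout v) B; have := ro v; lra.
have zz : (theta + xi + sg) * n <= ze * n.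
  by rewrite ler_wpM2r ?(ltW n0) //; rewrite /sg; lra.
pose K1 := A :\: B :\: E.
have K1A v : v \in K1 -> [/\ v \in A, v \notin B & v \notin E].
  by rewrite !inE => /and3P[-> -> ->].
pose F := [set v in K1 | ze * n <= #|[set y in K1 | ~~ G y v]|%:R].
have Fn : #|F|%:R <= ze / 2 * n.
  have hm : ze * n * #|F|%:R <= \sum_(v in K1) #|[set y in K1 | ~~ G y v]|%:R.
    by rewrite /F; apply: card_markov.
  have hs : \sum_(v in K1) #|[set y in K1 | ~~ G y v]|%:R <= n * ((theta + xi + sg) * n).
    rewrite (double_count _ _ _ (fun v y => ~~ G y v)).
    apply: (@le_trans _ _ (\sum_(y in K1) (theta + xi + sg) * n)).
      apply: ler_sum => y /K1A[yA yB yE]; apply: le_trans (outB y yA yE).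
      by apply/lecard/subsetP => v; rewrite !inE => /andP[/and3P[_ -> _] ->].
    rewrite sumr_const -[X in X <= _]mulr_natl ler_wpM2r //.
      by rewrite mulr_ge0 ?(ltW n0) //; rewrite /sg; lra.
    by rewrite ler_nat max_card.
  have : ze * n * #|F|%:R <= ze * n * (ze / 2 * n).
    apply: (le_trans hm); apply: (le_trans hs).
    have -> : ze * n * (ze / 2 * n) = n * (ze ^+ 2 / 2 * n) by field.
    apply: ler_wpM2l; first exact: ltW.
    by rewrite ler_wpM2r ?(ltW n0) //; rewrite /sg; lra.
  by rewrite ler_pM2l // mulr_gt0.
pose K := K1 :\: F.
have KA v : v \in K -> [/\ v \in K1 & v \notin F] by rewrite inE => /andP[-> ->].
have sKAB : K \subset A :\: B.
  by apply/subsetP => v /KA[/K1A[vA vB _] _]; rewrite inE vA vB.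
have cK : #|A :\: B|%:R <= #|K|%:R + ze * n.
  by have := cardR_D R (A :\: B) E; have := cardR_D R K1 F; rewrite -/K1 -/K; lra.
have cAB := cardR_ID R A B.
have xin : (xi + ze + gam / 4) * n <= gam * n by rewrite ler_wpM2r ?(ltW n0) //; lra.
have Kbig : gam / 4 * n <= #|K|%:R by move: xin; lra.
have K0 : (0 < #|K|)%N.
  by rewrite -(ltr_nat R); apply: lt_le_trans Kbig; rewrite mulr_gt0 //; lra.
exists K; split => //; rewrite -/rr.
- by move: cK; lra.
- have : xi * n <= ze * n by rewrite ler_wpM2r ?(ltW n0) //; lra.
  by move: hA; lra.
- case/card_gt0P: K0 => v /KA[/K1A[vA _ vE] _].
  have [_ h] := good v vA vE; have := ro v.
  have := lecard R (subsetIl (nonout v) B).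
  have : (theta + sg) * n <= ze * n by rewrite ler_wpM2r ?(ltW n0) //; rewrite /sg; lra.
  by move: h; lra.
- apply: (@le_trans _ _ #|E|%:R); last by have := mulr_gt0 ze0 n0; move: En; lra.
  apply/lecard/subsetP => v; rewrite inE => /andP[vA]; apply: contraLR => vE.
  by rewrite -leNgt (le_trans (outB v vA vE)).
- by move=> v /KA[/K1A[vA _ vE] _]; rewrite (le_trans (outB v vA vE)).
- move=> v /KA[vK1]; rewrite inE vK1 -ltNge => /ltW; apply: le_trans.
  by apply/lecard/subsetP => y; rewrite !inE => /andP[-> /andP[_ ->]].
Qed.

Lemma near_clique_ncompat gam ze A B K i k x : near_clique gam ze A B K ->
  x \in K -> i != k -> #|K :&: ncompat i k x|%:R <= ze * n.
Proof.
move=> nc xK nik; rewrite ncompatE //; case: ifP => _; last by rewrite setIC; apply: nc_in nc _ xK.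
apply: le_trans (nc_out nc xK); apply/lecard/subsetP => y.
rewrite !inE => /andP[yK ->]; rewrite andbT.
by have /subsetP/(_ y yK) := nc_sub nc; rewrite inE => /andP[].
Qed.

Lemma near_clique_copies gam ze A B K (K0 : {set V}) (h : R) :
  0 < n -> 0 <= ze -> near_clique gam ze A B K -> K0 \subset K -> 0 <= h ->
  r%:R * ze * n + h <= #|K0|%:R ->
  h ^+ r <= #|[set f | copy f && [forall i, f i \in K0]]|%:R.
Proof.
move=> n0 ze0 nc sK0 h0 hK0.
have := @greedy_place (fun _ _ => K0) xpredT set0 setT h h0 (sub0set _) _ _ _.
rewrite setD0 cardsT card_ord => gp.
have {gp}gp : h ^+ r * #|[set f | partial set0 f && xpredT f]|%:R <=
  #|[set f | [&& partial setT f, xpredT f & [forall i in setT, f i \in K0]]]|%:R * n ^+ r.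
  apply: gp => // L k f _ _ _ kL pL _ hf.
  have zen : 0 <= ze * n by rewrite mulr_ge0 // ltW.
  apply: (@le_trans _ _ (#|K0|%:R - #|L|%:R * (ze * n))).
    have : #|L|%:R * (ze * n) <= r%:R * (ze * n).
      by rewrite ler_wpM2r // ler_nat -[X in (_ <= X)%N]card_ord max_card.
    by move: hK0; rewrite mulrA; lra.
  apply: cand_card => i iL; apply: le_trans (near_clique_ncompat nc (subsetP sK0 _ (hf i iL _)) _).
  - by apply/lecard/setSI.
  - by rewrite inE.
  - by apply: contraNneq kL => <-.
have e0 : [set f | partial set0 f && xpredT f] = setT.
  by apply/setP => f; rewrite !inE partial0.
rewrite e0 cardsT card_ffun card_ord natrX in gp.
rewrite -(ler_pM2r (exprn_gt0 r n0)) (le_trans gp) // ler_wpM2r ?exprn_ge0 //.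
apply/lecard/subsetP => f; rewrite !inE => /and3P[cf _ /forall_inP hf].
by rewrite /copy cf; apply/forallP => i; apply: hf; rewrite inE.
Qed.

End Copies.

(** * Copies in sets of nonnegative weight *)

Section RankArithmetic.
Variable R : realType.

(* [E] measures how far the [b]s are from their upper bounds; the averaged inequality forces it
   to be tiny compared with the total drop [X] of the sequence [a], and then the inequalities for
   [b] bound each drop by the previous ones, so that [X] itself would be zero. *)
Lemma rank_arith (r0 : nat) (a b : nat -> R) (al th dl g eta : R) :
  let r := r0.+1%:R : R in
  (forall j, (0 < j <= r0)%N -> a j <= b j <= a j.-1) ->
  dl = r^-1 + th -> 0 <= th -> 0 < eta -> 0 <= al -> al <= 1 / 2 -> al <= eta / (4 * r) ->
  0 < g -> g <= 1 -> 5 * r * (th * r + al) * (1 + r) ^+ r0.+1 < g ->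
  0 <= al + \sum_(0 <= j < r0) ((dl - g) * a j + g * b j.+1) + (1 - r0%:R * dl - al) * a r0 ->
  \sum_(0 <= i < r0.+1) a i < - eta ->
  (forall j, (0 < j <= r0)%N ->
     j.+1%:R * b j + \sum_(j.+1 <= i < r0.+1) a i < - eta) ->
  False.
Proof.
move=> r hab dlE th0 eta0 al0 al1 al2 g0 g1 gbig tot.
set S := \sum_(0 <= i < r0.+1) a i => hS hb.
have r1 : 1 <= r by rewrite /r -natr1 lerDr.
have r0' : 0 < r by apply: lt_le_trans r1.
have mono i j : (i <= j <= r0)%N -> a j <= a i.
  elim: j => [|j IH]; first by case: i.
  rewrite leq_eqVlt => /andP[/orP[/eqP->//|ij] jr].
  apply: (@le_trans _ _ (a j)); last by apply: IH; nlia.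
  by have /andP[h1 h2] := hab j.+1 ltac:(nlia); apply: le_trans h1 h2.
pose X := a 0%N - a r0.
have X0 : 0 <= X by rewrite subr_ge0 mono // leq0n leqnn.
pose E := \sum_(0 <= j < r0) (a j - b j.+1).
have SE : S = \sum_(0 <= j < r0) a j + a r0 by rewrite /S big_nat_recr.
have Sle : S <= r * a 0%N.
  rewrite /S big_mkord mulr_natl -[X in _ *+ X]card_ord -sumr_const.
  by apply: ler_sum => i _; apply: mono; have := ltn_ord i; nlia.
have eE : \sum_(0 <= j < r0) ((dl - g) * a j + g * b j.+1) = dl * (S - a r0) - g * E.
  rewrite SE addrK /E !mulr_sumr -sumrB; apply: eq_bigr => j _; ring.
rewrite eE in tot.
have rN : r0%:R = r - 1 by rewrite /r -natr1 addrK.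
have rV : r * r^-1 = 1 by rewrite divff // gt_eqF.
have iv0 : 0 < r^-1 by rewrite invr_gt0.
set q := r^-1 in dlE rV iv0.
have tau0 : 0 <= th * r + al by rewrite addr_ge0 // mulr_ge0 // ltW.
have hE : g * E <= (th * r + al) * X + q * S / 4.
  have p1 : th * (S - r * a r0) <= th * (r * X).
    by apply: ler_wpM2l => //; rewrite /X; lra.
  have p0 : q * S <= q * (r * a 0%N) by rewrite ler_pM2l.
  have p0' : q * (r * a 0%N) = a 0%N by rewrite mulrA (mulrC q) rV mul1r.
  have p2 : al * (- a r0) <= al * (X - q * S).
    by apply: ler_wpM2l => //; rewrite /X; lra.
  have p3 : (1 / 2 - al) * (q * S) <= 0.
    by rewrite mulr_ge0_le0 ?subr_ge0 // pmulr_rle0 //; lra.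
  have p4 : q * S <= q * - eta by rewrite ler_pM2l // ltW.
  have p5 : eta / (4 * r) = q * eta / 4.
    by rewrite invfM -/q; field.
  have p6 : (1 - r0%:R * dl - al) * a r0 = - (dl * (r * a r0)) + a r0 + dl * a r0 - al * a r0.
    by rewrite rN; ring.
  have p7 : dl * (r * a r0) = a r0 + th * (r * a r0).
    by rewrite dlE mulrDl mulrA (mulrC q) rV mul1r.
  have p8 : dl * S = q * S + th * S by rewrite dlE mulrDl.
  move: tot p1 p2 p3 al2; rewrite p6 p5 p7 !mulrBr !mulrBl p8; lra.
have qS : q * S < 0 by rewrite pmulr_rlt0 //; lra.
have SX : - S <= 4 * r * ((th * r + al) * X).
  have E0 : 0 <= E.
    rewrite /E big_mkord; apply: sumr_ge0 => j _; rewrite subr_ge0.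
    by have /andP[] := hab j.+1 ltac:(have := ltn_ord j; nlia).
  have h : - (q * S) <= 4 * ((th * r + al) * X).
    by have := mulr_ge0 (ltW g0) E0; move: hE; lra.
  have := ler_wpM2l (ltW r0') h.
  by rewrite mulrN !mulrA rV mul1r; lra.
have ej j : (j < r0)%N -> g * (a j - b j.+1) <= (th * r + al) * X.
  move=> jr; apply: (@le_trans _ _ (g * E)); last by move: hE; lra.
  rewrite ler_pM2l // /E big_mkord (bigD1 (Ordinal jr)) //= lerDl.
  apply: sumr_ge0 => i _; rewrite subr_ge0.
  by have /andP[] := hab i.+1 ltac:(have := ltn_ord i; nlia).
pose Q := 5 * r * (th * r + al) * X.
have Q0 : 0 <= Q by rewrite /Q mulr_ge0 // mulr_ge0 // mulr_ge0 // ltW.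
have main j : (j <= r0)%N -> g * (a 0%N - a j) <= ((1 + r) ^+ j - 1) * Q.
  elim: j => [|j IH] jr; first by rewrite expr0 !subrr mulr0 mul0r.
  have {}IH := IH ltac:(nlia).
  have hbj := hb j.+1 ltac:(nlia).
  have hs : \sum_(0 <= i < r0.+1) a i = \sum_(0 <= i < j.+1) a i + a j.+1
      + \sum_(j.+2 <= i < r0.+1) a i.
    by rewrite (@big_cat_nat _ _ _ j.+2) //= big_nat_recr.
  rewrite -/S in hs.
  have h0 : \sum_(0 <= i < j.+1) a i <= j.+1%:R * a 0%N.
    rewrite big_mkord mulr_natl -[X in _ *+ X]card_ord -sumr_const.
    by apply: ler_sum => i _; apply: mono; have := ltn_ord i; nlia.
  have h1 : a 0%N - a j.+1 <= j.+2%:R * (a 0%N - b j.+1) - S.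
    have e : j.+2%:R = j.+1%:R + 1 :> R by rewrite natr1.
    by rewrite mulrBr e !mulrDl mul1r; move: hbj; rewrite e mulrDl mul1r; lra.
  have /andP[_ /= bj] := hab j.+1 ltac:(nlia).
  have aj : a j <= a 0%N by apply: mono; nlia.
  have h2 : j.+2%:R * (a 0%N - b j.+1) <= r * (a 0%N - b j.+1).
    by rewrite ler_wpM2r ?ler_nat ?ltnS //; lra.
  have h3 : g * (a 0%N - a j.+1) <= g * (r * (a 0%N - b j.+1) - S).
    by rewrite ler_pM2l //; lra.
  have h4 : r * (g * (a j - b j.+1)) <= r * ((th * r + al) * X).
    by rewrite ler_pM2l // ej.
  have h5 : g * - S <= 1 * - S by rewrite ler_wpM2r //; lra.
  have h6 : r * (g * (a 0%N - a j)) <= r * (((1 + r) ^+ j - 1) * Q) by rewrite ler_pM2l.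
  have h7 : 0 <= ((1 + r) ^+ j - 1) * Q.
    by rewrite mulr_ge0 // subr_ge0 exprn_ege1 // lerDl ltW.
  have h8 : ((1 + r) ^+ j.+1 - 1) * Q =
     r * (((1 + r) ^+ j - 1) * Q) + ((1 + r) ^+ j - 1) * Q + r * Q.
    by rewrite exprS; ring.
  have h9 : Q <= r * Q by rewrite ler_peMl.
  have hQ : Q = r * ((th * r + al) * X) + 4 * r * ((th * r + al) * X) by rewrite /Q; ring.
  have h10 : g * (r * (a 0%N - b j.+1) - S) =
     r * (g * (a 0%N - a j)) + r * (g * (a j - b j.+1)) + g * - S by ring.
  by rewrite h8; move: h3; rewrite h10; lra.
have := main r0 (leqnn _); rewrite -/X => hX.
have Xp : 0 < X.
  rewrite lt_neqAle X0 andbT; apply/eqP => X00.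
  by move: SX; rewrite -X00 !mulr0; lra.
have e1 : ((1 + r) ^+ r0 - 1) * Q <= (1 + r) ^+ r0.+1 * Q.
  rewrite ler_wpM2r // exprS.
  have : 0 <= (1 + r) ^+ r0 by rewrite exprn_ge0 // addr_ge0 // ltW.
  by move=> h; have := mulr_ge0 (ltW r0') h; rewrite mulrDl mul1r; lra.
have e2 : (1 + r) ^+ r0.+1 * Q = 5 * r * (th * r + al) * (1 + r) ^+ r0.+1 * X.
  by rewrite /Q; ring.
have e3 : 5 * r * (th * r + al) * (1 + r) ^+ r0.+1 * X < g * X by rewrite ltr_pM2r.
by move: hX e1; rewrite e2; lra.
Qed.

End RankArithmetic.

Section Ranking.
Variables (R : realType) (V : finType) (y : V -> R) (v0 : V).

Definition ranking := sort (fun u v => y v <= y u) (enum V).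
Definition rk i := y (nth v0 ranking i).
Definition top k := [set x in take k ranking].

Let size_ranking : size ranking = #|V|.
Proof. by rewrite size_sort -cardE. Qed.

Lemma rk_mono i j : (i <= j < #|V|)%N -> rk j <= rk i.
Proof.
move=> /andP[ij jV].
have tr : transitive (fun u v : V => y v <= y u) by move=> a b c h1 h2; apply: le_trans h2 h1.
have st : sorted (fun u v => y v <= y u) ranking by apply: sort_sorted => u v; exact: le_total.
apply: (sorted_leq_nth tr (fun u => lexx (y u)) v0 st) => //; rewrite inE size_ranking //.
exact: leq_ltn_trans jV.
Qed.

Lemma top_card k : (k <= #|V|)%N -> #|top k| = k.
Proof.
move=> kV; rewrite cardsE.
have /card_uniqP-> : uniq (take k ranking) by rewrite take_uniq // sort_uniq enum_uniq.
by rewrite size_take size_ranking; case: ltngtP kV.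
Qed.

Lemma top_ge u k : (k <= #|V|)%N -> u \in top k -> rk k.-1 <= y u.
Proof.
move=> kV; rewrite inE => ut; rewrite -(nth_index v0 ut).
have : (index u (take k ranking) < size (take k ranking))%N by rewrite index_mem.
rewrite size_take size_ranking => hi.
have ik : (index u (take k ranking) < k)%N by move: hi; case: (ltnP k #|V|) => //; nlia.
by rewrite nth_take //; apply: rk_mono; nlia.
Qed.

Lemma sum_rk : \sum_v y v = \sum_(0 <= i < #|V|) rk i.
Proof.
have -> : \sum_v y v = \sum_(v <- ranking) y v.
  by rewrite [RHS](perm_big (enum V)) ?perm_sort //= big_enum.
by rewrite (big_nth v0) size_ranking.
Qed.

Lemma rank_sum (D g h r0 : nat) : (forall v, y v <= 1) ->
  (0 < h)%N -> (g <= D)%N -> (r0 * D + h <= #|V|)%N ->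
  \sum_v y v <= h%:R + \sum_(0 <= j < r0)
      ((D%:R - g%:R) * rk (j * D + h).-1 + g%:R * rk (j.+1 * D + h - g).-1)
    + (#|V|%:R - r0%:R * D%:R - h%:R) * rk (r0 * D + h).-1.
Proof.
move=> y1 h0 gD hn.
have block s t c : (s <= t)%N -> (forall i, (s <= i < t)%N -> rk i <= c) ->
    \sum_(s <= i < t) rk i <= (t%:R - s%:R) * c.
  move=> st hc; rewrite -natrB // mulr_natl -sumr_const_nat.
  by rewrite big_nat_cond [X in _ <= X]big_nat_cond; apply: ler_sum => i; rewrite andbT => /hc.
have part k : (k <= r0)%N -> \sum_(0 <= i < k * D + h) rk i <=
    h%:R + \sum_(0 <= j < k)
      ((D%:R - g%:R) * rk (j * D + h).-1 + g%:R * rk (j.+1 * D + h - g).-1).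
  elim: k => [|k IH] kr.
    rewrite mul0n add0n [\sum_(0 <= j < 0) _]big_geq // addr0.
    by have := block 0%N h 1 (leq0n _) (fun i _ => y1 _); rewrite subr0 mulr1.
  have kD : (k.+1 * D + h <= r0 * D + h)%N by rewrite leq_add2r leq_mul2r kr orbT.
  have kD1 : (k.+1 * D = D + k * D)%N by rewrite mulSn.
  rewrite big_nat_recr //= addrA.
  rewrite (@big_cat_nat _ _ _ (k * D + h)%N) //=; last by rewrite kD1; nlia.
  rewrite (@big_cat_nat _ _ _ (k.+1 * D + h - g)%N _ (k.+1 * D + h)%N) //=; try nlia.
  have b1 := @block (k * D + h)%N (k.+1 * D + h - g)%N (rk (k * D + h).-1) ltac:(nlia).
  have b2 := @block (k.+1 * D + h - g)%N (k.+1 * D + h)%N (rk (k.+1 * D + h - g).-1) ltac:(nlia).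
  have {b1} := b1 (fun i hi => rk_mono (i := (k * D + h).-1) (j := i) ltac:(nlia)).
  have {b2} := b2 (fun i hi => rk_mono (i := (k.+1 * D + h - g).-1) (j := i) ltac:(nlia)).
  have -> : (k.+1 * D + h)%:R - (k.+1 * D + h - g)%:R = g%:R :> R.
    by rewrite natrB ?subKr //; nlia.
  have -> : (k.+1 * D + h - g)%:R - (k * D + h)%:R = D%:R - g%:R :> R.
    by rewrite -!natrB; try nlia; congr (_%:R); nlia.
  by have := IH ltac:(nlia); lra.
rewrite sum_rk (@big_cat_nat _ _ _ (r0 * D + h)%N) //=.
have b3 := @block (r0 * D + h)%N #|V| (rk (r0 * D + h).-1) hn.
have {b3} := b3 (fun i hi => rk_mono (i := (r0 * D + h).-1) (j := i) ltac:(nlia)).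
by rewrite natrD natrM opprD addrA; have := part r0 (leqnn _); lra.
Qed.

End Ranking.

Section Prefix.
Variables (R : realType) (r0 : nat) (T : rel 'I_r0.+1) (V : finType) (G : rel V).
Hypothesis tourT : forall i j, i != j -> T i j (+) T j i.
Hypothesis irrG : irreflexive G.
Local Notation n := (#|V|%:R : R).
Local Notation copy := (copy T G).
Local Notation partial := (partial T G).
Variable S : 'I_r0.+1 -> {set V}.
Implicit Type f : {ffun 'I_r0.+1 -> V}.

Definition filled k f :=
  partial [set i : 'I_r0.+1 | (i < k)%N] f && [forall i : 'I_r0.+1, (i < k)%N ==> (f i \in S i)].

Let card_low k : (k <= r0.+1)%N -> #|[set i : 'I_r0.+1 | (i < k)%N]| = k.
Proof. by move=> kr; rewrite -sum1dep_card -(big_ord_widen _ (fun _ => 1%N) kr) sum1_card card_ord. Qed.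

Lemma filled_add k f v : (k < r0.+1)%N -> filled k f -> v \in S (inord k) ->
  (forall i : 'I_r0.+1, (i < k)%N -> compat T G i (inord k) (f i) v) ->
  filled k.+1 (upd f (inord k) v).
Proof.
move=> kr /andP[pf /forallP sf] vS hc; apply/andP; split.
  have -> : [set i : 'I_r0.+1 | (i < k.+1)%N] = inord k |: [set i : 'I_r0.+1 | (i < k)%N].
    by apply/setP => i; rewrite !inE -val_eqE /= inordK // ltnS leq_eqVlt.
  by apply: partial_upd => // [|i]; rewrite inE ?inordK ?ltnn //; apply: hc.
apply/forallP => i; apply/implyP; rewrite updE; case: eqVneq => [->//|nik].
rewrite ltnS leq_eqVlt => /orP[/eqP e|ik]; last by move/implyP: (sf i); apply.
by case/eqP: nik; apply/val_inj; rewrite /= inordK.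
Qed.

Lemma filled_all f : filled r0.+1 f -> copy f /\ forall i, f i \in S i.
Proof.
move=> /andP[pf /forallP sf]; split; last by move=> i; move/implyP: (sf i); apply.
by apply: partialS pf; apply/subsetP => i _; rewrite inE.
Qed.

Variable D : R.
Hypothesis ncD : forall i k x, i != k -> #|ncompat T G i k x|%:R <= D.

Lemma filled_cand k m f : (k <= m)%N -> (m < r0.+1)%N ->
  #|S (inord m)|%:R - k%:R * D <=
  #|[set v in S (inord m) | [forall i in [set i : 'I_r0.+1 | (i < k)%N],
      compat T G i (inord m) (f i) v]]|%:R.
Proof.
move=> km mr; have := @cand_card R _ T V G (S (inord m)) [set i : 'I_r0.+1 | (i < k)%N] (inord m) f D.
rewrite card_low; last by nlia.
apply=> i; rewrite inE => ik; apply: le_trans (ncD _ _ (i := i)).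
  by apply/lecard/subsetIr.
by apply/eqP => /(congr1 val) /=; rewrite inordK //; nlia.
Qed.

Lemma count_filled p k (h : R) : 0 <= h -> (p + k <= r0.+1)%N ->
  (forall j, (p <= j < p + k)%N -> h + j%:R * D <= #|S (inord j)|%:R) ->
  h ^+ k * #|[set f | filled p f]|%:R <= #|[set f | filled (p + k) f]|%:R * n ^+ k.
Proof.
move=> h0 pk hh; apply: (@greedy_iter _ _ _ filled inord) => // j f jj pf.
have jr : (j < r0.+1)%N by move: jj pk; nlia.
apply: le_trans (_ : #|S (inord j)|%:R - j%:R * D <= _); first by have := hh j jj; lra.
apply: (le_trans (filled_cand f (leqnn j) jr)).
apply/lecard/subsetP => v; rewrite !inE => /andP[vS /forall_inP hc].
by apply: filled_add => // i ij; apply: hc; rewrite inE.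
Qed.

Variables (gam theta xi ze kap : R).
Hypotheses (n0 : 0 < n) (rob : robust r0.+1 G theta gam) (ze0 : 0 < ze) (zeg : ze <= gam / 8).
Hypotheses (ze1 : ze <= 1) (th0 : 0 <= theta) (xi0 : 0 <= xi) (thxi : theta + xi <= ze ^+ 2 / 4).
Hypotheses (kap0 : 0 < kap) (kapz : kap <= ze ^+ 3 / 8).

Lemma filled_pair j f (S0 : {set V}) : (j.+1 < r0.+1)%N ->
  S (inord j) = S0 -> S (inord j.+1) = S0 ->
  (r0.+1%:R^-1 - xi) * n + j%:R * D <= #|S0|%:R -> filled j f ->
  kap * n ^+ 2 <=
     #|[set p : V * V | filled j.+2 (upd (upd f (inord j) p.1) (inord j.+1) p.2)]|%:R
  \/ exists A B K, near_clique r0.+1 G gam ze A B K /\ K \subset S0.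
Proof.
move=> jr Sj Sj1 hS pf.
have {hS}hS : (r0.+1%:R^-1 - xi) * n <= #|S0|%:R - j%:R * D by rewrite lerBrDr.
have jr' : (j < r0.+1)%N by nlia.
set oj : 'I_r0.+1 := inord j; set oj1 : 'I_r0.+1 := inord j.+1.
have nj : oj != oj1 by apply/eqP => /(congr1 val) /=; rewrite !inordK //; nlia.
pose A := [set v in S oj | [forall i in [set i : 'I_r0.+1 | (i < j)%N], compat T G i oj (f i) v]].
pose B := [set v in S oj1 | [forall i in [set i : 'I_r0.+1 | (i < j)%N], compat T G i oj1 (f i) v]].
have hA : (r0.+1%:R^-1 - xi) * n <= #|A|%:R.
  by apply: (le_trans hS); have := filled_cand f (leqnn j) jr'; rewrite -/oj -/A Sj.
have hB : (r0.+1%:R^-1 - xi) * n <= #|B|%:R.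
  by apply: (le_trans hS); have := filled_cand f (leqnSn j) jr; rewrite -/oj1 -/B Sj1.
have ext u v : u \in A -> v \in B -> compat T G oj oj1 u v ->
    filled j.+2 (upd (upd f oj u) oj1 v).
  rewrite !inE => /andP[uS /forall_inP uc] /andP[vS /forall_inP vc] uv.
  apply: filled_add => // [|i].
    by apply: filled_add => // i ij; apply: uc; rewrite inE.
  rewrite updE; case: eqVneq => [->//|nio].
  rewrite ltnS leq_eqVlt => /orP[/eqP e|ij]; last by apply: vc; rewrite inE.
  by case/eqP: nio; apply/val_inj; rewrite /= inordK.
have sA : A \subset S0 by rewrite -Sj; apply/subsetP => v; rewrite inE => /andP[].
have sB : B \subset S0 by rewrite -Sj1; apply/subsetP => v; rewrite inE => /andP[].
have [Tj|nTj] := boolP (T oj oj1).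
  have [ge|/ltW le] := lerP (kap * n ^+ 2)
      #|[set p : V * V | [&& p.1 \in A, p.2 \in B & G p.1 p.2]]|%:R.
    left; apply: (le_trans ge); apply/lecard/subsetP => p.
    rewrite !inE -/A -/B => /and3P[pA pB pG]; apply: ext; rewrite ?inE //.
    by rewrite compat_out.
  right; have [K nc] := near_clique_of_sparse n0 rob ze0 zeg ze1 th0 xi0 thxi kap0 kapz hA hB le.
  exists A, B, K; split=> //; apply: subset_trans sA.
  by apply: subset_trans (nc_sub nc) (subsetDl _ _).
have Tj : T oj1 oj by have := tourT nj; rewrite (negbTE nTj).
have [ge|/ltW le] := lerP (kap * n ^+ 2)
    #|[set p : V * V | [&& p.1 \in B, p.2 \in A & G p.1 p.2]]|%:R.
  left; apply: (le_trans ge).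
  pose sw (p : V * V) := (p.2, p.1).
  have swi : injective sw by move=> [a b] [c d] [-> ->].
  rewrite -(card_imset _ swi); apply/lecard/subsetP => p /imsetP[[v u]].
  rewrite inE /= => /and3P[vB uA Guv] ->; rewrite inE /=; apply: ext => //.
  by rewrite compat_in.
right; have [K nc] := near_clique_of_sparse n0 rob ze0 zeg ze1 th0 xi0 thxi kap0 kapz hB hA le.
exists B, A, K; split=> //; apply: subset_trans sB.
by apply: subset_trans (nc_sub nc) (subsetDl _ _).
Qed.

Lemma count_with_pair j (S0 : {set V}) (al : R) :
  (0 < j <= r0)%N -> 0 <= al -> al <= 1 -> gam <= 1 ->
  ze <= gam / (8 * r0.+1%:R) ->
  (forall i : 'I_r0.+1, (i <= j)%N -> S i = S0) ->
  (forall i : nat, (j < i < r0.+1)%N -> al * n + i%:R * D <= #|S (inord i)|%:R) ->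
  (r0.+1%:R^-1 - xi) * n + j.-1%:R * D <= #|S0|%:R ->
  (forall i : nat, (i < j.-1)%N -> al * n + i%:R * D <= #|S0|%:R) ->
  kap * al ^+ r0.+1 * (gam / 8) ^+ r0.+1 * n ^+ r0.+1 <=
    #|[set f | copy f && [forall i, f i \in S i]]|%:R \/
  kap * al ^+ r0.+1 * (gam / 8) ^+ r0.+1 * n ^+ r0.+1 <=
    #|[set f | copy f && [forall i, f i \in S0]]|%:R.
Proof.
case: j => // j /andP[_ jr] al0 al1 g1 zeg8 hlow hhigh hS0 hS0'; rewrite /= in hS0 hS0'.
have g0 : 0 < gam / 8 by apply: lt_le_trans zeg.
have kap1 : kap <= 1.
  have z3 : ze ^+ 3 <= 1 by rewrite exprn_ile1 // ltW.
  by apply: (le_trans kapz); rewrite ler_pdivrMr // (le_trans z3) // mul1r ler1n.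
have aln : 0 <= al * n by rewrite mulr_ge0 // ltW.
have Slow i : (i <= j.+1)%N -> S (inord i) = S0.
  by move=> ij; apply: hlow; rewrite inordK //; nlia.
have ak k : al ^+ k <= 1 by rewrite exprn_ile1.
have gk k : (gam / 8) ^+ k <= 1 by rewrite exprn_ile1 ?ltW //; lra.
have ak0 k : 0 <= al ^+ k by rewrite exprn_ge0.
have gk0 k : 0 <= (gam / 8) ^+ k by rewrite exprn_ge0 // ltW.
have [/existsP[f /existsP[K /existsP[A /existsP[B /andP[pf /andP[/asboolP nc sK]]]]]]|] :=
  boolP [exists f, exists K : {set V}, exists A : {set V}, exists B : {set V},
     filled j f && (`[< near_clique r0.+1 G gam ze A B K >] && (K \subset S0))].
  right; have rz : r0.+1%:R * ze <= gam / 8.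
    have : (r0.+1%:R : R) != 0 by rewrite pnatr_eq0.
    move: zeg8 (ltr0Sn R r0); set rR := r0.+1%:R => zeg8 rR0 rRn.
    apply: (le_trans (ler_wpM2l (ltW rR0) zeg8)).
    by rewrite (_ : rR * _ = gam / 8) //; field; rewrite addrC natr1.
  have rzn := ler_wpM2r (ltW n0) rz.
  have := @near_clique_copies R r0.+1 T V G tourT gam ze A B K K (gam / 8 * n) n0 (ltW ze0) nc
     (subxx _) (mulr_ge0 (ltW g0) (ltW n0)).
  have Kb := nc_big nc; have -> : r0.+1%:R * ze * n + gam / 8 * n <= #|K|%:R by lra.
  move=> /(_ isT) hK; apply: (@le_trans _ _ ((gam / 8 * n) ^+ r0.+1)).
    rewrite [X in _ <= X]exprMn ler_wpM2r ?exprn_ge0 // ler_piMl //.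
    by rewrite mulr_ile1 // ltW.
  apply: (le_trans hK); apply/lecard/subsetP => h; rewrite !inE => /andP[-> /forallP hh].
  by apply/forallP => i; apply: (subsetP sK).
move=> none; left.
have c1 : (al * n) ^+ j * n ^+ r0.+1 <= #|[set f | filled j f]|%:R * n ^+ j.
  have := @count_filled 0%N j (al * n) aln; rewrite add0n.
  have -> : [set f | filled 0 f] = setT.
    apply/setP => f; rewrite !inE /filled; apply/andP; split; last by apply/forallP.
    by apply/partialP => i; rewrite inE.
  rewrite cardsT card_ffun card_ord natrX; apply; first by nlia.
  by move=> i ij; rewrite Slow; [apply: hS0'|]; nlia.
have c2 : kap * n ^+ 2 * #|[set f | filled j f]|%:R <= #|[set f | filled j.+2 f]|%:R * n ^+ 2.
  apply: (@step_count2 _ _ _ _ _ (inord j) (inord j.+1)).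
    by apply/eqP => /(congr1 val) /=; rewrite !inordK //; nlia.
  move=> f; rewrite inE => pf.
  have jr2 : (j.+1 < r0.+1)%N by nlia.
  case: (filled_pair jr2 (Slow j (leqnSn j)) (Slow j.+1 (leqnn _)) hS0 pf) => [h|[A [B [K [nc sK]]]]].
  - by apply: (le_trans h); apply/lecard/subsetP => p; rewrite !inE.
  - case/negP: none; apply/existsP; exists f; apply/existsP; exists K.
    by apply/existsP; exists A; apply/existsP; exists B; rewrite pf sK andbT; apply/asboolP.
have c3 : (al * n) ^+ (r0.+1 - j.+2) * #|[set f | filled j.+2 f]|%:R <=
   #|[set f | filled r0.+1 f]|%:R * n ^+ (r0.+1 - j.+2).
  have := @count_filled j.+2 (r0.+1 - j.+2) (al * n) aln; rewrite subnKC //.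
  by apply => // i ij; apply: hhigh; nlia.
have fin : #|[set f | filled r0.+1 f]|%:R <=
    #|[set f | copy f && [forall i, f i \in S i]]|%:R :> R.
  by apply/lecard/subsetP => f; rewrite !inE => /filled_all[-> /forallP].
apply: le_trans fin.
set X := #|[set f | filled j f]|%:R in c1 c2.
set Y := #|[set f | filled j.+2 f]|%:R in c2 c3.
set Z := #|[set f | filled r0.+1 f]|%:R in c3 *.
have np k : 0 < n ^+ k by rewrite exprn_gt0.
have d1 : al ^+ j * n ^+ r0.+1 <= X.
  by rewrite -(ler_pM2r (np j)) mulrAC -exprMn.
have d2 : kap * X <= Y by rewrite -(ler_pM2r (np 2%N)) mulrAC.
have d3 : al ^+ (r0.+1 - j.+2) * Y <= Z.
  by rewrite -(ler_pM2r (np (r0.+1 - j.+2)%N)) mulrAC -exprMn.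
have d4 : kap * (al ^+ (r0.+1 - j.+2) * al ^+ j) * n ^+ r0.+1 <= Z.
  apply: le_trans d3; apply: le_trans (ler_wpM2l (ak0 _) d2).
  have := ler_wpM2l (mulr_ge0 (ltW kap0) (ak0 (r0.+1 - j.+2)%N)) d1.
  by rewrite !mulrA ![al ^+ _ * kap]mulrC.
apply: le_trans d4; rewrite ler_wpM2r ?(ltW (np _)) // -mulrA ler_wpM2l ?(ltW kap0) //.
have -> : al ^+ r0.+1 = al ^+ (r0.+1 - j.+2) * al ^+ j * al ^+ 2.
  by rewrite -!exprD; congr (_ ^+ _); nlia.
by rewrite -[X in X <= _]mulrA ler_piMr ?mulr_ge0 // mulr_ile1.
Qed.

End Prefix.

Section SelectionCore.
Variables (R : realType) (r0 : nat) (T : rel 'I_r0.+1) (V : finType) (G : rel V).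
Hypothesis tourT : forall i j, i != j -> T i j (+) T j i.
Local Notation n := (#|V|%:R : R).
Variables (y : V -> R) (v0 : V) (eta c : R) (D g h : nat).
Variables (gam theta xi ze kap al : R).
Hypothesis y1 : forall v, y v <= 1.
Hypothesis few : #|[set f : {ffun 'I_r0.+1 -> V} |
  copy T G f && (- eta <= \sum_i y (f i))]|%:R < c * n ^+ r0.+1.
Hypotheses (h0 : (0 < h)%N) (gD : (g < D)%N) (hn : (r0 * D + h <= #|V|)%N).
Local Notation a := (fun j => rk y v0 (j * D + h).-1).
Local Notation b := (fun j => rk y v0 (j * D + h - g).-1).

Lemma pick_bad (F : pred {ffun 'I_r0.+1 -> V}) :
  c * n ^+ r0.+1 <= #|[set f | copy T G f && F f]|%:R ->
  exists2 f, F f & \sum_i y (f i) < - eta.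
Proof.
move=> hF; apply/not_exists2P => none.
suff /(lecard R) : [set f | copy T G f && F f] \subset
    [set f | copy T G f && (- eta <= \sum_i y (f i))].
  by move=> /(le_trans hF); rewrite leNgt few.
apply/subsetP => f; rewrite !inE => /andP[-> Ff] /=.
by have := none f; case=> // /negP; rewrite -leNgt.
Qed.

Let jD j k : (j <= k)%N -> (j * D <= k * D)%N.
Proof. by move=> jk; rewrite leq_mul2r jk orbT. Qed.

Lemma rk_interleave j : (0 < j <= r0)%N -> a j <= b j <= a j.-1.
Proof.
case: j => // j /andP[_ jr] /=; have := jD jr; have e : (j.+1 * D = D + j * D)%N by rewrite mulSn.
by move=> jrD; apply/andP; split; apply: rk_mono; apply/andP; split; nlia.
Qed.

Lemma rk_steps i j : (i <= j <= r0)%N -> a j <= a i.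
Proof.
move=> /andP[ij jr]; have := jD jr; have := jD ij => h1 h2.
by apply: rk_mono; apply/andP; split; nlia.
Qed.

Hypotheses (n0 : 0 < n) (rob : robust r0.+1 G theta gam) (ze0 : 0 < ze) (zeg : ze <= gam / 8).
Hypotheses (ze1 : ze <= 1) (th0 : 0 <= theta) (xi0 : 0 <= xi) (thxi : theta + xi <= ze ^+ 2 / 4).
Hypotheses (kap0 : 0 < kap) (kapz : kap <= ze ^+ 3 / 8) (al0 : 0 < al) (al1 : al <= 1).
Hypotheses (g1 : gam <= 1) (zeg8 : ze <= gam / (8 * r0.+1%:R)).
Hypothesis cE : c = kap * al ^+ r0.+1 * (gam / 8) ^+ r0.+1.
Hypothesis alh : al * n <= h%:R.
Hypothesis ncD : forall i k x, i != k -> #|ncompat T G i k x|%:R <= D%:R :> R.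
Hypothesis DgE : (r0.+1%:R^-1 - xi) * n <= D%:R + h%:R - g%:R.

Let Scard k : (k <= r0)%N -> #|top y (k * D + h)| = (k * D + h)%N.
Proof. by move=> kr; apply: top_card; have := jD kr; nlia. Qed.

Let Scard' k : (k <= r0)%N -> #|top y (k * D + h - g)| = (k * D + h - g)%N.
Proof. by move=> kr; apply: top_card; have := jD kr; nlia. Qed.

Lemma constraint0 : \sum_(0 <= i < r0.+1) a i < - eta.
Proof.
pose S (i : 'I_r0.+1) := top y (i * D + h).
have alh0 : 0 <= al * n by rewrite mulr_ge0 // ltW.
have cnt : (al * n) ^+ r0.+1 <= #|[set f | filled T G S r0.+1 f]|%:R.
  have := @count_filled R _ T V G S D%:R ncD 0%N r0.+1 (al * n) alh0; rewrite add0n.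
  have -> : [set f | filled T G S 0 f] = setT.
    apply/setP => f; rewrite !inE /filled; apply/andP; split; last by apply/forallP.
    by apply/partialP => i; rewrite inE.
  rewrite cardsT card_ffun card_ord natrX ler_pM2r ?exprn_gt0 //; apply => // j jr.
  rewrite /S inordK // Scard; last by nlia.
  by rewrite natrD natrM; move: alh; lra.
have [f /forallP fS] : exists2 f : {ffun 'I_r0.+1 -> V}, [forall i, f i \in S i] & \sum_i y (f i) < - eta.
  apply: pick_bad; apply: (@le_trans _ _ #|[set f | filled T G S r0.+1 f]|%:R); last first.
    by apply/lecard/subsetP => f; rewrite !inE => /filled_all[-> /forallP].
  apply: le_trans cnt; rewrite exprMn ler_wpM2r ?exprn_ge0 // cE mulrAC ler_piMl ?exprn_ge0 ?(ltW al0) //.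
  have g0 : 0 < gam / 8 by apply: lt_le_trans zeg.
  have z3 : ze ^+ 3 <= 1 by rewrite exprn_ile1 // ltW.
  rewrite mulr_ile1 ?exprn_ge0 ?exprn_ile1 ?(ltW g0) ?(ltW kap0) //; last by move: g1; lra.
  by apply: (le_trans kapz); rewrite ler_pdivrMr // (le_trans z3) // mul1r ler1n.
apply: le_lt_trans; rewrite big_mkord; apply: ler_sum => i _.
by apply: top_ge; [rewrite -(Scard (leq_ord i)) max_card | exact: fS].
Qed.

Lemma constraint j : (0 < j <= r0)%N ->
  j.+1%:R * b j + \sum_(j.+1 <= i < r0.+1) a i < - eta.
Proof.
move=> /andP[j0 jr].
pose S0 := top y (j * D + h - g).
pose S (i : 'I_r0.+1) := if (i <= j)%N then S0 else top y (i * D + h).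
have alh0 : 0 <= al * n by rewrite mulr_ge0 // ltW.
have ghD : (g <= j * D + h)%N by have := @jD 1 j j0; rewrite mul1n; nlia.
have S0c : #|S0|%:R = j%:R * D%:R + h%:R - g%:R :> R.
  by rewrite /S0 Scard' // natrB // natrD natrM.
have jm : j%:R = j.-1%:R + 1 :> R by rewrite natr1 prednK.
have cnt := @count_with_pair R r0 T V G tourT S D%:R ncD gam theta xi ze kap
  n0 rob ze0 zeg ze1 th0 xi0 thxi kap0 kapz j S0 al.
rewrite j0 jr (ltW al0) -cE in cnt.
have {}cnt := cnt isT isT al1 g1 zeg8.
have {cnt} := cnt _ _ _ _.
have split_sum (F : nat -> R) : \sum_(0 <= i < r0.+1) F i =
    \sum_(0 <= i < j.+1) F i + \sum_(j.+1 <= i < r0.+1) F i.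
  by rewrite (@big_cat_nat _ _ _ j.+1).
have low : \sum_(0 <= i < r0.+1) (if (i <= j)%N then b j else a i) =
    j.+1%:R * b j + \sum_(j.+1 <= i < r0.+1) a i.
  rewrite split_sum; congr (_ + _).
    rewrite big_nat_cond (eq_bigr (fun _ => b j)); last by move=> i; rewrite andbT ltnS => /andP[_ ->].
    by rewrite -big_nat_cond sumr_const_nat subn0 mulr_natl.
  rewrite big_nat_cond [RHS]big_nat_cond; apply: eq_bigr => i; rewrite andbT => /andP[ij _].
  by rewrite leqNgt ij.
have bS u : u \in S0 -> b j <= y u.
  by apply: top_ge; rewrite -(Scard' jr) max_card.
case=> [i ij|i /andP[ji ir]||i ij||].
- by rewrite /S ij.
- by rewrite /S inordK // leqNgt ji /= Scard // natrD natrM; move: alh; lra.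
- rewrite S0c jm [(j.-1%:R + 1) * _]mulrDl mul1r -lerBrDr; apply: (le_trans DgE).
  by move: (j.-1%:R * D%:R : R) => w; lra.
- have ij1 : i.+1%:R * D%:R <= j%:R * D%:R :> R.
    by rewrite -!natrM ler_nat; apply: jD; nlia.
  have gDR : g%:R <= D%:R :> R by rewrite ler_nat ltnW.
  move: ij1; rewrite -[i.+1%:R]natr1 [(i%:R + 1) * _]mulrDl mul1r S0c => ij1.
  by move: ij1 alh gDR; move: (i%:R * D%:R : R) (j%:R * D%:R : R) => w w'; lra.
- case/pick_bad => f /forallP fS; apply: le_lt_trans; rewrite -low big_mkord.
  apply: ler_sum => i _; have := fS i; rewrite /S; case: ifP => ij; first exact: bS.
  by apply: top_ge; rewrite -(Scard (leq_ord i)) max_card.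
- case/pick_bad => f /forallP fS; apply: le_lt_trans; rewrite -low big_mkord.
  apply: ler_sum => i _; apply: le_trans (bS _ (fS i)); case: ifP => // /negbT; rewrite -ltnNge => ij.
  have /andP[+ _] := rk_interleave (j := j) ltac:(by rewrite j0).
  by apply: le_trans; apply: rk_steps; rewrite (ltnW ij) leq_ord.
Qed.

End SelectionCore.

Section RobustSelection.
Variable R : realType.

Lemma robust_selection (r0 : nat) (gam : R) : (0 < r0)%N -> 0 < gam -> gam <= 1 ->
  exists2 theta : R, 0 < theta & forall eta : R, 0 < eta ->
  exists2 c : R, 0 < c & exists N : nat,
  forall (T : rel 'I_r0.+1) (V : finType) (G : rel V),
    (forall i j, i != j -> T i j (+) T j i) -> (N <= #|V|)%N ->
    robust r0.+1 G theta gam ->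
  forall y : V -> R, (forall v, y v <= 1) -> 0 <= \sum_v y v ->
  c * #|V|%:R ^+ r0.+1 <=
    #|[set f | copy T G f && (- eta <= \sum_i y (f i))]|%:R.
Proof.
move=> r0p gam0 gam1.
have rr1 : 2 <= (r0.+1%:R : R) by rewrite ler_nat.
have rr0 : 0 < (r0.+1%:R : R) by rewrite ltr0n.
have rrE : (r0%:R : R) = r0.+1%:R - 1 by rewrite -natr1 addrK.
move: (erefl (r0.+1%:R : R)); move: {2}(r0.+1%:R : R) => rr rrE'.
rewrite rrE' in rr1 rr0 rrE.
pose ze := gam / (8 * rr).
pose xi := ze ^+ 2 / 8.
pose B := (1 + rr) ^+ r0.+1.
have B1 : 1 <= B by rewrite exprn_ege1 // lerDl ltW.
pose theta := xi / (40 * rr ^+ 2 * B).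
pose q := rr^-1.
have rq : rr * q = 1 by rewrite divff // gt_eqF.
have q0 : 0 < q by rewrite invr_gt0.
have ze0 : 0 < ze by rewrite divr_gt0 // mulr_gt0.
have zeE : ze = gam * q / 8 by rewrite /ze invfM -/q; field.
have q1 : q <= 1 / 2 by have : rr * q >= 2 * q by [rewrite ler_pM2r]; lra.
have gq : gam * q <= q by rewrite ler_piMl // ltW.
have gq' : gam * q <= gam by rewrite ler_piMr //; [exact: ltW | lra].
have zeq : ze <= q / 8 by rewrite zeE; lra.
have zeg : ze <= gam / 8 by rewrite zeE; lra.
have ze1 : ze <= 1 by lra.
have z2 : ze ^+ 2 <= ze by rewrite expr2 ler_piMl // ltW.
have z20 : 0 < ze ^+ 2 by rewrite exprn_gt0.
have xi0 : 0 < xi by rewrite divr_gt0.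
have xiq : xi <= q / 64 by rewrite /xi; lra.
have den1 : 1 <= rr ^+ 2 * B by rewrite mulr_ege1 // exprn_ege1 //; lra.
have den0 : 0 < rr ^+ 2 * B by apply: lt_le_trans den1.
have theta0 : 0 < theta by rewrite divr_gt0 // -mulrA mulr_gt0.
have thE : theta * (40 * rr ^+ 2 * B) = xi.
  by rewrite /theta divfK // gt_eqF // -mulrA mulr_gt0.
have thE2 : 40 * theta * rr <= xi.
  rewrite -thE; have -> : theta * (40 * rr ^+ 2 * B) = 40 * theta * rr * (rr * B) by ring.
  by apply: ler_peMr; [pos | apply: mulr_ege1 => //; lra].
have thr : theta <= theta * rr by rewrite ler_peMr ?(ltW theta0) //; lra.
have thxi : theta + xi <= ze ^+ 2 / 4 by rewrite /xi in thE2 *; lra.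
have zeD : ze <= gam / (8 * rr) by [].
have BE : (1 + rr) ^+ r0.+1 = B by [].
have qE : rr^-1 = q by [].
clear den0 den1 zeE gq gq' z20; clearbody theta xi ze B q.
exists theta => // eta eta0.
pose al := Num.min (eta / (8 * rr)) (xi / (80 * rr * B)).
have rB0 : 0 < 80 * rr * B by have : 0 < B; [apply: lt_le_trans B1 | move=> ?; pos].
have al0 : 0 < al by rewrite lt_min; apply/andP; split; pos.
have al_eta : al <= eta / (8 * rr) by rewrite ge_min lexx.
have al_xi : al * (80 * rr * B) <= xi.
  by rewrite -ler_pdivlMr // ge_min lexx orbT.
have al_xi2 : 80 * al <= xi.
  apply: le_trans al_xi; have -> : al * (80 * rr * B) = 80 * al * (rr * B) by ring.
  by apply: ler_peMr; [pos | apply: mulr_ege1 => //; lra].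
have al1 : al <= 1 by move: al_xi2 xiq q1; glra.
clearbody al.
pose kap := ze ^+ 3 / 8.
have kap0 : 0 < kap by rewrite divr_gt0 // exprn_gt0.
have g80 : 0 < gam / 8 by rewrite divr_gt0.
have kapz : kap <= ze ^+ 3 / 8 by [].
clearbody kap.
pose c := kap * al ^+ r0.+1 * (gam / 8) ^+ r0.+1.
exists c; first by rewrite /c; pos.
have [N1 hN1] := eventually_ge 1 theta0.
have [N2 hN2] := eventually_ge 1 al0.
have [N3 hN3] := eventually_ge 2 xi0.
exists (N1 + N2 + N3)%N => T V G tourT hN rob y y1 sy.
have {hN1}hth := hN1 #|V| ltac:(move: hN; clear; lia).
have {hN2}hal := hN2 #|V| ltac:(move: hN; clear; lia).
have {hN3}hxi := hN3 #|V| ltac:(move: hN; clear; lia).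
set n := #|V|%:R : R in hth hal hxi *.
have n0 : 0 < n.
  rewrite lt0r ler0n andbT; apply/eqP => e; move: hth; rewrite e mulr0; glra.
rewrite leNgt; apply/negP => few.
have [v0 _] : exists v0 : V, v0 \in setT.
  by apply/set0Pn; rewrite -card_gt0 cardsT -(ltr_nat R).
have qn0 : 0 <= (q + theta) * n by rewrite mulr_ge0 // addr_ge0 // ltW.
have hD := truncn_itv qn0; set D := Num.truncn _ in hD.
have xn0 : 0 <= xi * n by rewrite mulr_ge0 // ltW.
have hg := truncn_itv xn0; set g := Num.truncn _ in hg.
have an0 : 0 <= al * n by rewrite mulr_ge0 // ltW.
have hh := truncn_itv an0; set h' := Num.truncn _ in hh; pose h := h'.+1.
move: hD hg hh; rewrite -![_.+1%:R]natr1 => /andP[D1 D2] /andP[g1' g2] /andP[h1 h2].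
have hR : h%:R = h'%:R + 1 :> R by rewrite /h -natr1.
have nl a b : a <= b -> a * n <= b * n by move=> ab; rewrite ler_wpM2r // ltW.
have xqn := nl _ _ xiq.
have gDR : (g%:R : R) + 1 <= D%:R by move: D2 g1' xqn hxi hth; rewrite mulrDl; glra.
have gD : (g < D)%N by rewrite -(ler_nat R) -natr1.
have hn : (r0 * D + h <= #|V|)%N.
  rewrite -(ler_nat R) natrD natrM rrE -/n hR.
  have e1 : (rr - 1) * D%:R <= (rr - 1) * ((q + theta) * n) by rewrite ler_wpM2l //; move: rr1; glra.
  have e2 : (rr - 1) * ((q + theta) * n) = (1 - q + theta * rr - theta) * n.
    by transitivity ((rr * q - q + theta * rr - theta) * n); [ring | rewrite rq].
  have e3 : (1 - q + theta * rr - theta + 2 * al) * n <= 1 * n by apply: nl; move: thE2 theta0 xiq al_xi2 q0 xi0; glra.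
  by move: e1 e3 h1 hal; rewrite e2; glra.
have ncD i k x : i != k -> #|ncompat T G i k x|%:R <= D%:R :> R.
  move=> nik; rewrite ler_nat /D truncn_ge_nat //.
  by have := ncompat_card tourT x rob nik; rewrite rrE' qE.
have DgE : (r0.+1%:R^-1 - xi) * n <= D%:R + h%:R - g%:R.
  by rewrite rrE' qE mulrBl hR; move: D2 g1' hth; rewrite mulrDl; have := ler0n R h'; glra.
have h0 : (0 < h)%N by [].
have zeg8 : ze <= gam / (8 * r0.+1%:R) by rewrite rrE'.
have alh : al * n <= h%:R by rewrite hR; move: h2; glra.
have c0 := constraint0 v0 few h0 gD hn n0 ze0 zeg ze1 kap0 kapz al0 gam1
  (erefl _) alh ncD.
have cj := constraint tourT v0 few h0 gD hn n0 rob ze0 zeg ze1 (ltW theta0) (ltW xi0) thxi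
  kap0 kapz al0 al1 gam1 zeg8 (erefl _) alh ncD DgE.
have hab := rk_interleave y v0 h0 gD hn.
have tot := rank_sum v0 y1 h0 (ltnW gD) hn.
have nq : n / n = 1 by rewrite divff // gt_eqF.
have nV : 0 < n^-1 by rewrite invr_gt0.
have hdiv a b : a * n <= b -> a <= b / n by rewrite ler_pdivlMr.
have hdiv' a b : b <= a * n -> b / n <= a by rewrite ler_pdivrMr.
apply: (@rank_arith R r0 (fun j => rk y v0 (j * D + h).-1) (fun j => rk y v0 (j * D + h - g).-1)
   (h%:R / n) (D%:R / n - q) (D%:R / n) (g%:R / n) eta) => //.
- by rewrite rrE' qE subrKC.
- by rewrite subr_ge0; apply: hdiv; move: D2 hth; rewrite mulrDl; glra.
- by rewrite divr_ge0 // ltW.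
- by apply: hdiv'; have := nl (2 * al) (1 / 2) ltac:(move: al_xi2 xiq q1; glra); rewrite hR; move: h1 hal; glra.
- have e : eta / (4 * rr) = 2 * (eta / (8 * rr)).
    by rewrite !invfM; field; rewrite gt_eqF.
  by rewrite rrE'; apply: hdiv'; have := nl (2 * al) (eta / (4 * rr)) ltac:(rewrite e; move: al_eta; glra);
    rewrite hR; move: h1 hal; glra.
- by rewrite divr_gt0 //; move: g2 hxi; glra.
- by apply: hdiv'; have := nl xi 1 ltac:(move: xiq q1; glra); move: g1'; glra.
- rewrite rrE' BE.
  have e1 : D%:R / n - q <= theta by rewrite lerBlDl; apply: hdiv'.
  have e2 : h%:R / n <= 2 * al by apply: hdiv'; rewrite hR; move: h1 hal; glra.
  have e3 : xi / 2 <= g%:R / n by apply: hdiv; move: g2 hxi; glra.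
  apply: lt_le_trans e3.
  have B0 : 0 <= B by apply: le_trans B1.
  apply: (@le_lt_trans _ _ (5 * rr * (theta * rr + 2 * al) * B)).
    rewrite ler_wpM2r // ler_wpM2l ?mulr_ge0 ?(ltW rr0) //.
    by rewrite lerD // ler_wpM2r // ltW.
  have -> : 5 * rr * (theta * rr + 2 * al) * B =
     theta * (40 * rr ^+ 2 * B) / 8 + al * (80 * rr * B) / 8 by field.
  by rewrite thE; move: al_xi xi0; glra.
- have e : 0 <= (\sum_v y v) / n by rewrite divr_ge0 // ltW.
  apply: (le_trans e); have := ler_wpM2r (ltW nV) tot.
  rewrite -/n; set F := fun j : nat => _; set S1 := \sum_(_ <= _ < _) _.
  move=> /le_trans; apply; rewrite le_eqVlt; apply/orP; left; apply/eqP.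
  rewrite mulrDl mulrDl; congr (_ + _ + _).
    rewrite mulr_suml; apply: eq_bigr => j _.
    by rewrite mulrDl; ring.
  have -> : 1 - r0%:R * (D%:R / n) - h%:R / n = (n - r0%:R * D%:R - h%:R) / n.
    by rewrite [RHS]mulrBl [X in _ = X - _]mulrBl nq mulrA.
  by rewrite mulrAC.
Qed.

End RobustSelection.

(** * Nearly uniform weightings of copies *)

Section Fractional.
Variables (R : realType) (r : nat) (V : finType).
Local Notation n := (#|V|%:R : R).
Implicit Types (w : {ffun 'I_r -> V} -> R) (v : V).

Definition wdeg w v : R := \sum_f w f * #|[set i | f i == v]|%:R.

Lemma sum_wdeg w (h : V -> R) : \sum_v h v * wdeg w v = \sum_f w f * \sum_i h (f i).
Proof.
under eq_bigr do rewrite mulr_sumr; rewrite exchange_big; apply: eq_bigr => f _.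
under eq_bigr do rewrite mulrCA; rewrite -mulr_sumr; congr (_ * _).
transitivity (\sum_v \sum_i h v * (f i == v)%:R).
  apply: eq_bigr => v _; rewrite -mulr_sumr; congr (_ * _).
  rewrite (_ : [set i | f i == v] = [set i in setT | f i == v]); last first.
    by apply/setP => i; rewrite !inE.
  by rewrite cardR_sum; apply: eq_bigl => i; rewrite inE.
rewrite exchange_big; apply: eq_bigr => i _.
rewrite (bigD1 (f i)) //= eqxx mulr1 big1 ?addr0 // => v; rewrite eq_sym => /negbTE->.
by rewrite mulr0.
Qed.

Lemma sum_wdeg1 w : \sum_v wdeg w v = r%:R * \sum_f w f.
Proof.
have := sum_wdeg w (fun _ => 1); under eq_bigr do rewrite mul1r.
by move=> ->; rewrite mulr_sumr; apply: eq_bigr => f _; rewrite sumr_const card_ord mulrC.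
Qed.

Lemma wdegD w1 w2 v : wdeg (fun f => w1 f + w2 f) v = wdeg w1 v + wdeg w2 v.
Proof. by rewrite /wdeg -big_split; apply: eq_bigr => f _; rewrite mulrDl. Qed.

Lemma wdegZ a w v : wdeg (fun f => a * w f) v = a * wdeg w v.
Proof. by rewrite /wdeg mulr_sumr; apply: eq_bigr => f _; rewrite mulrA. Qed.

Lemma wdeg_ge0 w v : (forall f, 0 <= w f) -> 0 <= wdeg w v.
Proof. by move=> w0; apply: sumr_ge0 => f _; rewrite mulr_ge0. Qed.

Lemma card_fiber (i : 'I_r) v : #|[set f : {ffun 'I_r -> V} | f i == v]|%:R * n <= n ^+ r.
Proof.
set X := [set f | _].
have inj : {in setX X setT &, injective (fun p : {ffun 'I_r -> V} * V => upd p.1 i p.2)}.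
  move=> [f u] [g u']; rewrite !inE /= !andbT => /eqP fi /eqP gi e.
  have -> : u = u' by rewrite -(upd_eq f i u) e upd_eq.
  by rewrite -(upd_id f i) -(upd_id g i) -(upd_upd f i u) fi gi e upd_upd.
rewrite -natrM -natrX ler_nat -(cardsT V) -cardsX -(card_in_imset inj).
by rewrite (leq_trans (max_card _)) // card_ffun card_ord cardsT.
Qed.

Hypothesis r0 : (0 < r)%N.
Variables (T : rel 'I_r) (G : rel V) (c eta : R).
Hypotheses (c0 : 0 < c) (c1 : c <= 1) (eta0 : 0 <= eta) (n0 : 0 < n).
Hypothesis sel : forall y : V -> R, (forall v, y v <= 1) -> 0 <= \sum_v y v ->
  c * n ^+ r <= #|[set f | copy T G f && (- eta <= \sum_i y (f i))]|%:R.

Lemma selection_step (y : V -> R) : (forall v, y v <= 1) -> \sum_v y v = 0 ->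
  exists u : {ffun 'I_r -> V} -> R,
  [/\ forall f, 0 <= u f, forall f, 0 < u f -> copy T G f,
      forall f, u f * n ^+ r <= n / (r%:R * c), \sum_f u f = n / r%:R
    & forall v, 0 <= wdeg u v <= c^-1] /\
  \sum_f u f * \sum_i y (f i) >= - eta * (n / r%:R).
Proof.
move=> y1 y0; have := sel y1 _; rewrite y0 lexx => /(_ isT).
set E := [set f | _] => hE.
have rR : 0 < r%:R :> R by rewrite ltr0n.
have En : 0 < #|E|%:R :> R by apply: lt_le_trans hE; pos.
pose s := n / r%:R / #|E|%:R; have s0 : 0 < s by rewrite /s; pos.
have sE : s * #|E|%:R = n / r%:R by rewrite /s divfK // gt_eqF.
have sn : s * n ^+ r <= n / (r%:R * c).
  rewrite -(ler_pM2l c0) mulrCA -[X in _ <= X]/(c * (n / (r%:R * c))).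
  have -> : c * (n / (r%:R * c)) = n / r%:R.
    by field; rewrite !gt_eqF.
  by rewrite -sE ler_pM2l.
pose u f : R := s * (f \in E)%:R.
have u0 f : 0 <= u f by rewrite /u mulr_ge0 // ltW.
have usum (F : {ffun 'I_r -> V} -> R) : \sum_f u f * F f = \sum_(f in E) s * F f.
  rewrite [RHS]big_mkcond; apply: eq_bigr => f _; rewrite /u.
  by case: (f \in E); rewrite ?mulr1 ?mulr0 ?mul0r.
exists u; split; [split => //|].
- move=> f; rewrite /u; case fE : (f \in E); last by rewrite mulr0 ltxx.
  by move: fE; rewrite inE => /andP[].
- move=> f; rewrite /u; apply: le_trans sn; rewrite ler_pM2r ?exprn_gt0 //.
  by case: (f \in E); rewrite ?mulr1 ?mulr0 // ltW.
- have := usum (fun _ => 1); under eq_bigr do rewrite mulr1.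
  by move=> ->; rewrite sumr_const mulr1 -sE mulr_natr.
- move=> v; rewrite wdeg_ge0 //=.
  rewrite -(ler_pM2r n0); apply: (@le_trans _ _ (\sum_i s * #|[set f : {ffun 'I_r -> V} | f i == v]|%:R * n)).
    rewrite -mulr_suml ler_pM2r // /wdeg usum -mulr_sumr -mulr_sumr ler_wpM2l ?(ltW s0) //.
    apply: (@le_trans _ _ (\sum_(f : {ffun 'I_r -> V}) #|[set i : 'I_r | f i == v]|%:R)).
      by rewrite [X in X <= _]big_mkcond; apply: ler_sum => f _; case: ifP.
    have := double_count R [set: {ffun 'I_r -> V}] [set: 'I_r] (fun f i => f i == v).
    have bs (A : finType) (F : A -> R) : \sum_(a in [set: A]) F a = \sum_a F a.
      by apply: eq_bigl => a; rewrite inE.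
    rewrite !bs => h.
    have -> : \sum_(f : {ffun 'I_r -> V}) #|[set i : 'I_r | f i == v]|%:R =
       \sum_(f : {ffun 'I_r -> V}) #|[set b in [set: 'I_r] | f b == v]|%:R :> R.
      by apply: eq_bigr => f _; congr (_%:R); apply: eq_card => i; rewrite !inE.
    rewrite h le_eqVlt; apply/orP; left; apply/eqP; apply: eq_bigr => i _.
    by congr (_%:R); apply: eq_card => f; rewrite !inE.
  apply: (@le_trans _ _ (\sum_(i < r) s * n ^+ r)).
    by apply: ler_sum => i _; rewrite -mulrA ler_pM2l // card_fiber.
  rewrite sumr_const card_ord -[X in X <= _]mulr_natl.
  apply: (le_trans (ler_wpM2l (ltW rR) sn)).
  by rewrite le_eqVlt; apply/orP; left; apply/eqP; field; rewrite !gt_eqF.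
rewrite usum; have -> : - eta * (n / r%:R) = \sum_(f in E) s * - eta.
  by rewrite sumr_const -sE -[RHS]mulr_natl; ring.
apply: ler_sum => f; rewrite inE => /andP[_ h].
by rewrite ler_pM2l.
Qed.

(* [y] is, up to scaling, the current vector of deficiencies [N - wdeg w]; adding a measure on
   copies that see almost nonnegative total deficiency cannot increase its Euclidean norm by more
   than a bounded amount. *)
Lemma selection_iter (N : nat) : exists w : {ffun 'I_r -> V} -> R,
  [/\ forall f, 0 <= w f, forall f, 0 < w f -> copy T G f,
      forall f, w f * n ^+ r <= N%:R * (n / (r%:R * c)),
      \sum_f w f = N%:R * (n / r%:R)
    & \sum_v (N%:R - wdeg w v) ^+ 2 <=
        (N%:R ^+ 2 * eta / r%:R + N%:R * (c^-1) ^+ 2) * n].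
Proof.
have rR : 0 < r%:R :> R by rewrite ltr0n.
elim: N => [|N [w [w0 wc wb ws wq]]].
  exists (fun _ => 0); split => // [f|f||]; rewrite ?ltxx ?mul0r //.
    by rewrite big1.
  rewrite big1 ?expr0n /= ?mul0r ?addr0 ?mul0r // => v _.
  by rewrite /wdeg big1 ?subrr ?expr0n // => f _; rewrite mul0r.
pose Y v := N%:R - wdeg w v; pose y v := Y v / N%:R.
have Ysum : \sum_v Y v = 0.
  rewrite /Y sumrB sum_wdeg1 ws sumr_const -[N%:R *+ _]mulr_natl.
  have -> : r%:R * (N%:R * (n / r%:R)) = n * N%:R by field; rewrite gt_eqF.
  by rewrite subrr.
have y1 v : y v <= 1.
  rewrite /y; have [->|N0] := posnP N; first by rewrite invr0 mulr0.
  by rewrite ler_pdivrMr ?ltr0n // mul1r /Y gerBl wdeg_ge0.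
have yY v : N%:R * y v = Y v.
  rewrite /y; have [e|N0] := posnP N; last by rewrite mulrC divfK // gt_eqF // ltr0n.
  have w00 f : w f = 0.
    have := wb f; rewrite e mul0r pmulr_lle0 ?exprn_gt0 // => h.
    by apply/eqP; rewrite eq_le h w0.
  rewrite e mul0r /Y e sub0r /wdeg big1 ?oppr0 // => f _; by rewrite w00 mul0r.
have ysum : \sum_v y v = 0 by rewrite /y -mulr_suml Ysum mul0r.
have [u [[u0 uc ub us ud] uy]] := selection_step y1 ysum.
exists (fun f => w f + u f); split.
- by move=> f; rewrite addr_ge0.
- move=> f; have := w0 f; rewrite le_eqVlt => /orP[/eqP<-|/wc//]; rewrite add0r; exact: uc.
- by move=> f; rewrite mulrDl -natr1 mulrDl mul1r lerD.
- by rewrite big_split /= ws us -natr1 mulrDl mul1r.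
pose x v := 1 - wdeg u v.
have xb v : x v ^+ 2 <= c^-1 ^+ 2.
  have /andP[h1 h2] := ud v; have ci : 1 <= c^-1 by rewrite invf_ge1.
  rewrite -[X in X <= _]real_normK ?num_real // ler_sqr ?nnegrE // ?invr_ge0 ?(ltW c0) //.
  by rewrite ler_norml; apply/andP; split; rewrite /x; lra.
have cross : \sum_v Y v * x v <= N%:R * eta * (n / r%:R).
  have -> : \sum_v Y v * x v = \sum_v Y v - \sum_v Y v * wdeg u v.
    by rewrite -sumrB; apply: eq_bigr => v _; rewrite /x; ring.
  rewrite Ysum sum_wdeg sub0r lerNl.
  have -> : \sum_f u f * \sum_i Y (f i) = N%:R * \sum_f u f * \sum_i y (f i).
    rewrite mulr_sumr; apply: eq_bigr => f _; rewrite mulrCA; congr (_ * _).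
    by rewrite mulr_sumr; apply: eq_bigr => i _; rewrite yY.
  have := ler_wpM2l (ler0n R N) uy; apply: le_trans.
  by rewrite -mulrA mulNr mulrN.
have -> : \sum_v (N.+1%:R - wdeg (fun f => w f + u f) v) ^+ 2 =
    \sum_v Y v ^+ 2 + 2 * \sum_v Y v * x v + \sum_v x v ^+ 2.
  rewrite mulr_sumr -!big_split /=; apply: eq_bigr => v _.
  by rewrite wdegD /Y /x -[N.+1%:R]natr1; ring.
have xs : \sum_v x v ^+ 2 <= c^-1 ^+ 2 * n.
  apply: (@le_trans _ _ (\sum_(v : V) c^-1 ^+ 2)); first by apply: ler_sum => v _.
  by rewrite sumr_const mulr_natr.
rewrite -[N.+1%:R]natr1; apply: (le_trans (lerD (lerD wq (ler_wpM2l _ cross)) xs)) => //.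
have e0 : 0 <= eta / r%:R * n by pos.
have -> : ((N%:R + 1) ^+ 2 * eta / r%:R + (N%:R + 1) * c^-1 ^+ 2) * n =
  (N%:R ^+ 2 * eta / r%:R + N%:R * c^-1 ^+ 2) * n + 2 * (N%:R * eta * (n / r%:R))
   + c^-1 ^+ 2 * n + eta / r%:R * n by ring.
by rewrite lerDl.
Qed.

End Fractional.

Lemma spread_measure (R : realType) (r0 : nat) (gam : R) : (0 < r0)%N -> 0 < gam -> gam <= 1 ->
  exists2 theta : R, 0 < theta & forall eta : R, 0 < eta ->
  exists2 C : R, 0 < C & exists N : nat,
  forall (T : rel 'I_r0.+1) (V : finType) (G : rel V),
    (forall i j, i != j -> T i j (+) T j i) -> (N <= #|V|)%N ->
    robust r0.+1 G theta gam ->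
  exists w : {ffun 'I_r0.+1 -> V} -> R,
  [/\ forall f, 0 <= w f, forall f, 0 < w f -> copy T G f,
      forall f, w f * #|V|%:R ^+ r0 <= C,
      \sum_f w f = #|V|%:R / r0.+1%:R
    & \sum_v (1 - wdeg w v) ^+ 2 <= eta * #|V|%:R].
Proof.
move=> r00 gam0 gam1; have [theta theta0 hsel] := robust_selection r00 gam0 gam1.
exists theta => // eta eta0.
have [c c0 [N1 hN1]] := hsel (eta / 2) ltac:(pos).
pose c' := Num.min c 1.
have c'0 : 0 < c' by rewrite lt_min c0 ltr01.
have c'1 : c' <= 1 by rewrite ge_min lexx orbT.
have [K hK] := eventually_ge (c'^-1 ^+ 2) (x := eta / 2) ltac:(pos).
exists (r0.+1%:R * c')^-1; first by pos.
exists N1.+1 => T V G tT hV rob.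
set n := #|V|%:R : R; have n0 : 0 < n by rewrite ltr0n; apply: leq_trans hV.
have sel y : (forall v, y v <= 1) -> 0 <= \sum_v y v ->
    c' * n ^+ r0.+1 <= #|[set f | copy T G f && (- (eta / 2) <= \sum_i y (f i))]|%:R.
  move=> y1 ys; apply: le_trans (hN1 T V G tT (ltnW hV) rob y y1 ys).
  by rewrite ler_wpM2r ?exprn_ge0 ?(ltW n0) // ge_min lexx.
have [w [w0 wc wb ws wq]] := selection_iter (ltn0Sn r0) c'0 c'1 (ltac:(pos) : 0 <= eta / 2) n0 sel K.+1.
have K0 : 0 < K.+1%:R :> R by rewrite ltr0n.
have Kn : (K.+1%:R : R) != 0 by rewrite gt_eqF.
have Ki : 0 < (K.+1%:R : R)^-1 by rewrite invr_gt0.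
exists (fun f => K.+1%:R^-1 * w f); split.
- by move=> f; rewrite mulr_ge0 // ltW.
- by move=> f; rewrite pmulr_rgt0 //; apply: wc.
- move=> f; rewrite -(ler_pM2r n0) -mulrA -exprSr -(ler_pM2l K0) -[_ * w f * _]mulrA mulVKf //.
  by rewrite (le_trans (wb f)) // [n / _]mulrC.
- by rewrite -mulr_sumr ws mulrA mulVf // mul1r.
have -> : \sum_v (1 - wdeg (fun f => K.+1%:R^-1 * w f) v) ^+ 2 =
    (K.+1%:R^-1) ^+ 2 * \sum_v (K.+1%:R - wdeg w v) ^+ 2.
  rewrite mulr_sumr; apply: eq_bigr => v _; rewrite -exprMn mulrBr mulVf // wdegZ //.
apply: (le_trans (ler_wpM2l (exprn_ge0 _ (ltW Ki)) wq)); rewrite -/n [X in X <= _]mulrA ler_pM2r //.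
have h1 := hK K.+1 (leqnSn K).
have r1 : (r0.+1%:R : R)^-1 <= 1 by rewrite invf_le1 ?ltr0n // ler1n.
rewrite -(ler_pM2l (exprn_gt0 2 K0)) mulrA -exprMn mulfV // expr1n mul1r.
set k := K.+1%:R in h1 *; set a := (c'^-1 ^+ 2) in h1 *; set q := r0.+1%:R^-1 in r1 *.
have h2 : k * a <= k * (eta / 2 * k) by rewrite ler_pM2l.
have h3 : k ^+ 2 * (eta / 2) * q <= k ^+ 2 * (eta / 2).
  by rewrite ler_piMr //; pos.
by have e : k * (eta / 2 * k) = k ^+ 2 * (eta / 2) by [ring]; lra.
Qed.

(** * Random samples of blocks *)

Section Resampling.
Variables (R : realType) (J I P : finType) (p0 : P) (iota : P -> J).
Local Notation m := (#|I|%:R : R).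
Implicit Types (Z : {ffun J -> I}) (Y : {ffun P -> I}).

Definition resample Z Y : {ffun J -> I} :=
  [ffun j => if [pick i | (i != p0) && (iota i == j)] is Some i then Y i else Z j].

Hypothesis iota_inj : {in predC1 p0 &, injective iota}.

Lemma resample_in Z Y i : i != p0 -> resample Z Y (iota i) = Y i.
Proof.
move=> ni; rewrite ffunE; case: pickP => [i' /andP[ni' /eqP e]|/(_ i)]; last by rewrite ni eqxx.
by rewrite (iota_inj _ _ e) // inE.
Qed.

Lemma resample_out Z Y j : (forall i, i != p0 -> iota i != j) -> resample Z Y j = Z j.
Proof.
move=> h; rewrite ffunE; case: pickP => [i /andP[ni /eqP e]|//].
by have := h i ni; rewrite e eqxx.
Qed.

Lemma resample_sum (Phi : {ffun J -> I} -> R) :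
  m ^+ #|P| * \sum_Z Phi Z = \sum_Z \sum_Y Phi (resample Z Y).
Proof.
pose sw (p : {ffun J -> I} * {ffun P -> I}) : {ffun J -> I} * {ffun P -> I} :=
  (resample p.1 p.2, [ffun i => if i == p0 then p.2 i else p.1 (iota i)]).
have swK : involutive sw.
  move=> [Z Y]; rewrite /sw /=; congr (_, _); apply/ffunP => i; last first.
    rewrite ffunE; case: (eqVneq i p0) => [->|ni]; first by rewrite ffunE eqxx.
    exact: resample_in.
  have [/existsP[k /andP[nk /eqP<-]]|none] := boolP [exists k, (k != p0) && (iota k == i)].
    by rewrite resample_in // ffunE (negbTE nk).
  have h k : k != p0 -> iota k != i.
    by move=> nk; apply: contra none => e; apply/existsP; exists k; rewrite nk.
  by rewrite !resample_out.
rewrite pair_big /= (reindex_inj (inv_inj swK)) /=.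
have -> : \sum_(p : {ffun J -> I} * {ffun P -> I}) Phi (resample (sw p).1 (sw p).2) =
    \sum_(p : {ffun J -> I} * {ffun P -> I}) Phi p.1.
  by apply: eq_bigr => p _; rewrite -[in RHS](swK p).
rewrite -(pair_big xpredT xpredT (fun Z Y => Phi Z)) /= mulr_sumr.
by apply: eq_bigr => Z _; rewrite sumr_const card_ffun -[Phi Z *+ _]mulr_natl natrX.
Qed.

End Resampling.

Section Variance.
Variables (R : realType) (J I P K : finType) (p0 : P) (j0 : J) (iota : K -> P -> J).
Local Notation m := (#|I|%:R : R).
Implicit Types (Z : {ffun J -> I}) (Y : {ffun P -> I}).

Hypothesis iota0 : forall b, iota b p0 = j0.
Hypothesis iota_inj : forall b, injective (iota b).
Hypothesis iota_disj : forall b b' i i', b != b' -> i' != p0 -> iota b i != iota b' i'.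
Variables (H : {ffun P -> I} -> R) (M : R).
Hypothesis H0 : forall u, \sum_Y H (upd Y p0 u) = 0.
Hypothesis HM : forall Y, `|H Y| <= M.

Definition along Z b : {ffun P -> I} := [ffun i => Z (iota b i)].

Lemma cross_term b b' : b != b' -> \sum_Z H (along Z b) * H (along Z b') = 0.
Proof.
move=> nb; have [I0|I0] := posnP #|I|.
  apply: big1 => Z _; exfalso; have : (0 < #|I|)%N by apply/card_gt0P; exists (Z j0).
  by rewrite I0.
have mP : m ^+ #|P| != 0 by rewrite gt_eqF // exprn_gt0 // ltr0n.
apply: (mulfI mP); rewrite mulr0.
have ii : {in predC1 p0 &, injective (iota b')} by move=> i i' _ _; apply: iota_inj.
rewrite (resample_sum (p0 := p0) ii (fun Z => H (along Z b) * H (along Z b'))).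
apply: big1 => Z _; rewrite -[RHS](mulr0 (H (along Z b))) -[X in _ * X](H0 (Z j0)) mulr_sumr.
apply: eq_bigr => Y _; congr (H _ * H _); apply/ffunP => i; rewrite [LHS]ffunE [RHS]ffunE.
  by apply: resample_out => i' ni'; rewrite eq_sym iota_disj.
case: (eqVneq i p0) => [->|ni]; last exact: resample_in.
by rewrite iota0; apply: resample_out => i' ni'; rewrite -(iota0 b) eq_sym iota_disj.
Qed.

Lemma variance_bound :
  \sum_Z (\sum_b H (along Z b)) ^+ 2 <= #|K|%:R * M ^+ 2 * m ^+ #|J|.
Proof.
have -> : \sum_Z (\sum_b H (along Z b)) ^+ 2 =
    \sum_b \sum_b' \sum_Z H (along Z b) * H (along Z b').
  rewrite exchange_big /=.
  under [RHS]eq_bigr do rewrite exchange_big /=.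
  rewrite [RHS]exchange_big /=; apply: eq_bigr => Z _.
  rewrite expr2 mulr_suml exchange_big; apply: eq_bigr => b _.
  by rewrite mulr_sumr; apply: eq_bigr => b' _; rewrite mulrC.
rewrite -mulrA mulr_natl -sumr_const; apply: ler_sum => b _.
rewrite (bigD1 b) //= [X in _ + X]big1 ?addr0 => [|b' nb]; last by apply: cross_term; rewrite eq_sym.
have -> : M ^+ 2 * m ^+ #|J| = \sum_(Z : {ffun J -> I}) M ^+ 2.
  by rewrite sumr_const card_ffun -[_ ^+ 2 *+ _]mulr_natr natrX.
apply: ler_sum => Z _; rewrite -expr2 -[X in X <= _]real_normK ?num_real //.
by rewrite ler_sqr ?nnegrE // (le_trans _ (HM (along Z b))).
Qed.

End Variance.

Lemma sum_coord (R : realType) (J I : finType) (j : J) (h : I -> R) : (0 < #|I|)%N ->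
  #|I|%:R * \sum_(Z : {ffun J -> I}) h (Z j) = #|I|%:R ^+ #|J| * \sum_u h u.
Proof.
move=> I0.
pose sw (p : {ffun J -> I} * I) : {ffun J -> I} * I := (upd p.1 j p.2, p.1 j).
have swK : involutive sw by move=> [Z u]; rewrite /sw /= upd_upd upd_id upd_eq.
transitivity (\sum_(p : {ffun J -> I} * I) h (p.1 j)).
  rewrite -(pair_big xpredT xpredT (fun (Z : {ffun J -> I}) u => h (Z j))) /= mulr_sumr.
  by apply: eq_bigr => Z _; rewrite sumr_const -[h _ *+ _]mulr_natl.
rewrite (reindex_inj (inv_inj swK)) /=.
transitivity (\sum_(p : {ffun J -> I} * I) h p.2).
  by apply: eq_bigr => p _; rewrite upd_eq.
rewrite -(pair_big xpredT xpredT (fun (Z : {ffun J -> I}) u => h u)) /=.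
by rewrite sumr_const card_ffun -natrX mulr_natl.
Qed.

Section Lines.
Variables (R : realType) (r0 q : nat) (V I : finType).
Variables (phi : I * 'I_r0.+1 -> V) (psi : V -> I * 'I_r0.+1).
Hypotheses (phiK : cancel phi psi) (psiK : cancel psi phi).
Hypotheses (q_prime : prime q) (rq : (r0.+1 <= q)%N).
Local Notation role := 'I_r0.+1.
Local Notation J := (role * 'F_q)%type.
Local Notation m := (#|I|%:R : R).

(* A line of the affine plane over ['F_q], given as the graph of an affine function; two lines
   share at most one point. *)
Definition line (al be : 'F_q) (i : role) : J := (i, al + (i : nat)%:R * be).

(* A pattern consists of a line (two coordinates), a cyclic shift assigning roles to the points
   of the line, and a vertex slot inside the block of each point. *)
Definition pattern := ('F_q * ('F_q * (role * {ffun role -> role})))%type.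
Implicit Types (Z : {ffun J -> I}) (Y : {ffun role -> I}) (g : pattern) (x : J * role).

Definition emb Y (sb : role * {ffun role -> role}) : {ffun role -> V} :=
  [ffun i => phi (Y (i + sb.1), sb.2 i)].

Definition slot g (i : role) : J * role := (line g.1 g.2.1 (i + g.2.2.1), g.2.2.2 i).

Definition contains g x :=
  (line g.1 g.2.1 x.1.1 == x.1) && (g.2.2.2 (x.1.1 - g.2.2.1) == x.2).

Definition realize Z g : {ffun role -> V} := [ffun i => phi (Z (slot g i).1, (slot g i).2)].

Lemma contains_slot g i : contains g (slot g i).
Proof. by rewrite /contains /slot /= addrK !eqxx. Qed.

Lemma containsE g x : contains g x -> x = slot g (x.1.1 - g.2.2.1).
Proof.
case: x => [j b] /= /andP[/eqP ej /eqP eb]; rewrite /slot /= subrK.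
by congr (_, _).
Qed.

Lemma slot1_inj g : injective (fun i => (slot g i).1).
Proof. by move=> i i' /(congr1 (fun j : J => j.1)) /= /addIr. Qed.

Lemma realizeE Z g : realize Z g = emb (along (line g.1) Z g.2.1) g.2.2.
Proof. by apply/ffunP => i; rewrite !ffunE. Qed.

Variables (w : {ffun role -> V} -> R) (C eta : R).
Hypotheses (w0 : forall f, 0 <= w f) (wC : forall f, w f * #|V|%:R ^+ r0 <= C).
Hypothesis wdev : \sum_v (1 - wdeg w v) ^+ 2 <= eta * #|V|%:R.
Hypothesis I0 : (0 < #|I|)%N.

Let m0 : 0 < m. Proof. by rewrite ltr0n. Qed.
Let q0 : 0 < q%:R :> R. Proof. by rewrite ltr0n prime_gt0. Qed.

Definition scale : R := m ^+ r0 / q%:R.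
Definition weight Z g : R := scale * w (realize Z g).
Definition load Z x : R := \sum_(g | contains g x) weight Z g.

Let scale0 : 0 < scale. Proof. by rewrite divr_gt0 // exprn_gt0. Qed.
Lemma card_blocks : #|V| = (#|I| * r0.+1)%N.
Proof. by rewrite (bij_eq_card (Bijective psiK phiK)) card_prod card_ord. Qed.

Lemma scale_w f : scale * w f <= C / q%:R.
Proof.
rewrite /scale mulrAC ler_pM2r ?invr_gt0 //; apply: le_trans (wC f).
by rewrite mulrC ler_wpM2l // lerXn2r ?nnegrE // ler_nat card_blocks leq_pmulr.
Qed.

Section Point.
Variables (p : role) (c : 'F_q) (b0 : role).

Definition point_sum Y : R :=
  \sum_(sb : role * {ffun role -> role} | sb.2 (p - sb.1) == b0) scale * w (emb Y sb).

Definition pencil (be : 'F_q) := line (c - (p : nat)%:R * be) be.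

Lemma load_pencil Z : load Z ((p, c), b0) = \sum_be point_sum (along pencil Z be).
Proof.
rewrite /load /point_sum pair_big /=.
rewrite (reindex_onto (fun j : 'F_q * (role * {ffun role -> role}) => (c - (p : nat)%:R * j.1, j) : pattern)
   (fun g : pattern => g.2)).
  apply: eq_big => [[be [s b]]|[be [s b]] _].
    by rewrite /contains /line /= subrK !eqxx /= andbT.
  by rewrite /weight realizeE; congr (_ * w (emb _ _)); apply/ffunP => i; rewrite !ffunE.
move=> [al [be [s b]]]; rewrite /contains /line /= => /andP[/eqP[e] _].
by rewrite -e addrK.
Qed.

Let Yof (f : {ffun role -> V}) (s : role) : {ffun role -> I} := [ffun k => (psi (f (k - s))).1].
Let bof (f : {ffun role -> V}) : {ffun role -> role} := [ffun i => (psi (f i)).2].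

Lemma sum_emb u (s : role) :
  \sum_(p' : {ffun role -> I} * {ffun role -> role} | p'.2 (p - s) == b0)
     w (emb (upd p'.1 p u) (s, p'.2)) =
  m * \sum_(f : {ffun role -> V} | f (p - s) == phi (u, b0)) w f.
Proof.
have YofK Y (b : {ffun role -> role}) : Yof (emb Y (s, b)) s = Y.
  by apply/ffunP => k; rewrite !ffunE phiK /= subrK.
have bofK Y (b : {ffun role -> role}) : bof (emb Y (s, b)) = b.
  by apply/ffunP => k; rewrite !ffunE phiK.
have embK f : emb (Yof f s) (s, bof f) = f.
  by apply/ffunP => i; rewrite !ffunE /= addrK -[RHS]psiK; case: (psi (f i)).
rewrite (reindex_onto (fun fu : {ffun role -> V} * I => (upd (Yof fu.1 s) p fu.2, bof fu.1))
  (fun p' => (emb (upd p'.1 p u) (s, p'.2), p'.1 p))); last first.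
  by move=> [Y b] _ /=; rewrite YofK bofK upd_upd upd_id.
have -> : m * \sum_(f : {ffun role -> V} | f (p - s) == phi (u, b0)) w f =
    \sum_(fu : {ffun role -> V} * I | fu.1 (p - s) == phi (u, b0)) w fu.1.
  rewrite (eq_bigl (fun fu : {ffun role -> V} * I => (fu.1 (p - s) == phi (u, b0)) && true));
    last by move=> fu; rewrite andbT.
  rewrite -(pair_big (fun f : {ffun role -> V} => f (p - s) == phi (u, b0)) xpredT (fun f _ => w f)) /=.
  by rewrite mulr_sumr; apply: eq_bigr => f _; rewrite sumr_const -[w f *+ _]mulr_natl.
have key f u' : (emb (upd (upd (Yof f s) p u') p u) (s, bof f) == f) = ((psi (f (p - s))).1 == u).
  rewrite upd_upd; apply/eqP/eqP => [e|e].
    by rewrite -e !ffunE /= subrK eqxx phiK.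
  rewrite -[RHS]embK; congr (emb _ _); apply/ffunP => k; rewrite [LHS]updE; case: eqP => // ->.
  by rewrite ffunE.
apply: eq_big => [[f u']|[f u']] /=.
  rewrite xpair_eqE upd_eq eqxx andbT key ffunE -(can_eq psiK) phiK.
  by case: (psi (f (p - s))) => a b /=; rewrite xpair_eqE andbC.
by rewrite xpair_eqE key => /andP[_ /andP[]]; rewrite -(key f u') => /eqP->.
Qed.

Lemma sum_point u : \sum_Y point_sum (upd Y p u) = m * scale * wdeg w (phi (u, b0)).
Proof.
have -> : \sum_Y point_sum (upd Y p u) = \sum_s scale *
    \sum_(p' : {ffun role -> I} * {ffun role -> role} | p'.2 (p - s) == b0)
     w (emb (upd p'.1 p u) (s, p'.2)).
  transitivity (\sum_Y \sum_s \sum_(b : {ffun role -> role} | b (p - s) == b0)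
     scale * w (emb (upd Y p u) (s, b))).
    apply: eq_bigr => Y _; rewrite /point_sum.
    rewrite (pair_big_dep xpredT (fun (s : role) (b : {ffun role -> role}) => b (p - s) == b0)
       (fun s b => scale * w (emb (upd Y p u) (s, b)))) /=.
    by apply: eq_bigr => -[s b].
  rewrite exchange_big; apply: eq_bigr => s _ /=.
  rewrite (pair_big xpredT (fun b : {ffun role -> role} => b (p - s) == b0)
     (fun Y b => scale * w (emb (upd Y p u) (s, b)))) /= mulr_sumr.
  by apply: eq_bigr => -[].
under eq_bigr do rewrite sum_emb.
transitivity (m * scale * \sum_s \sum_(f : {ffun role -> V} | f (p - s) == phi (u, b0)) w f).
  by rewrite mulr_sumr; apply: eq_bigr => s _; rewrite mulrCA mulrA.
congr (_ * _).
rewrite (reindex_inj (inv_inj (subKr p))) /=; under eq_bigr do rewrite subKr.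
rewrite /wdeg (exchange_big_dep xpredT) //=; apply: eq_bigr => f _.
by rewrite sumr_const -[w f *+ _]mulr_natr; congr (_ * _%:R); apply: eq_card => i; rewrite !inE.
Qed.

Let M : R := C * (r0.+1 * r0.+1 ^ r0.+1)%:R / q%:R.

Lemma point_sum_bound Y : 0 <= point_sum Y <= M.
Proof.
apply/andP; split; first by rewrite /point_sum; apply: sumr_ge0 => sb _; rewrite mulr_ge0 // ltW.
have C0 : 0 <= C / q%:R by apply: le_trans (scale_w (emb Y (0, [ffun _ => 0]))); rewrite mulr_ge0 // ltW.
apply: (@le_trans _ _ (\sum_(sb : role * {ffun role -> role}) C / q%:R)).
  by rewrite /point_sum big_mkcond; apply: ler_sum => sb _; case: ifP => // _; apply: scale_w.
by rewrite sumr_const card_prod card_ffun !card_ord -[_ *+ _]mulr_natr mulrAC.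
Qed.

Lemma load_variance :
  \sum_Z (load Z ((p, c), b0) - wdeg w (phi (Z (p, c), b0))) ^+ 2 <=
    q%:R * M ^+ 2 * m ^+ #|{: J}|.
Proof.
have mr : 0 < m ^+ r0.+1 by rewrite exprn_gt0.
pose H Y := point_sum Y - wdeg w (phi (Y p, b0)) / q%:R.
have Hs u : \sum_Y H (upd Y p u) = 0.
  rewrite sumrB sum_point; under [X in _ - X]eq_bigr do rewrite upd_eq.
  rewrite sumr_const card_ffun card_ord -[_ *+ (_ ^ _)]mulr_natl natrX exprS /scale.
  by rewrite -!mulrA [_^-1 * _]mulrC subrr.
have avg u : 0 <= wdeg w (phi (u, b0)) / q%:R <= M.
  have e : m ^+ r0.+1 * (wdeg w (phi (u, b0)) / q%:R) = \sum_Y point_sum (upd Y p u).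
    by rewrite sum_point /scale exprS; ring.
  apply/andP; split; [rewrite -(pmulr_rge0 _ mr)|rewrite -(ler_pM2l mr)]; rewrite e.
    by apply: sumr_ge0 => Y _; have /andP[] := point_sum_bound (upd Y p u).
  have -> : m ^+ r0.+1 * M = \sum_(Y : {ffun role -> I}) M.
    by rewrite sumr_const card_ffun card_ord -[M *+ _]mulr_natl natrX.
  by apply: ler_sum => Y _; have /andP[] := point_sum_bound (upd Y p u).
have HM Y : `|H Y| <= M.
  have /andP[h1 h2] := point_sum_bound Y; have /andP[h3 h4] := avg (Y p).
  by rewrite ler_norml /H; apply/andP; split; move: h1 h2 h3 h4;
    move: (point_sum Y) (wdeg w (phi (Y p, b0)) / q%:R) (M) => a b c'; lra.
have i0 be : pencil be p = (p, c) by rewrite /pencil /line subrK.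
have ii be : injective (pencil be) by move=> i i' [].
have qr (i i' : role) : ((i : nat)%:R == (i' : nat)%:R :> 'F_q) -> i = i'.
  move=> /eqP/(congr1 (@nat_of_ord _)); rewrite !val_Fp_nat // !modn_small; first exact: ord_inj.
  - by apply: leq_trans rq.
  - by apply: leq_trans rq.
have id be be' i i' : be != be' -> i' != p -> pencil be i != pencil be' i'.
  move=> nb; apply: contraNneq => e0.
  have ei : i = i' := congr1 fst e0.
  have e : c - (p : nat)%:R * be + (i' : nat)%:R * be = c - (p : nat)%:R * be' + (i' : nat)%:R * be'.
    by rewrite -{1}ei; exact: (congr1 snd e0).
  have : ((i' : nat)%:R - (p : nat)%:R) * (be - be') == 0 :> 'F_q.
    apply/eqP; transitivity ((c - (p : nat)%:R * be + (i' : nat)%:R * be) -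
       (c - (p : nat)%:R * be' + (i' : nat)%:R * be')); first by ring.
    by rewrite e subrr.
  by rewrite mulf_eq0 !subr_eq0 (negbTE nb) orbF => /qr->.
have := variance_bound i0 ii id Hs HM; rewrite card_Fp //.
apply: le_trans; rewrite le_eqVlt; apply/orP; left; apply/eqP; apply: eq_bigr => Z _.
congr (_ ^+ 2); rewrite /H sumrB -load_pencil; congr (_ - _).
under eq_bigr do rewrite ffunE i0.
by rewrite sumr_const card_Fp // -[_ *+ _]mulr_natr divfK // gt_eqF.
Qed.

End Point.

Lemma load_deviation : \sum_Z \sum_x (load Z x - 1) ^+ 2 <=
  (2 * (q%:R * (C * (r0.+1 * r0.+1 ^ r0.+1)%:R / q%:R) ^+ 2) + 2 * eta)
    * #|{: J * role}|%:R * m ^+ #|{: J}|.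
Proof.
set B := q%:R * _.
have e1 : \sum_Z \sum_x (load Z x - wdeg w (phi (Z x.1, x.2))) ^+ 2 <=
    B * #|{: J * role}|%:R * m ^+ #|{: J}|.
  rewrite exchange_big /= mulrAC [B * _]mulrC mulr_natr -sumr_const.
  apply: ler_sum => -[[p c] b] _ /=; rewrite mulrC; exact: load_variance.
have e2 : \sum_(Z : {ffun J -> I}) \sum_(x : J * role) (1 - wdeg w (phi (Z x.1, x.2))) ^+ 2 <=
    eta * #|{: J * role}|%:R * m ^+ #|{: J}|.
  rewrite -(ler_pM2l m0) exchange_big /= mulr_sumr.
  have -> : \sum_(x : J * role) m * \sum_(Z : {ffun J -> I}) (1 - wdeg w (phi (Z x.1, x.2))) ^+ 2 =
     \sum_(x : J * role) m ^+ #|{: J}| * \sum_(u : I) (1 - wdeg w (phi (u, x.2))) ^+ 2.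
    apply: eq_bigr => x _.
    exact: (sum_coord x.1 (fun u => (1 - wdeg w (phi (u, x.2))) ^+ 2) I0).
  rewrite -(pair_big xpredT xpredT (fun (j : J) (b : role) =>
      m ^+ #|{: J}| * \sum_u (1 - wdeg w (phi (u, b))) ^+ 2)) /=.
  rewrite sumr_const -mulr_sumr exchange_big /= pair_big /=.
  have -> : \sum_(p : I * role) (1 - wdeg w (phi (p.1, p.2))) ^+ 2 = \sum_v (1 - wdeg w v) ^+ 2.
    rewrite [RHS](reindex phi) /=; last by exists psi => ? _.
    by apply: eq_bigr => -[].
  rewrite -[_ *+ _]mulr_natl.
  have cj : #|{: J * role}|%:R = #|{: J}|%:R * r0.+1%:R :> R by rewrite card_prod natrM card_ord.
  have cv : #|V|%:R = m * r0.+1%:R :> R by rewrite card_blocks natrM.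
  rewrite cj; move: wdev; rewrite cv => h.
  have alg (X Y z : R) : m * (eta * (Y * z) * X) = Y * (X * (eta * (m * z))) by ring.
  rewrite alg.
  by rewrite ler_wpM2l // ler_wpM2l // exprn_ge0 // ltW.
have e3 : \sum_Z \sum_x (load Z x - 1) ^+ 2 <=
   2 * \sum_Z \sum_x (load Z x - wdeg w (phi (Z x.1, x.2))) ^+ 2 +
   2 * \sum_(Z : {ffun J -> I}) \sum_(x : J * role) (1 - wdeg w (phi (Z x.1, x.2))) ^+ 2.
  rewrite !mulr_sumr -big_split /=; apply: ler_sum => Z _.
  rewrite !mulr_sumr -big_split /=; apply: ler_sum => x _.
  set a := load Z x; set b := wdeg _ _; rewrite -subr_ge0.
  have -> : 2 * (a - b) ^+ 2 + 2 * (1 - b) ^+ 2 - (a - 1) ^+ 2 = (a + 1 - 2 * b) ^+ 2 by ring.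
  exact: sqr_ge0.
have alg (X Y : R) : (2 * B + 2 * eta) * X * Y = 2 * (B * X * Y) + 2 * (eta * X * Y) by ring.
by rewrite alg; apply: (le_trans e3); rewrite lerD // ler_pM2l.
Qed.

End Lines.

Section Rounding.
Variables (R : realType) (r0 q : nat) (V I : finType) (phi : I * 'I_r0.+1 -> V).
Variable w : {ffun 'I_r0.+1 -> V} -> R.
Hypothesis w0 : forall f, 0 <= w f.
Local Notation role := 'I_r0.+1.
Local Notation J := (role * 'F_q)%type.
Variable Z : {ffun J -> I}.
Local Notation om g := (weight phi w Z g).
Local Notation d x := (load phi w Z x).
Implicit Types (x : J * role) (g : pattern r0 q).

Let om0 g : 0 <= om g.
Proof. by rewrite /weight /scale mulr_ge0 // divr_ge0 // exprn_ge0. Qed.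

Let d0 x : 0 <= d x.
Proof. by apply: sumr_ge0. Qed.

Let cardX : #|{: J * role}|%:R = #|{: J}|%:R * r0.+1%:R :> R.
Proof. by rewrite card_prod natrM card_ord. Qed.

Lemma slot_sum (a : pattern r0 q -> R) (F : J * role -> R) :
  \sum_g a g * \sum_i F (slot g i) = \sum_x F x * \sum_(g | contains g x) a g.
Proof.
under [RHS]eq_bigr do rewrite mulr_sumr big_mkcond.
rewrite exchange_big; apply: eq_bigr => g _; rewrite -big_mkcond /=.
rewrite (reindex_onto (slot g) (fun x => x.1.1 - g.2.2.1)); last first.
  by move=> x /containsE/esym.
rewrite mulr_sumr; apply: eq_big => [i|i _]; last by rewrite mulrC.
by rewrite contains_slot /= addrK eqxx.
Qed.

Definition excess x : R := Num.max 0 (d x - 1).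
Definition trimmed g : R := om g * Num.max 0 (1 - \sum_i excess (slot g i)).

Let ex0 x : 0 <= excess x.
Proof. by rewrite /excess le_max lexx. Qed.

Lemma trimmed_ge0 g : 0 <= trimmed g.
Proof. by rewrite mulr_ge0 // le_max lexx. Qed.

Lemma trimmed_gt0 g : 0 < trimmed g -> 0 < w (realize phi Z g).
Proof.
rewrite lt0r => /andP[+ _]; rewrite /trimmed !mulf_eq0 !negb_or => /andP[/andP[_ h] _].
by rewrite lt0r h w0.
Qed.

Lemma trimmed_load x : \sum_(g | contains g x) trimmed g <= 1.
Proof.
apply: (@le_trans _ _ (\sum_(g | contains g x) om g * Num.max 0 (1 - excess x))).
  apply: ler_sum => g gx; rewrite ler_wpM2l // ge_max le_max lexx /= le_max.
  apply/orP; right; rewrite lerB // [in X in X <= _](containsE gx).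
  by rewrite (bigD1 (x.1.1 - g.2.2.1)) //= lerDl sumr_ge0.
rewrite -mulr_suml -/(load phi w Z x) /excess; have := d0 x; move: (d x) => y y0.
have [h|h] := lerP (y - 1) 0; first by rewrite subr0 max_r //; lra.
have [h'|h'] := lerP (1 - (y - 1)) 0; first by rewrite mulr0.
have := sqr_ge0 (y - 1); rewrite -subr_ge0; have -> : (y - 1) ^+ 2 = 1 - y * (1 - (y - 1)) by ring.
by rewrite !subr_ge0.
Qed.

Lemma trimmed_le1 g : trimmed g <= 1.
Proof.
apply: le_trans (trimmed_load (slot g 0)); rewrite (bigD1 g) ?contains_slot //= lerDl.
by apply: sumr_ge0 => g' _; apply: trimmed_ge0.
Qed.

Lemma sum_trimmed_le : \sum_g trimmed g <= #|{: J}|%:R.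
Proof.
have := slot_sum trimmed (fun _ => 1); under eq_bigr do rewrite sumr_const card_ord.
have rp : 0 < r0.+1%:R :> R by rewrite ltr0n.
rewrite -mulr_suml => e; rewrite -(ler_pM2r rp) e.
have -> : #|{: J}|%:R * r0.+1%:R = \sum_(x : J * role) 1 :> R.
  by rewrite sumr_const -cardX.
by apply: ler_sum => x _; rewrite mul1r trimmed_load.
Qed.

Lemma sum_trimmed_ge (tau : R) : 0 < tau ->
  #|{: J}|%:R - (1 + 2 / tau) * \sum_x (d x - 1) ^+ 2 - 2 * tau * r0.+1%:R * #|{: J}|%:R
  <= \sum_g trimmed g.
Proof.
move=> tau0.
set S2 := \sum_x _; pose A := \sum_x `|d x - 1|.
have rp : 1 <= r0.+1%:R :> R by rewrite ler1n.
have hA : A <= S2 / tau + tau * #|{: J * role}|%:R.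
  have -> : S2 / tau + tau * #|{: J * role}|%:R = \sum_x ((d x - 1) ^+ 2 / tau + tau).
    by rewrite big_split /= -mulr_suml sumr_const -[tau *+ _]mulr_natr.
  apply: ler_sum => x _; move: (d x - 1) => y.
  rewrite -(ler_pM2r tau0) mulrDl divfK ?gt_eqF // -[X in _ <= X + _]real_normK ?num_real //.
  have := sqr_ge0 (`|y| - tau); move: (normr_ge0 y); move: `|y| => z z0.
  have -> : (z - tau) ^+ 2 = z ^+ 2 + tau * tau - 2 * (z * tau) by ring.
  by have := mulr_ge0 z0 (ltW tau0); lra.
have hom : #|{: J}|%:R - A <= \sum_g om g.
  have := slot_sum (weight phi w Z) (fun _ => 1); under eq_bigr do rewrite sumr_const card_ord.
  rewrite -mulr_suml; under [X in _ = X -> _]eq_bigr do rewrite mul1r.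
  move=> e; have h : #|{: J}|%:R * r0.+1%:R - A <= \sum_x d x.
    have -> : #|{: J}|%:R * r0.+1%:R = \sum_(x : J * role) 1 :> R.
      by rewrite sumr_const -cardX.
    rewrite lerBlDr -big_split /=; apply: ler_sum => x _.
    by have := ler_norm (- (d x - 1)); rewrite normrN; lra.
  have rp0 : 0 < r0.+1%:R :> R by apply: lt_le_trans rp.
  rewrite -(ler_pM2r rp0) e; apply: le_trans h; rewrite mulrBl lerB //.
  by rewrite ler_peMr // /A sumr_ge0.
have hex : \sum_x excess x * d x <= S2 + A.
  rewrite -big_split /=; apply: ler_sum => x _; have := d0 x; rewrite /excess; move: (d x) => y y0.
  have [h|h] := lerP (y - 1) 0; first by rewrite mul0r addr_ge0 ?sqr_ge0.
  by rewrite gtr0_norm // (_ : (y - 1) ^+ 2 + (y - 1) = (y - 1) * y) //; ring.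
have htr : \sum_g om g - \sum_x excess x * d x <= \sum_g trimmed g.
  rewrite -slot_sum -sumrB; apply: ler_sum => g _.
  rewrite -[X in X - _]mulr1 -mulrBr ler_wpM2l // le_max lexx orbT //.
apply: le_trans htr; move: hA hom hex; rewrite cardX.
have -> : (1 + 2 / tau) * S2 = S2 + 2 * (S2 / tau) by ring.
move: (S2 / tau) (\sum_x excess x * d x) (\sum_g om g) (#|{: J}|%:R : R) (r0.+1%:R : R) => a b c N rr.
by move: (S2) A => s A' h1 h2 h3; lra.
Qed.

(* [nu] is [t] times a fractional packing of the sampled blocks whose weight exceeds the number of
   good blocks among them. *)
Definition augments (good : {set I}) (t : nat) (nu : {ffun pattern r0 q -> 'I_t.+1}) :=
  [&& [forall g, (0 < nu g)%N ==> (0 < w (realize phi Z g))],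
      [forall x, (\sum_(g | contains g x) nu g <= t)%N]
    & (t * #|[set j | Z j \in good]| < \sum_g nu g)%N].

Lemma augments_ex (good : {set I}) (t : nat) (s : R) :
  s + #|[set j | Z j \in good]|%:R <= \sum_g trimmed g ->
  #|{: pattern r0 q}|%:R < t%:R * s ->
  exists nu : {ffun pattern r0 q -> 'I_t.+1}, augments good nu.
Proof.
move=> hs ht.
have tr0 g : 0 <= t%:R * trimmed g by rewrite mulr_ge0 // trimmed_ge0.
have le_t g : (Num.truncn (t%:R * trimmed g) <= t)%N.
  rewrite -(ler_nat R); have /andP[h _] := truncn_itv (tr0 g).
  by rewrite (le_trans h) // ler_piMr // trimmed_le1.
pose nu : {ffun pattern r0 q -> 'I_t.+1} := [ffun g => inord (Num.truncn (t%:R * trimmed g))].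
have nuE g : nu g = Num.truncn (t%:R * trimmed g) :> nat by rewrite ffunE inordK // ltnS.
exists nu; apply/and3P; split.
- apply/forallP => g; apply/implyP; rewrite nuE truncn_gt0 => h; apply: trimmed_gt0.
  rewrite lt0r trimmed_ge0 andbT; apply: contraTneq h => ->.
  by rewrite mulr0 -ltNge ltr01.
- apply/forallP => x; rewrite -(ler_nat R) natr_sum.
  apply: (@le_trans _ _ (\sum_(g | contains g x) t%:R * trimmed g)).
    by apply: ler_sum => g _; rewrite nuE; have /andP[] := truncn_itv (tr0 g).
  by rewrite -mulr_sumr ler_piMr // trimmed_load.
rewrite -(ltr_nat R) natrM natr_sum.
have h : t%:R * \sum_g trimmed g - #|{: pattern r0 q}|%:R <= \sum_g (nu g)%:R.
  rewrite mulr_sumr lerBlDr -[#|_|%:R]mulr1 -[_ * 1]mulrC mulr_natr -sumr_const -big_split /=.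
  apply: ler_sum => g _; have /andP[_ /ltW] := truncn_itv (tr0 g).
  by rewrite nuE natr1.
apply: lt_le_trans h; rewrite ltrBrDr.
apply: (@lt_le_trans _ _ (t%:R * (s + #|[set j | Z j \in good]|%:R))); last by rewrite ler_wpM2l.
by rewrite mulrDr addrC ltrD2r.
Qed.

End Rounding.

Section Sampling.
Variable R : realType.

Lemma sampling_avg (r0 q : nat) (V I : finType) (phi : I * 'I_r0.+1 -> V)
    (w : {ffun 'I_r0.+1 -> V} -> R) (good : {set I}) (tau e2 nu : R) :
  let J := ('I_r0.+1 * 'F_q)%type in
  (forall f, 0 <= w f) -> (0 < #|I|)%N -> 0 < tau -> 0 < nu ->
  \sum_(Z : {ffun J -> I}) \sum_x (load phi w Z x - 1) ^+ 2 <= e2 * #|{: J * 'I_r0.+1}|%:R * #|I|%:R ^+ #|{: J}| ->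
  #|good|%:R <= (1 - nu) * #|I|%:R ->
  (1 + 2 / tau) * e2 * r0.+1%:R + 2 * tau * r0.+1%:R <= nu / 2 ->
  nu / 4 * #|I|%:R ^+ #|{: J}| <=
    #|[set Z : {ffun J -> I} | nu / 4 * #|{: J}|%:R + #|[set j | Z j \in good]|%:R
         <= \sum_g trimmed phi w Z g]|%:R.
Proof.
move=> J w0 I0 tau0 nu0 hdev hgood hpar.
have J0 : (0 < #|{: J}|)%N by apply/card_gt0P; exists (0, 0).
have cardX : #|{: J * 'I_r0.+1}|%:R = #|{: J}|%:R * r0.+1%:R :> R.
  by rewrite card_prod natrM card_ord.
rewrite cardX in hdev.
have NR : 0 < #|{: J}|%:R :> R by rewrite ltr0n.
have m0 : 0 < #|I|%:R :> R by rewrite ltr0n.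
move: (erefl #|{: J}|); move: {2}#|{: J}| => k kE; rewrite kE in J0 cardX hdev NR *.
have hM : 0 < #|I|%:R ^+ k :> R by rewrite exprn_gt0.
have cZ : #|{ffun J -> I}|%:R = #|I|%:R ^+ k :> R by rewrite card_ffun kE natrX.
pose gd (Z : {ffun J -> I}) : R := #|[set j | Z j \in good]|%:R.
have sgd : \sum_Z gd Z <= k%:R * ((1 - nu) * #|I|%:R ^+ k).
  have -> : \sum_Z gd Z = \sum_(j : J) \sum_(Z : {ffun J -> I}) (Z j \in good)%:R.
    rewrite exchange_big; apply: eq_bigr => Z _; rewrite /gd.
    rewrite (_ : [set j | Z j \in good] = [set j in setT | Z j \in good]); last first.
      by apply/setP => j; rewrite !inE.
    by rewrite cardR_sum; apply: eq_bigl => j; rewrite inE.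
  rewrite mulr_natl -kE -sumr_const kE; apply: ler_sum => j _.
  rewrite -(ler_pM2l m0) (sum_coord j (fun u => (u \in good)%:R) I0) kE.
  rewrite mulrA [X in _ <= X]mulrC ler_pM2l // [X in _ <= X]mulrC.
  apply: le_trans hgood; rewrite -sum1_card natr_sum [X in _ <= X]big_mkcond.
  by apply: ler_sum => u _; case: (u \in good).
pose D (Z : {ffun J -> I}) := \sum_x (load phi w Z x - 1) ^+ 2.
pose X (Z : {ffun J -> I}) := \sum_g trimmed phi w Z g - gd Z.
have Xle Z : X Z <= k%:R.
  by rewrite /X lerBlDr (le_trans (sum_trimmed_le phi w0 Z)) // kE lerDl.
have Xge Z : (1 - 2 * tau * r0.+1%:R) * k%:R - (1 + 2 / tau) * D Z - gd Z <= X Z.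
  rewrite /X lerD2r; apply: le_trans (sum_trimmed_ge phi w0 Z tau0).
  by rewrite kE -/(D Z) le_eqVlt; apply/orP; left; apply/eqP; ring.
have sX : nu / 2 * k%:R * #|I|%:R ^+ k <= \sum_Z X Z.
  apply: (@le_trans _ _ (\sum_Z ((1 - 2 * tau * r0.+1%:R) * k%:R - (1 + 2 / tau) * D Z - gd Z)));
    last by apply: ler_sum.
  have cs (a : R) : \sum_(Z : {ffun J -> I}) a = #|I|%:R ^+ k * a.
    by rewrite sumr_const card_ffun kE -[a *+ _]mulr_natl natrX.
  rewrite !sumrB cs -mulr_sumr.
  have t0 : 0 <= 1 + 2 / tau by pos.
  have h1 := ler_wpM2l t0 hdev.
  have h2 : ((1 + 2 / tau) * e2 * r0.+1%:R + 2 * tau * r0.+1%:R) * (k%:R * #|I|%:R ^+ k) <=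
      nu / 2 * (k%:R * #|I|%:R ^+ k) by rewrite ler_pM2r // mulr_gt0.
  move: h1 h2 sgd; move: (\sum_Z gd Z) (\sum_Z _) => a b.
  move: (#|I|%:R ^+ k) (k%:R : R) (r0.+1%:R : R) (1 + 2 / tau) => M N rr tt h1 h2 h3.
  by move: h1 h2 h3; clear; lra.
set W := [set Z | _].
have sX2 : \sum_Z X Z <= #|W|%:R * k%:R + #|I|%:R ^+ k * (nu / 4 * k%:R).
  rewrite (bigID (mem W)) /= lerD //.
    by rewrite mulr_natl -sumr_const; apply: ler_sum.
  apply: (@le_trans _ _ (\sum_(Z : {ffun J -> I} | Z \notin W) nu / 4 * k%:R)).
    by apply: ler_sum => Z; rewrite inE -ltNge => /ltW; rewrite /X lerBlDr.
  rewrite sumr_const -[X in X <= _]mulr_natl -cZ ler_wpM2r //.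
    by rewrite mulr_ge0 // divr_ge0 // ltW.
  by rewrite ler_nat max_card.
rewrite -(ler_pM2r NR); move: (le_trans sX sX2).
move: (#|I|%:R ^+ k) (k%:R : R) (#|W|%:R : R) => M N ww; lra.
Qed.

Lemma sampling (r0 : nat) (nu : R) : 0 < nu ->
  exists2 eta : R, 0 < eta & forall C : R, 0 < C ->
  exists q : nat, [/\ prime q, (r0.+1 <= q)%N & exists t : nat,
  forall (V I : finType) (phi : I * 'I_r0.+1 -> V) (psi : V -> I * 'I_r0.+1)
    (w : {ffun 'I_r0.+1 -> V} -> R) (good : {set I}),
    cancel phi psi -> cancel psi phi -> (0 < #|I|)%N ->
    (forall f, 0 <= w f) -> (forall f, w f * #|V|%:R ^+ r0 <= C) ->
    \sum_v (1 - wdeg w v) ^+ 2 <= eta * #|V|%:R ->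
    #|good|%:R <= (1 - nu) * #|I|%:R ->
  nu / 4 * #|I|%:R ^+ #|{: 'I_r0.+1 * 'F_q}| <=
    #|[set Z : {ffun 'I_r0.+1 * 'F_q -> I} |
        [exists n : {ffun pattern r0 q -> 'I_t.+1}, augments phi w Z good n]]|%:R].
Proof.
move=> nu0.
have rr0 : 0 < r0.+1%:R :> R by rewrite ltr0n.
move: (erefl (r0.+1%:R : R)); move: {2}(r0.+1%:R : R) => rr rrE; rewrite rrE in rr0.
pose tau := nu / (16 * rr).
have tau0 : 0 < tau by rewrite /tau; pos.
pose tt := 1 + 2 / tau.
have tt0 : 0 < tt by rewrite /tt; pos.
pose eta := nu / (16 * rr * tt).
have eta0 : 0 < eta by rewrite /eta; pos.
exists eta => // C C0.
pose k : R := (r0.+1 * r0.+1 ^ r0.+1)%:R.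
pose bq := 16 * rr * tt * (C * k) ^+ 2 / nu.
have bq0 : 0 <= bq by rewrite /bq; have : 0 <= k := ler0n _ _; move=> ?; pos.
have [q hq q_prime] := prime_above (maxn r0 (Num.bound bq)).
have rq : (r0.+1 <= q)%N by apply: leq_trans hq; rewrite ltnS leq_maxl.
have bqq : bq <= q%:R.
  apply: le_trans (ltW (archi_boundP bq0)) _; rewrite ler_nat ltnW //.
  by apply: leq_trans hq; rewrite ltnS leq_maxr.
exists q; split => //.
pose G : R := #|{: pattern r0 q}|%:R.
have nu4 : 0 < nu / 4 by pos.
exists (Num.bound (G / (nu / 4))) => V I phi psi w good phiK psiK I0 w0 wC wdev hgood.
have q0 : 0 < q%:R :> R by rewrite ltr0n prime_gt0.
have dev := load_deviation phiK psiK q_prime rq w0 wC wdev I0.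
have hpar : (1 + 2 / tau) * (2 * (q%:R * (C * k / q%:R) ^+ 2) + 2 * eta) * r0.+1%:R
    + 2 * tau * r0.+1%:R <= nu / 2.
  rewrite rrE -/tt.
  have h1 : 16 * rr * tt * eta = nu.
    by rewrite /eta; field; rewrite !gt_eqF.
  have h2 : 16 * rr * tau = nu by rewrite /tau; field; rewrite gt_eqF.
  have h3 : 16 * rr * tt * (q%:R * (C * k / q%:R) ^+ 2) <= nu.
    have -> : 16 * rr * tt * (q%:R * (C * k / q%:R) ^+ 2) = bq * nu / q%:R.
      by rewrite /bq; field; rewrite !gt_eqF.
    by rewrite ler_pdivrMr // mulrC ler_pM2l.
  move: (q%:R * (C * k / q%:R) ^+ 2) h3 => B h3.
  have -> : tt * (2 * B + 2 * eta) * rr + 2 * tau * rr =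
    (16 * rr * tt * B) / 8 + (16 * rr * tt * eta) / 8 + (16 * rr * tau) / 8 by field.
  by rewrite h1 h2; move: h3; clear -nu0; lra.
apply: le_trans (sampling_avg w0 I0 tau0 nu0 dev hgood hpar) _.
apply/lecard/subsetP => Z; rewrite !inE => hZ; apply/existsP.
apply: (augments_ex w0 hZ).
have J1 : 1 <= #|{: 'I_r0.+1 * 'F_q}|%:R :> R.
  by rewrite ler1n; apply/card_gt0P; exists (0, 0).
have tG : G < (Num.bound (G / (nu / 4)))%:R * (nu / 4).
  by rewrite -ltr_pdivrMr // archi_boundP // divr_ge0 // ltW.
apply: (lt_le_trans tG); rewrite ler_wpM2l // ler_peMr // ltW //.
Qed.

End Sampling.

(** * Complete subhypergraphs *)

Section Box.
Variable R : realType.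

Lemma subset_of_size (A : finType) (X : {set A}) k : (k <= #|X|)%N ->
  exists2 Y : {set A}, Y \subset X & #|Y| = k.
Proof.
move=> kX; exists [set x in take k (enum X)].
  by apply/subsetP => x; rewrite inE => /mem_take; rewrite mem_enum.
rewrite cardsE; have /card_uniqP-> : uniq (take k (enum X)) by rewrite take_uniq ?enum_uniq.
by rewrite size_take -cardE; case: ltngtP kX.
Qed.

Lemma pigeonhole_in (A B : finType) (f : A -> B) (X : {set A}) (Y : {set B}) (b0 : B) :
  b0 \in Y -> (forall a, a \in X -> f a \in Y) ->
  exists2 b, b \in Y & #|X|%:R <= #|Y|%:R * #|[set a in X | f a == b]|%:R :> R.
Proof.
move=> b0Y fY.
have [b bY bmax] := @arg_maxnP B b0 (mem Y) (fun b => #|[set a in X | f a == b]|) b0Y.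
exists b => //; rewrite -natrM ler_nat.
rewrite -sum1_card (partition_big f (mem Y)) //=.
apply: (@leq_trans (\sum_(c in Y) #|[set a in X | f a == b]|)); last by rewrite sum_nat_const.
by apply: leq_sum => c cY; rewrite sum1dep_card; exact: bmax.
Qed.

Lemma box_step (t : nat) (delta : R) : 0 < delta ->
  exists2 delta' : R, 0 < delta' & exists N : nat,
  forall (J I : finType) (X : {set {ffun J -> I}}) (k : J), (N <= #|I|)%N ->
    delta * #|I|%:R ^+ #|J| <= #|X|%:R ->
  exists2 A : {set I}, #|A| = t &
    delta' * #|I|%:R ^+ #|J| <= #|[set Z | [forall z in A, upd Z k z \in X]]|%:R.
Proof.
move=> d0.
pose s := Num.bound (4 * t%:R / delta).
have hs : 4 * t%:R / delta < s%:R by apply: archi_boundP; pos.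
have s0 : 0 < s%:R :> R by apply: le_lt_trans hs; pos.
have tds : 4 * t%:R < s%:R * delta by rewrite -ltr_pdivrMr.
have [N hN] := eventually_ge s%:R (x := delta / 2) ltac:(pos).
exists (delta / 4 / 2 ^+ s); first by pos.
exists N.+1 => J I X k NI hX.
set m := #|I|%:R : R in hX *; set M := m ^+ #|J| in hX *.
have m0 : 0 < m by rewrite ltr0n; apply: leq_trans NI.
have M0 : 0 < M by rewrite exprn_gt0.
have ME : M = #|{ffun J -> I}|%:R by rewrite card_ffun natrX.
pose Xz z := [set Z : {ffun J -> I} | upd Z k z \in X].
have XzM z : #|Xz z|%:R <= M by rewrite ME ler_nat max_card.
have cnt : m * #|X|%:R <= \sum_z #|Xz z|%:R.
  have inj : {in setX X [set: I] &, injective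
      (fun p : {ffun J -> I} * I => (p.1 k, upd p.1 k p.2))}.
    move=> [Z u] [Z' u'] _ _ /= [e1 e2].
    have eu : u = u' by rewrite -(upd_eq Z k u) e2 upd_eq.
    by rewrite -(upd_id Z k) -(upd_id Z' k) -(upd_upd Z k u) e1 e2 upd_upd eu.
  have := card_in_imset inj; rewrite cardsX cardsT => e.
  rewrite /m mulrC -natrM -e -natr_sum ler_nat.
  have -> : (\sum_z #|Xz z|)%N = #|[set p : I * {ffun J -> I} | p.2 \in Xz p.1]|.
    by rewrite sum_card_fst; apply: eq_bigr => z _; apply: eq_card => Z; rewrite !inE.
  apply: subset_leq_card; apply/subsetP => p /imsetP[[Z u]]; rewrite !inE /= andbT => ZX ->.
  by rewrite /= upd_upd upd_id.
pose Big := [set z | delta / 2 * M <= #|Xz z|%:R].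
have Bigc : delta / 2 * m <= #|Big|%:R.
  have h : \sum_z #|Xz z|%:R <= #|Big|%:R * M + m * (delta / 2 * M).
    rewrite (bigID (mem Big)) /= lerD //.
      by rewrite mulr_natl -sumr_const; apply: ler_sum.
    apply: (@le_trans _ _ (\sum_(z : I | z \notin Big) delta / 2 * M)).
      by apply: ler_sum => z; rewrite inE -ltNge => /ltW.
    rewrite sumr_const -[X in X <= _]mulr_natl ler_wpM2r //; first by pos.
    by rewrite ler_nat max_card.
  rewrite -(ler_pM2r M0); have h2 : m * (delta * M) <= m * #|X|%:R by rewrite ler_pM2l.
  by move: (le_trans h2 (le_trans cnt h)); glra.
have [S0 sS0 cS0] : exists2 S0 : {set I}, S0 \subset Big & #|S0| = s.
  by apply: subset_of_size; rewrite -(ler_nat R) (le_trans _ Bigc) // hN // ltnW.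
pose hits Z := [set z in S0 | upd Z k z \in X].
have hsum : s%:R * (delta / 2 * M) <= \sum_Z #|hits Z|%:R.
  have := double_count R [set: {ffun J -> I}] S0 (fun Z z => upd Z k z \in X).
  have -> : \sum_(Z in [set: {ffun J -> I}]) #|[set z in S0 | upd Z k z \in X]|%:R =
     \sum_Z #|hits Z|%:R :> R by apply: eq_bigl => Z; rewrite inE.
  move=> ->; rewrite -cS0 mulr_natl -sumr_const; apply: ler_sum => z /(subsetP sS0).
  rewrite inE => /le_trans; apply; apply/lecard/subsetP => Z; rewrite !inE //.
pose Good := [set Z | (t <= #|hits Z|)%N].
have Goodc : delta / 4 * M <= #|Good|%:R.
  have h : \sum_Z #|hits Z|%:R <= s%:R * #|Good|%:R + t%:R * M.
    rewrite (bigID (mem Good)) /= lerD //.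
      rewrite mulr_natr -sumr_const; apply: ler_sum => Z _; rewrite ler_nat -cS0.
      by apply/subset_leq_card/subsetP => z; rewrite inE => /andP[].
    apply: (@le_trans _ _ (\sum_(Z : {ffun J -> I} | Z \notin Good) t%:R)).
      by apply: ler_sum => Z; rewrite inE -ltnNge => /ltnW; rewrite ler_nat.
    rewrite sumr_const -[X in X <= _]mulr_natr ler_wpM2l // ME ler_nat.
    exact: max_card.
  have h2 := le_trans hsum h.
  have h3 : 4 * t%:R * M <= s%:R * delta * M by rewrite ler_pM2r // ltW.
  rewrite -(ler_pM2l s0); move: h2 h3; glra.
have [H HS hH] := @pigeonhole_in _ _ hits Good (powerset S0) set0 (ltac:(by rewrite inE sub0set))
  (fun Z _ => ltac:(by rewrite inE; apply/subsetP => z; rewrite inE => /andP[])).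
rewrite card_powerset cS0 natrX in hH.
have fib0 : (0 < #|[set Z in Good | hits Z == H]|)%N.
  rewrite lt0n; apply/eqP => e; move: hH; rewrite e mulr0 => hH.
  have h9 : 0 < delta / 4 * M by pos.
  by move: h9 Goodc hH; glra.
have [A sA cA] : exists2 A : {set I}, A \subset H & #|A| = t.
  apply: subset_of_size; case/card_gt0P: fib0 => Z.
  by rewrite !inE => /andP[h /eqP<-].
exists A => //; apply: (@le_trans _ _ #|[set Z in Good | hits Z == H]|%:R).
  rewrite -mulrA [_^-1 * _]mulrC mulrA ler_pdivrMr ?exprn_gt0 //.
  by rewrite [X in _ <= X]mulrC (le_trans Goodc).
apply/lecard/subsetP => Z; rewrite !inE => /andP[_ /eqP eH].
by apply/forall_inP => z /(subsetP sA); rewrite -eH inE => /andP[].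
Qed.

Lemma box_seq (t l : nat) (delta : R) : 0 < delta -> exists N : nat,
  forall (J I : finType) (X : {set {ffun J -> I}}) (L : seq J), (N <= #|I|)%N ->
    uniq L -> size L = l -> delta * #|I|%:R ^+ #|J| <= #|X|%:R ->
  exists A : J -> {set I}, (forall j, j \in L -> #|A j| = t) /\
    exists Z0 : {ffun J -> I}, forall Z : {ffun J -> I},
      (forall j, j \in L -> Z j \in A j) -> (forall j, j \notin L -> Z j = Z0 j) -> Z \in X.
Proof.
elim: l delta => [|l IH] delta d0.
  exists 1%N => J I X [|//] I0 _ _ hX.
  have /card_gt0P[Z0 Z0X] : (0 < #|X|)%N.
    by rewrite -(ltr0n R); apply: lt_le_trans hX; rewrite mulr_gt0 // exprn_gt0 // ltr0n.
  exists (fun _ => set0); split => //; exists Z0 => Z _ hZ.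
  by rewrite (_ : Z = Z0) //; apply/ffunP => j; apply: hZ.
have [d' d'0 [N1 hN1]] := box_step t d0.
have [N2 hN2] := IH d' d'0.
exists (N1 + N2)%N => J I X [//|k L] NI /= /andP[kL uL] [sL] hX.
have [Ak cAk hX'] := hN1 J I X k ltac:(move: NI; clear; lia) hX.
have [A [cA [Z0 hZ0]]] := hN2 J I _ L ltac:(move: NI; clear; lia) uL sL hX'.
exists (fun j => if j == k then Ak else A j); split.
  by move=> j; rewrite inE; case: eqP => //= _; apply: cA.
exists Z0 => Z hZ hZ'.
have : upd Z k (Z0 k) \in [set Z | [forall z in Ak, upd Z k z \in X]].
  apply: hZ0 => j jL; rewrite updE; case: (eqVneq j k) => [e|njk].
  - by rewrite -e jL in kL.
  - by have := hZ j; rewrite inE jL orbT (negbTE njk); apply.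
  - by rewrite e.
  - by apply: hZ'; rewrite inE negb_or njk.
rewrite inE => /forall_inP/(_ (Z k)); rewrite upd_upd upd_id; apply.
by have := hZ k; rewrite inE eqxx; apply.
Qed.

(* Erdős' theorem on complete [J]-partite subhypergraphs. *)
Lemma box (t : nat) (J : finType) (delta : R) : 0 < delta -> exists N : nat,
  forall (I : finType) (X : {set {ffun J -> I}}), (N <= #|I|)%N ->
    delta * #|I|%:R ^+ #|J| <= #|X|%:R ->
  exists A : J -> {set I}, (forall j, #|A j| = t) /\
    forall Z : {ffun J -> I}, (forall j, Z j \in A j) -> Z \in X.
Proof.
move=> d0; have [N hN] := box_seq t #|J| d0.
exists N => I X NI hX.
have [A [cA [Z0 h]]] := hN J I X (enum J) NI (enum_uniq _) (esym (cardE _)) hX.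
exists A; split=> [j|Z hZ]; first by apply: cA; rewrite mem_enum.
by apply: h => // j; rewrite mem_enum.
Qed.

End Box.

(** * Almost perfect packings *)

Section Packing.
Variables (r : nat) (T : rel 'I_r) (V : finType) (G : rel V).
Implicit Type P : {set {ffun 'I_r -> V}}.

Definition packing P :=
  [forall f in P, copy T G f] &&
  [forall f in P, forall g in P, (f != g) ==> [forall i, forall j, f i != g j]].

Definition covered P : {set V} := \bigcup_(f in P) [set f i | i in 'I_r].

Lemma packingP P : reflect ((forall f, f \in P -> copy T G f) /\
   (forall f g i j, f \in P -> g \in P -> f i = g j -> f = g)) (packing P).
Proof.
apply: (iffP andP) => [[/forall_inP h1 /forall_inP h2]|[h1 h2]].
  split=> // f g i j fP gP e; apply/eqP/negP => /negP nfg.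
  have /forall_inP/(_ g gP)/implyP/(_ nfg)/forallP/(_ i)/forallP/(_ j) := h2 f fP.
  by rewrite e eqxx.
split; first exact/forall_inP.
apply/forall_inP => f fP; apply/forall_inP => g gP; apply/implyP => nfg.
by apply/forallP => i; apply/forallP => j; apply: contraNneq nfg => /(h2 _ _ _ _ fP gP)->.
Qed.

Lemma coveredP P v : reflect (exists f i, f \in P /\ v = f i) (v \in covered P).
Proof.
apply: (iffP bigcupP) => [[f fP /imsetP[i _ ->]]|[f [i [fP ->]]]]; first by exists f, i.
by exists f => //; apply/imsetP; exists i.
Qed.

Hypotheses (tourT : forall i j, i != j -> T i j (+) T j i) (irrG : irreflexive G).

Lemma card_covered P : packing P -> #|covered P| = (#|P| * r)%N.
Proof.
move=> /packingP[h1 h2].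
have inj : {in setX P [set: 'I_r] &, injective (fun p : {ffun 'I_r -> V} * 'I_r => p.1 p.2)}.
  move=> [f i] [g j]; rewrite !inE /= !andbT => fP gP e.
  have efg := h2 _ _ _ _ fP gP e; rewrite efg in e *.
  by rewrite (copy_inj tourT irrG (h1 g gP) e).
have -> : (#|P| * r)%N = #|setX P [set: 'I_r]| by rewrite cardsX cardsT card_ord.
rewrite -(card_in_imset inj); apply: eq_card => v.
apply/coveredP/imsetP => [[f [i [fP ->]]]|[[f i]]].
  by exists (f, i) => //; rewrite !inE fP.
by rewrite !inE /= andbT => fP ->; exists f, i.
Qed.

End Packing.

Section Layout.
Variables (r0 : nat) (T : rel 'I_r0.+1) (V : finType) (G : rel V).
Hypotheses (tourT : forall i j, i != j -> T i j (+) T j i) (irrG : irreflexive G).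
Variables (P : {set {ffun 'I_r0.+1 -> V}}) (m : nat).
Hypotheses (packP : packing T G P) (cV : #|V| = (m * r0.+1)%N).

Definition block := ({f : {ffun 'I_r0.+1 -> V} | f \in P} + 'I_(m - #|P|))%type.

Lemma packing_le : (#|P| <= m)%N.
Proof. by rewrite -(leq_pmul2r (ltn0Sn r0)) -cV -(card_covered tourT irrG packP) max_card. Qed.

Lemma card_block : #|{: block}| = m.
Proof. by rewrite card_sum card_sig card_ord subnKC ?packing_le. Qed.

Lemma layout : exists (phi : block * 'I_r0.+1 -> V) psi,
  [/\ cancel phi psi, cancel psi phi & forall f i, phi (inl f, i) = val f i].
Proof.
pose L := ~: covered P.
have cL : #|{: 'I_(m - #|P|) * 'I_r0.+1}| = #|L|.
  by rewrite card_prod !card_ord mulnBl -cV -(card_covered tourT irrG packP) -cardsT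
    -[L]setTD cardsD setTI.
pose h (x : 'I_(m - #|P|) * 'I_r0.+1) : V := enum_val (cast_ord cL (enum_rank x)).
have hL x : h x \notin covered P by have := enum_valP (cast_ord cL (enum_rank x)); rewrite inE.
have hinj : injective h by move=> x y /enum_val_inj/cast_ord_inj/enum_rank_inj.
pose phi (x : block * 'I_r0.+1) : V :=
  match x.1 with inl f => val f x.2 | inr j => h (j, x.2) end.
have valc (f : {f : {ffun 'I_r0.+1 -> V} | f \in P}) i : val f i \in covered P.
  by apply/coveredP; exists (val f), i; split => //; apply: valP.
have phi_inj : injective phi.
  have /packingP[cp dj] := packP.
  move=> [[f|j] i] [[f'|j'] i']; rewrite /phi /=.
  - move=> e; have ef := dj _ _ _ _ (valP f) (valP f') e.
    move: e; rewrite ef => /(copy_inj tourT irrG (cp _ (valP f')))->.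
    by rewrite (val_inj ef).
  - by move=> e; have := hL (j', i'); rewrite -e valc.
  - by move=> e; have := hL (j, i); rewrite e valc.
  - by move/hinj => -[-> ->].
have [psi phiK psiK] : bijective phi.
  by apply: inj_card_bij => //; rewrite card_prod card_block card_ord cV.
by exists phi, psi.
Qed.

End Layout.

Section Augment.
Variables (R : realType) (r0 q t : nat) (T : rel 'I_r0.+1) (V I : finType) (G : rel V).
Hypotheses (tourT : forall i j, i != j -> T i j (+) T j i) (irrG : irreflexive G).
Local Notation role := 'I_r0.+1.
Local Notation J := (role * 'F_q)%type.
Variables (P : {set {ffun role -> V}}) (phi : I * role -> V) (blk : {ffun role -> V} -> I).
Hypotheses (packP : packing T G P) (phi_inj : injective phi).
Hypothesis blkE : forall f i, f \in P -> phi (blk f, i) = f i.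
Variables (w : {ffun role -> V} -> R) (A : J -> {set I}).
Variables (nu : {ffun pattern r0 q -> 'I_t.+1}) (gd : {set J}).
Hypothesis wcopy : forall f, 0 < w f -> copy T G f.
Hypothesis cA : forall j, #|A j| = t.
Hypothesis boxA : forall Z : {ffun J -> I}, (forall j, Z j \in A j) ->
  [/\ injective Z, augments phi w Z (blk @: P) nu & [set j | Z j \in blk @: P] = gd].

Let blk_inj : {in P &, injective blk}.
Proof.
move=> f g fP gP e; apply/ffunP => i.
by rewrite -(blkE i fP) -(blkE i gP) e.
Qed.

Let demand : {set pattern r0 q * 'I_t} := [set d : pattern r0 q * 'I_t | (d.2 < nu d.1)%N].
Let users (x : J * role) : {set pattern r0 q * 'I_t} := [set d in demand | contains d.1 x].

Let card_users x : #|users x| = (\sum_(g | contains g x) nu g)%N.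
Proof.
rewrite sum_card_fst [RHS]big_mkcond; apply: eq_bigr => g _.
case: ifP => gx; last by rewrite (_ : [set _ | _] = set0) ?cards0 //; apply/setP => c; rewrite !inE gx andbF.
rewrite (_ : [set _ | _] = [set c : 'I_t | (c < nu g)%N]); last first.
  by apply/setP => c; rewrite !inE gx andbT.
have nt : (nu g <= t)%N by rewrite -ltnS ltn_ord.
by rewrite -sum1dep_card -(big_ord_widen _ (fun _ => 1%N) nt) sum1_card card_ord.
Qed.

Hypothesis t0 : (0 < t)%N.

Let elem_ex j : exists u, u \in A j.
Proof. by apply/set0Pn; rewrite -card_gt0 cA. Qed.

Let Z0 : {ffun J -> I} := [ffun j => xchoose (elem_ex j)].

Let Z0A j : Z0 j \in A j.
Proof. by rewrite ffunE; exact: (xchooseP (elem_ex j)). Qed.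

Let nth_A j k : (k < t)%N -> nth (Z0 j) (enum (A j)) k \in A j.
Proof. by move=> kt; rewrite -mem_enum mem_nth // -cardE cA. Qed.

Let A_disj j j' u : u \in A j -> u \in A j' -> j = j'.
Proof.
move=> uj uj'; apply/eqP/negP => /negP nj.
pose Z : {ffun J -> I} := [ffun k => if (k == j) || (k == j') then u else Z0 k].
have [] := boxA (Z := Z).
  by move=> k; rewrite ffunE; case: eqP => [->|_] //=; case: eqP => [->|_].
move=> /(_ j j'); rewrite !ffunE !eqxx orbT => /(_ erefl) e.
by rewrite e eqxx in nj.
Qed.

Let pos (d : pattern r0 q * 'I_t) x := index d (enum (users x)).

Let pos_lt d x : d \in users x -> (pos d x < t)%N.
Proof.
move=> dx; have : (pos d x < size (enum (users x)))%N by rewrite index_mem mem_enum.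
rewrite -cardE card_users => /leq_trans; apply.
have [_ /and3P[_ /forallP h _] _] := boxA Z0A; exact: h.
Qed.

Let pick_elem d i := nth (Z0 (slot d.1 i).1) (enum (A (slot d.1 i).1)) (pos d (slot d.1 i)).

Let newcopy (d : pattern r0 q * 'I_t) : {ffun role -> V} :=
  [ffun i => phi (pick_elem d i, (slot d.1 i).2)].

Let dem_users d i : d \in demand -> d \in users (slot d.1 i).
Proof. by move=> dd; rewrite inE dd contains_slot. Qed.

Let pick_in d i : d \in demand -> pick_elem d i \in A (slot d.1 i).1.
Proof. by move=> dd; apply: nth_A; apply/pos_lt/dem_users. Qed.

Let newcopy_copy d : d \in demand -> copy T G (newcopy d).
Proof.
move=> dd.
pose Z : {ffun J -> I} :=
  [ffun j => if [pick i | (slot d.1 i).1 == j] is Some i then pick_elem d i else Z0 j].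
have ZA j : Z j \in A j.
  by rewrite ffunE; case: pickP => [i /eqP<-|_]; [exact: pick_in | exact: Z0A].
have -> : newcopy d = realize phi Z d.1.
  apply/ffunP => i; rewrite !ffunE; congr (phi (_, _)).
  case: pickP => [i' /eqP/slot1_inj->//|/(_ i)]; by rewrite eqxx.
have [_ /and3P[/forallP/(_ d.1)/implyP h _ _] _] := boxA ZA.
by apply/wcopy/h; move: dd; rewrite inE; apply: leq_ltn_trans.
Qed.

Let newcopy_inj d d' i i' : d \in demand -> d' \in demand ->
  newcopy d i = newcopy d' i' -> d = d'.
Proof.
move=> dd dd'; rewrite !ffunE => /phi_inj[e1 e2].
have ej : (slot d.1 i).1 = (slot d'.1 i').1.
  by apply: (A_disj (pick_in i dd)); rewrite e1; apply: pick_in.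
have ex : slot d.1 i = slot d'.1 i' 
  by rewrite [LHS]surjective_pairing [RHS]surjective_pairing ej; congr (_, _); exact: e2.
move: e1; rewrite /pick_elem ex => /eqP.
have u1 := dem_users i dd; have u2 := dem_users i' dd'; rewrite ex in u1.
rewrite nth_uniq ?enum_uniq -?cardE ?cA ?pos_lt // => /eqP e.
have m1 : d \in enum (users (slot d'.1 i')) by rewrite mem_enum.
have m2 : d' \in enum (users (slot d'.1 i')) by rewrite mem_enum.
by rewrite -[LHS](nth_index d m1) -[RHS](nth_index d m2); congr nth; exact: e.
Qed.

Let touched := \bigcup_j A j.
Let P' := [set f in P | blk f \notin touched] :|: newcopy @: demand.

(* The box provides [t] interchangeable blocks for every position of the sample, so the fractional
   packing [nu / t] of the sample becomes an honest packing of their union. *)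
Lemma augment : exists2 P1, packing T G P1 & (#|P| < #|P1|)%N.
Proof.
have /packingP[cp dj] := packP.
have dis f d i i' : f \in P -> blk f \notin touched -> d \in demand -> f i = newcopy d i' -> False.
  move=> fP nt dd; rewrite -(blkE i fP) ffunE => /phi_inj[e _].
  by case/negP: nt; apply/bigcupP; exists (slot d.1 i').1 => //; rewrite e pick_in.
exists P'.
  apply/packingP; split.
    by move=> f; rewrite !inE => /orP[/andP[/cp]//|/imsetP[d dd ->]]; apply: newcopy_copy.
  move=> f g i j; rewrite !inE => /orP[/andP[fP fn]|/imsetP[d dd ->]]
     /orP[/andP[gP gn]|/imsetP[d' dd' ->]].
  - exact: dj.
  - by move=> /(dis _ _ _ _ fP fn dd').
  - by move=> /esym /(dis _ _ _ _ gP gn dd).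
  - by move=> /(newcopy_inj dd dd')->.
have cdem : #|demand| = (\sum_g nu g)%N.
  rewrite sum_card_fst; apply: eq_bigr => g _.
  rewrite (_ : [set _ | _] = [set c : 'I_t | (c < nu g)%N]); last by apply/setP => c; rewrite !inE.
  have nt : (nu g <= t)%N by rewrite -ltnS ltn_ord.
  by rewrite -sum1dep_card -(big_ord_widen _ (fun _ => 1%N) nt) sum1_card card_ord.
have cnew : #|newcopy @: demand| = #|demand|.
  apply: card_in_imset => d d' dd dd' e.
  by apply: (newcopy_inj (i := 0) (i' := 0)) => //; rewrite e.
have cP' : #|P'| = (#|[set f in P | blk f \notin touched]| + #|newcopy @: demand|)%N.
  rewrite cardsU; rewrite [X in (_ - X)%N](_ : _ = 0%N) ?subn0 //.
  apply/eqP; rewrite cards_eq0; apply/eqP/setP => f; rewrite !inE.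
  apply/negP => /andP[/andP[fP fn] /imsetP[d dd e]].
  by apply: (dis f d 0 0) => //; rewrite e.
have hit : (#|[set f in P | blk f \in touched]| <= t * #|gd|)%N.
  rewrite -(card_in_imset (f := blk)); last first.
    by move=> f g; rewrite !inE => /andP[fP _] /andP[gP _]; apply: blk_inj.
  apply: (@leq_trans #|\bigcup_(j in gd) A j|).
    apply: subset_leq_card; apply/subsetP => u /imsetP[f]; rewrite inE => /andP[fP /bigcupP[j _ fj]] ->.
    apply/bigcupP; exists j => //.
    pose Z : {ffun J -> I} := [ffun k => if k == j then blk f else Z0 k].
    have ZA k : Z k \in A k by rewrite ffunE; case: eqP => [->|_].
    by have [_ _ <-] := boxA ZA; rewrite inE ffunE eqxx imset_f.
  apply: (@leq_trans (\sum_(j in gd) #|A j|)).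
    elim/big_rec2: _ => [|j s B _ IH]; first by rewrite cards0.
    by rewrite (leq_trans (leq_card_setU _ _)) // leq_add2l.
  by rewrite (eq_bigr (fun _ => t)) // sum_nat_const mulnC.
have [_ /and3P[_ _ h] hg] := boxA Z0A; rewrite hg in h.
have cPs : #|P| = (#|[set f in P | blk f \in touched]| + #|[set f in P | blk f \notin touched]|)%N.
  rewrite -(cardsID [set f | blk f \in touched]); congr (_ + _)%N; apply: eq_card => f.
    by rewrite !inE.
  by rewrite !inE andbC.
rewrite cP' cnew cdem cPs [X in (_ < X)%N]addnC ltn_add2r.
exact: leq_ltn_trans h.
Qed.

End Augment.

Section AlmostPacking.
Variable R : realType.

Lemma card_noninjective (J I : finType) :
  #|I|%:R * #|[set Z : {ffun J -> I} | ~~ injectiveb Z]|%:R <=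
    #|J|%:R ^+ 2 * #|I|%:R ^+ #|J| :> R.
Proof.
pose E (p : J * J) := [set Z : {ffun J -> I} | Z p.1 == Z p.2].
have hE p : p.1 != p.2 -> #|I|%:R * #|E p|%:R <= #|I|%:R ^+ #|J| :> R.
  move=> np; rewrite -natrM -natrX ler_nat.
  have inj : {in setX (E p) [set: I] &, injective (fun x : {ffun J -> I} * I => upd x.1 p.1 x.2)}.
    move=> [Z u] [Z' u']; rewrite !inE /= !andbT => /eqP e /eqP e' h.
    have eu : u = u' by rewrite -(upd_eq Z p.1 u) h upd_eq.
    have e2 : Z p.2 = Z' p.2.
      by move/ffunP/(_ p.2): h; rewrite !upd_neq // eq_sym.
    congr (_, _) => //; apply/ffunP => j; move/ffunP/(_ j): h; rewrite !updE.
    by case: eqP => // -> _; rewrite e e' e2.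
  by rewrite mulnC -(cardsT I) -cardsX -(card_in_imset inj) cardsT -card_ffun max_card.
have sub : [set Z : {ffun J -> I} | ~~ injectiveb Z] \subset \bigcup_(p : J * J | p.1 != p.2) E p.
  apply/subsetP => Z; rewrite inE => /injectivePn[j [j' nj e]].
  by apply/bigcupP; exists (j, j') => //; rewrite inE e.
apply: (@le_trans _ _ (#|I|%:R * \sum_(p : J * J | p.1 != p.2) #|E p|%:R)).
  by rewrite ler_wpM2l // (le_trans (lecard R sub)) // cardR_bigcup.
rewrite mulr_sumr; apply: (@le_trans _ _ (\sum_(p : J * J) #|I|%:R ^+ #|J|)).
  rewrite big_mkcond; apply: ler_sum => p _; case: ifP => [/hE//|_].
  by rewrite exprn_ge0.
by rewrite sumr_const card_prod -[_ *+ _]mulr_natl natrM expr2.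
Qed.

Lemma almost_packing (r0 : nat) (gam : R) : (0 < r0)%N -> 0 < gam -> gam <= 1 ->
  exists2 theta : R, 0 < theta & forall nu : R, 0 < nu -> exists N : nat,
  forall (T : rel 'I_r0.+1) (V : finType) (G : rel V),
    (forall i j, i != j -> T i j (+) T j i) -> irreflexive G -> (N <= #|V|)%N ->
    (r0.+1 %| #|V|)%N -> robust r0.+1 G theta gam ->
  exists2 P, packing T G P & (1 - nu) * #|V|%:R <= r0.+1%:R * #|P|%:R.
Proof.
move=> r00 gam0 gam1; have [theta theta0 hspread] := spread_measure r00 gam0 gam1.
exists theta => // nu nu0.
have [eta eta0 hsamp] := sampling r0 nu0.
have [C C0 [N1 hN1]] := hspread eta eta0.
have [q [q_prime rq [t hq]]] := hsamp C C0.
pose J := ('I_r0.+1 * 'F_q)%type.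
pose color := (option {ffun pattern r0 q -> 'I_t.+1} * {set J})%type.
have K0 : (0 < #|{: color}|)%N by apply/card_gt0P; exists (None, set0).
have KR : 0 < #|{: color}|%:R :> R by rewrite ltr0n.
have nu8 : 0 < nu / 8 by pos.
have [N2 hN2] := box t J (delta := nu / 8 / #|{: color}|%:R) ltac:(pos).
have [N3 hN3] := eventually_ge (#|{: J}|%:R ^+ 2) nu8.
exists ((N1 + N2 + N3).+1 * r0.+1)%N => T V G tourT irrG hV /dvdnP[m cV] rob.
have mN : (N1 + N2 + N3 < m)%N by move: hV; rewrite cV leq_pmul2r.
have [w [w0 wc wb ws wq]] := hN1 T V G tourT
  ltac:(rewrite cV (leq_trans _ (leq_pmulr m (ltn0Sn r0))) //; move: mN; clear; lia) rob.
have pack0 : packing T G set0.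
  by apply/packingP; split => [f|f g i j]; rewrite inE.
case: (@arg_maxnP _ set0 (packing T G) (fun P => #|P|) pack0) => P packP Pmax.
exists P => //; rewrite leNgt; apply/negP => lt.
have [phi [psi [phiK psiK phiE]]] := layout tourT irrG packP cV.
have cI := card_block tourT irrG packP cV; set I := block P m in phi psi phiK psiK phiE cI.
have I0 : (0 < #|{: I}|)%N by rewrite cI; apply: leq_ltn_trans mN.
have [x0 _] : exists x0 : I, x0 \in predT by apply/card_gt0P.
pose blk (f : {ffun 'I_r0.+1 -> V}) : I := if insub f is Some s then inl s else x0.
have blkE f i : f \in P -> phi (blk f, i) = f i.
  by move=> fP; rewrite /blk insubT phiE.
have cgood : #|blk @: P|%:R <= (1 - nu) * #|{: I}|%:R.
  apply: (@le_trans _ _ #|P|%:R); first by rewrite ler_nat leq_imset_card.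
  have rr0 : 0 < r0.+1%:R :> R by rewrite ltr0n.
  by rewrite -(ler_pM2l rr0) (le_trans (ltW lt)) // cI cV natrM mulrA [X in X <= _]mulrC.
have dense := hq V I phi psi w (blk @: P) phiK psiK I0 w0 wb wq cgood.
set X0 := [set Z | _] in dense.
pose Bad := [set Z : {ffun J -> I} | ~~ injectiveb Z].
pose X := X0 :\: Bad.
have mR : 0 < #|{: I}|%:R :> R by rewrite ltr0n.
have cBad : #|Bad|%:R <= nu / 8 * #|{: I}|%:R ^+ #|{: J}|.
  rewrite -(ler_pM2l mR); apply: (le_trans (card_noninjective J I)).
  rewrite mulrCA mulrA ler_wpM2r ?exprn_ge0 // hN3 // cI.
  by move: mN; clear; lia.
have cX : nu / 8 * #|{: I}|%:R ^+ #|{: J}| <= #|X|%:R.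
  have := cardR_D R X0 Bad; rewrite -/X; move: dense cBad.
  move: (#|{: I}|%:R ^+ #|{: J}|) (#|Bad|%:R : R) (#|X|%:R : R) (#|X0|%:R : R) => a b c d.
  by clear; lra.
pose col (Z : {ffun J -> I}) : color :=
  ([pick n | augments phi w Z (blk @: P) n], [set j | Z j \in blk @: P]).
have [[cn cg] hc] := pigeonhole R col X K0.
set Y := [set Z in X | _] in hc.
have cY : nu / 8 / #|{: color}|%:R * #|{: I}|%:R ^+ #|{: J}| <= #|Y|%:R.
  by rewrite mulrAC ler_pdivrMr // [X in _ <= X]mulrC (le_trans cX hc).
have [A [cA boxA]] := hN2 I Y ltac:(rewrite cI; move: mN; clear; lia) cY.
have [Z1 Z1Y] : exists Z, Z \in Y.
  apply/set0Pn; rewrite -card_gt0 -(ltr0n R); apply: lt_le_trans cY.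
  by rewrite mulr_gt0 ?divr_gt0 // exprn_gt0.
have inY Z : Z \in Y -> [/\ injective Z, exists n : {ffun pattern r0 q -> 'I_t.+1}, augments phi w Z (blk @: P) n & col Z = (cn, cg)].
  rewrite !inE => /andP[/andP[]]; rewrite negbK => /injectiveP Zi /existsP hn /eqP hcol.
  by split.
have [n cnE] : exists n, cn = Some n.
  have [_ [n0 hn0] [<- _]] := inY _ Z1Y.
  by case: pickP => [n _|/(_ n0)]; [exists n | rewrite hn0].
have inY' Z : Z \in Y -> [/\ injective Z, augments phi w Z (blk @: P) n & [set j | Z j \in blk @: P] = cg].
  move=> /inY[Zi _ [e1 e2]]; split => //; move: e1; rewrite cnE.
  by case: pickP => // n' hn' [<-].
have t0 : (0 < t)%N.
  have [_ /and3P[_ _ h] _] := inY' _ Z1Y; rewrite lt0n; apply/eqP => t00.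
  move: h; rewrite ltnNge (eq_bigr (fun _ => 0%N)) ?sum_nat_const ?muln0 //.
  by move=> g _; apply/eqP; rewrite -leqn0 -[X in (_ <= X)%N]t00 -ltnS ltn_ord.
have [P1 pack1 lt1] := augment packP (can_inj phiK) blkE wc cA (fun Z h => inY' Z (boxA Z h)) t0.
by suff : (#|P1| <= #|P|)%N; [rewrite leqNgt lt1 | exact: Pmax].
Qed.

End AlmostPacking.

(** * Linking pairs of vertices *)

Section Tuples.
Variables (R : realType) (V : finType).
Local Notation n := (#|V|%:R : R).

Definition hitting k (F : {set V}) := [set t : k.-tuple V | has (mem F) t].

Lemma hitting_card k (F : {set V}) :
  #|hitting k F|%:R * n <= k%:R * #|F|%:R * n ^+ k.
Proof.
elim: k => [|k IH].
  rewrite mul0r mul0r (_ : hitting 0 F = set0) ?cards0 ?mul0r //.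
  by apply/setP => t; rewrite !inE tuple0.
have inj : injective (fun t : k.+1.-tuple V => (thead t, [tuple of behead t])).
  move=> s t e; have e1 : thead s = thead t := congr1 fst e.
  have e2 : behead s = behead t := congr1 (fun p : V * k.-tuple V => val p.2) e.
  by apply/val_inj; rewrite (tuple_eta s) (tuple_eta t) /= e1 e2.
have sub : [set (thead t, [tuple of behead t]) | t in hitting k.+1 F] \subset
    setX F [set: k.-tuple V] :|: setX [set: V] (hitting k F).
  apply/subsetP => p /imsetP[t]; rewrite inE [in X in X -> _](tuple_eta t) /= => /orP[h|h] ->.
    by rewrite !inE /= h.
  by rewrite !inE /= h orbT.
have := lecard R sub; rewrite card_imset // => h.
have h2 : #|setX F [set: k.-tuple V] :|: setX [set: V] (hitting k F)|%:R <=
    #|F|%:R * n ^+ k + n * #|hitting k F|%:R.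
  apply: (le_trans (cardR_U R _ _)); rewrite !cardsX !cardsT card_tuple.
  by rewrite !natrM natrX.
have := ler_wpM2r (ler0n R #|V|) (le_trans h h2).
move/le_trans; apply; rewrite -[k.+1%:R]natr1 exprS mulrDl.
have := ler_wpM2l (ler0n R #|V|) IH.
move: (#|hitting k F|%:R : R) (#|F|%:R : R) (n ^+ k) n (k%:R : R) => a b c d e.
by clear; lra.
Qed.

Lemma avoiding_card k (X : {set k.-tuple V}) (F : {set V}) (c : R) : 0 < n ->
  c * n ^+ k <= #|X|%:R -> k%:R * #|F|%:R <= c / 2 * n ->
  c / 2 * n ^+ k <= #|[set t in X | ~~ has (mem F) t]|%:R.
Proof.
move=> n0 hX hF.
have h1 : #|hitting k F|%:R <= c / 2 * n ^+ k.
  rewrite -(ler_pM2r n0) (le_trans (hitting_card k F)) // [X in _ <= X]mulrAC ler_wpM2r //.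
  by rewrite exprn_ge0 // ltW.
have := cardR_D R X (hitting k F).
have e : X :\: hitting k F = [set t in X | ~~ has (mem F) t].
  by apply/setP => t; rewrite !inE andbC.
rewrite e; move: hX h1; move: (n ^+ k) (#|hitting k F|%:R : R) => a b; clear; lra.
Qed.

End Tuples.

Lemma disjointP (V : finType) (A B : {set V}) :
  reflect (forall x, x \in A -> x \in B -> False) [disjoint A & B].
Proof.
rewrite disjoints_subset; apply: (iffP subsetP) => h x xA; have := h x xA; rewrite inE.
  by move/negP.
by move=> h2; apply/negP.
Qed.

Section Links.
Variables (r : nat) (T : rel 'I_r) (V : finType) (G : rel V).
Hypotheses (tourT : forall i j, i != j -> T i j (+) T j i) (irrG : irreflexive G).
Implicit Types (A B S : {set V}) (x y z : V).

Definition packable S := [exists P : {set {ffun 'I_r -> V}}, packing T G P && (covered P == S)].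

Lemma packable0 : packable set0.
Proof.
apply/existsP; exists set0; apply/andP; split; last by rewrite /covered big_set0.
by apply/packingP; split => [f|f g i j]; rewrite inE.
Qed.

Lemma packable_copy (f : {ffun 'I_r -> V}) : copy T G f -> packable [set f i | i in 'I_r].
Proof.
move=> cf; apply/existsP; exists [set f]; rewrite /covered big_set1 eqxx andbT.
by apply/packingP; split => [g|g h i j]; rewrite !inE => /eqP-> // /eqP->.
Qed.

Lemma packableU A B : [disjoint A & B] -> packable A -> packable B -> packable (A :|: B).
Proof.
move=> dAB /existsP[P /andP[/packingP[P1 P2] /eqP cP]] /existsP[Q /andP[/packingP[Q1 Q2] /eqP cQ]].
apply/existsP; exists (P :|: Q); apply/andP; split; last by rewrite /covered bigcup_setU -cP -cQ.
have dis f g i j : f \in P -> g \in Q -> f i = g j -> False.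
  move=> fP gQ e; move/disjointP: dAB => /(_ (f i)); apply.
    by rewrite -cP; apply/coveredP; exists f, i.
  by rewrite -cQ e; apply/coveredP; exists g, j.
apply/packingP; split=> [f|f g i j]; rewrite !inE; first by case/orP; [exact: P1 | exact: Q1].
move=> /orP[fP|fQ] /orP[gP|gQ].
- exact: P2.
- by move/(dis _ _ _ _ fP gQ).
- by move/esym/(dis _ _ _ _ gP fQ).
- exact: Q2.
Qed.

(* The tiling of the rest can be completed on [S] whichever of [x] and [y] it misses. *)
Definition link x y S := [&& x \notin S, y \notin S, packable (x |: S) & packable (y |: S)].

Lemma link_sym x y S : link x y S = link y x S.
Proof. by rewrite /link andbCA; congr (_ && _); congr (_ && _); rewrite andbC. Qed.

Lemma link_trans x y z S1 S2 : z != x -> z != y -> y \notin S1 -> x \notin S2 ->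
  [disjoint S1 & S2] -> link x z S1 -> link z y S2 -> link x y (S1 :|: (z |: S2)).
Proof.
move=> zx zy yS1 xS2 dS /and4P[xS1 zS1 px1 pz1] /and4P[zS2 yS2 pz2 py2].
have dd u v : u \notin S2 -> v \notin S1 -> u != v -> [disjoint u |: S1 & v |: S2].
  move=> uS2 vS1 nuv; rewrite disjoint_sym disjoints_subset; apply/subsetP => a.
  rewrite !inE => /orP[/eqP->|aS2]; rewrite negb_or.
    by rewrite vS1 andbT eq_sym.
  apply/andP; split; first by apply: contraNneq uS2 => <-.
  by apply/negP => aS1; move/disjointP: dS => /(_ a aS1)/(_ aS2).
apply/and4P; split.
- by rewrite !inE !negb_or xS1 xS2 eq_sym zx.
- by rewrite !inE !negb_or yS1 yS2 eq_sym zy.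
- rewrite (_ : _ |: _ = (x |: S1) :|: (z |: S2)); last by rewrite setUA.
  by apply: packableU => //; apply: dd => //; rewrite eq_sym.
- rewrite (_ : _ |: _ = (z |: S1) :|: (y |: S2)).
    by apply: packableU => //; apply: dd.
  by apply/setP => a; rewrite !inE; do !case: (_ == _); rewrite ?orbT.
Qed.

Variable R : realType.
Local Notation n := (#|V|%:R : R).

Definition links k x y := [set t : k.-tuple V | uniq t && link x y [set z in t]].

Lemma links_sym k x y : links k x y = links k y x.
Proof. by apply/setP => t; rewrite !inE link_sym. Qed.

Lemma links_trans k1 k2 (c1 c2 : R) x y (Z : {set V}) :
  0 < n -> 0 <= c1 -> 0 <= c2 ->
  c1 * n ^+ k1.+1 <= \sum_(z in Z) #|links k1 x z|%:R ->
  (forall z, z \in Z -> c2 * n ^+ k2 <= #|links k2 z y|%:R) ->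
  (k1 + 2)%:R <= c1 / 2 * n -> (k2 * (k1 + 2))%:R <= c2 / 2 * n ->
  c1 * c2 / 4 * n ^+ (k1 + k2.+1) <= #|links (k1 + k2.+1) x y|%:R.
Proof.
move=> n0 c10 c20 h1 h2 b1 b2.
have nk k : 0 < n ^+ k by rewrite exprn_gt0.
pose ok1 z := [set t in links k1 x z | ~~ has (mem [set y]) t].
pose ok2 z (t1 : k1.-tuple V) := [set t in links k2 z y | ~~ has (mem (x |: [set u in t1])) t].
pose D := [set p : V * (k1.-tuple V * k2.-tuple V) |
  [&& p.1 \in Z :\: [set x; y], p.2.1 \in ok1 p.1 & p.2.2 \in ok2 p.1 p.2.1]].
have e1 : c1 / 2 * n ^+ k1.+1 <= \sum_(z in Z :\: [set x; y]) #|ok1 z|%:R.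
  have s1 : \sum_(z in Z) #|links k1 x z|%:R <=
      \sum_(z in Z :\: [set x; y]) #|ok1 z|%:R + (2 * n ^+ k1 + k1%:R * n ^+ k1).
    have hits z : #|links k1 x z|%:R <= #|ok1 z|%:R + #|hitting k1 [set y]|%:R :> R.
      rewrite -lerBlDr (le_trans (cardR_D R _ _)) // lecard //.
      by apply/subsetP => t; rewrite !inE andbC.
    have hy : n * #|hitting k1 [set y]|%:R <= k1%:R * n ^+ k1.
      by have := hitting_card R k1 [set y]; rewrite cards1 mulr1 mulrC.
    rewrite (big_setID [set x; y]) /= addrC.
    have -> : \sum_(z in Z :\: [set x; y]) #|ok1 z|%:R + (2 * n ^+ k1 + k1%:R * n ^+ k1) =
       (\sum_(z in Z :\: [set x; y]) #|ok1 z|%:R + k1%:R * n ^+ k1) + 2 * n ^+ k1 by ring.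
    apply: lerD.
      apply: (@le_trans _ _ (\sum_(z in Z :\: [set x; y]) (#|ok1 z|%:R + #|hitting k1 [set y]|%:R))).
        by apply: ler_sum => z _.
      rewrite big_split lerD2l sumr_const -[X in X <= _]mulr_natl; apply: le_trans hy.
      by rewrite ler_wpM2r // ler_nat max_card.
    apply: (@le_trans _ _ (\sum_(z in Z :&: [set x; y]) n ^+ k1)).
      by apply: ler_sum => z _; rewrite -natrX -card_tuple ler_nat max_card.
    rewrite sumr_const -[X in X <= _]mulr_natl ler_wpM2r ?(ltW (nk _)) // ler_nat.
    by rewrite (leq_trans (subset_leq_card (subsetIr _ _))) // cards2; case: eqP.
  have s2 : (k1 + 2)%:R * n ^+ k1 <= c1 / 2 * n * n ^+ k1 by rewrite ler_pM2r.
  move: (le_trans h1 s1) s2; rewrite natrD [n ^+ k1.+1]exprS.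
  move: (\sum_(z in Z :\: [set x; y]) _) (n ^+ k1) n (k1%:R : R) => a b c d; clear; lra.
have e2 z t1 : z \in Z -> c2 / 2 * n ^+ k2 <= #|ok2 z t1|%:R.
  move=> zZ; apply: avoiding_card => //; first exact: h2.
  apply: le_trans b2; rewrite -natrM ler_nat leq_mul2l; apply/orP; right.
  have h : (#|[set u in t1]| <= k1)%N by rewrite cardsE (leq_trans (card_size _)) // size_tuple.
  by rewrite (leq_trans (leq_card_setU _ _)) // cards1; move: h; nlia.
have cD : c1 * c2 / 4 * n ^+ (k1 + k2.+1) <= #|D|%:R.
  rewrite sum_card_fst natr_sum (bigID (mem (Z :\: [set x; y]))) /=.
  rewrite [X in _ <= _ + X]big1 ?addr0; last first.
    move=> z /negbTE nz; rewrite (_ : [set _ | _] = set0) ?cards0 //.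
    by apply/setP => p; rewrite [RHS]inE [LHS]inE /D [LHS]inE /= nz.
  have e3 : \sum_(z in Z :\: [set x; y]) #|ok1 z|%:R * (c2 / 2 * n ^+ k2) <=
     \sum_(z in Z :\: [set x; y]) #|[set b | (z, b) \in D]|%:R.
    apply: ler_sum => z zz; rewrite sum_card_fst natr_sum.
    rewrite mulr_natl -sumr_const big_mkcond; apply: ler_sum => t1 _.
    case: ifP => // t1ok; apply: (le_trans (e2 z t1 _)).
      by move: zz; rewrite inE => /andP[].
    by apply/lecard/subsetP => t2 h; rewrite inE inE inE /= zz t1ok h.
  apply: le_trans e3; rewrite -mulr_suml.
  apply: le_trans (ler_wpM2r _ e1); last by rewrite mulr_ge0 ?divr_ge0 // ltW.
  rewrite addnS -addSn exprD le_eqVlt; apply/orP; left; apply/eqP.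
  by move: (n ^+ k1.+1) (n ^+ k2) => a b; field.
apply: (le_trans cD).
pose F (p : V * (k1.-tuple V * k2.-tuple V)) : (k1 + k2.+1).-tuple V :=
  [tuple of p.2.1 ++ p.1 :: p.2.2].
have Finj : injective F.
  move=> [z [t1 t2]] [z' [t1' t2']] /(congr1 val) /= /eqP.
  rewrite eqseq_cat ?size_tuple // => /andP[/eqP e]; rewrite eqseq_cons => /andP[/eqP-> /eqP e'].
  by rewrite (val_inj e) (val_inj e').
rewrite -(card_imset _ Finj); apply/lecard/subsetP => t /imsetP[[z [t1 t2]]].
rewrite inE => /and3P[/= zZ h3 h4] ->; rewrite inE.
move: zZ; rewrite !inE negb_or => /andP[/andP[zx zy] zZ].
move: h3; rewrite inE => /andP[]; rewrite inE => /andP[u1 l1] n1.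
move: h4; rewrite inE => /andP[]; rewrite inE => /andP[u2 l2] n2.
have yt1 : y \notin t1.
  by apply: contra n1 => yt; apply/hasP; exists y => //=; rewrite inE.
have xt2 : x \notin t2.
  by apply: contra n2 => xt; apply/hasP; exists x => //=; rewrite !inE eqxx.
have dt u : u \in t1 -> u \notin t2.
  by move=> ut1; apply: contra n2 => ut2; apply/hasP; exists u => //=; rewrite !inE ut1 orbT.
have /and4P[_ zt1 _ _] := l1; have /and4P[zt2 _ _ _] := l2.
rewrite !inE in zt1 zt2.
apply/andP; split.
  rewrite /F /= cat_uniq u1 /= u2 zt2 !andbT negb_or zt1 /=.
  by apply/hasPn => u ut2; apply/negP => /dt; rewrite ut2.
have -> : [set u in F (z, (t1, t2))] = [set u in t1] :|: (z |: [set u in t2]).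
  by apply/setP => u; rewrite !inE /F /= mem_cat inE.
apply: link_trans => //; rewrite ?inE //.
by apply/disjointP => u; rewrite !inE => /dt; exact/negP.
Qed.

Definition others (w : 'I_r) (f : {ffun 'I_r -> V}) : r.-1.-tuple V := [tuple f (lift w j) | j < r.-1].

Lemma mem_others w f u : (u \in others w f) = [exists i, (i != w) && (f i == u)].
Proof.
apply/tnthP/existsP => [[j ->]|[i /andP[ni /eqP<-]]].
  by exists (lift w j); rewrite tnth_mktuple eqxx andbT eq_sym neq_lift.
rewrite eq_sym in ni; have [j -> _] := unlift_some ni.
by exists j; rewrite tnth_mktuple.
Qed.

Lemma link_others w f x y : copy T G (upd f w x) -> copy T G (upd f w y) ->
  uniq (others w f) && link x y [set z in others w f].
Proof.
have main u : copy T G (upd f w u) -> [/\ uniq (others w f), u \notin others w f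
    & packable (u |: [set z in others w f])].
  move=> cu; have inj := copy_inj tourT irrG cu; split.
  - rewrite /others /= map_inj_uniq ?enum_uniq // => i j e.
    by apply: (@lift_inj _ w); apply: inj; rewrite !upd_neq // eq_sym neq_lift.
  - rewrite mem_others; apply/negP => /existsP[i /andP[ni /eqP e]].
    by have : i = w by [apply: inj; rewrite upd_eq upd_neq]; apply/eqP.
  - rewrite (_ : _ |: _ = [set upd f w u i | i in 'I_r]); first exact: packable_copy.
    apply/setP => a; rewrite !inE mem_others; apply/orP/imsetP.
      case=> [/eqP->|/existsP[i /andP[ni /eqP<-]]]; first by exists w; rewrite ?upd_eq.
      by exists i => //; rewrite upd_neq.
    case=> i _ ->; rewrite updE; case: (eqVneq i w) => [_|ni]; first by left.
    by right; apply/existsP; exists i; rewrite ni eqxx.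
by move=> /main[h1 h2 h3] /main[_ h4 h5]; rewrite h1 /link !inE h2 h4 h3 h5.
Qed.

Lemma links_of_swap w x y :
  #|[set f | copy T G (upd f w x) && copy T G (upd f w y)]|%:R <= #|links r.-1 x y|%:R * n.
Proof.
set D := [set f | _]; pose F (f : {ffun 'I_r -> V}) := (others w f, f w).
have Finj : injective F.
  move=> f g e; have e1 : others w f = others w g := congr1 fst e.
  have e2 : f w = g w := congr1 snd e.
  apply/ffunP => i; case: (eqVneq w i) => [<-//|ni].
  have [j -> _] := unlift_some ni.
  by have := congr1 (fun t : r.-1.-tuple V => tnth t j) e1; rewrite !tnth_mktuple.
rewrite -natrM ler_nat -(cardsT V) -cardsX -(card_imset _ Finj).
apply: subset_leq_card; apply/subsetP => p /imsetP[f]; rewrite inE => /andP[c1 c2] ->.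
by rewrite inE /= in_setT andbT inE link_others.
Qed.

Lemma links_of_copies w y (Z : {set V}) :
  #|[set f | [&& copy T G f, f w \in Z & copy T G (upd f w y)]]|%:R <=
    \sum_(z in Z) #|links r.-1 y z|%:R :> R.
Proof.
set D := [set f | _]; pose F (f : {ffun 'I_r -> V}) := (f w, others w f).
have Finj : injective F.
  move=> f g e; have e2 : others w f = others w g := congr1 snd e.
  have e1 : f w = g w := congr1 fst e.
  apply/ffunP => i; case: (eqVneq w i) => [<-//|ni].
  have [j -> _] := unlift_some ni.
  by have := congr1 (fun t : r.-1.-tuple V => tnth t j) e2; rewrite !tnth_mktuple.
have -> : \sum_(z in Z) #|links r.-1 y z|%:R =
    #|[set p : V * r.-1.-tuple V | (p.1 \in Z) && (p.2 \in links r.-1 y p.1)]|%:R :> R.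
  rewrite sum_card_fst natr_sum big_mkcond; apply: eq_bigr => z _; case: ifP => zZ.
    by congr (_%:R); apply: eq_card => t; rewrite !inE zZ.
  by rewrite (_ : [set _ | _] = set0) ?cards0 //; apply/setP => t; rewrite !inE zZ.
rewrite ler_nat -(card_imset _ Finj).
apply: subset_leq_card; apply/subsetP => p /imsetP[f fD ->].
have /and3P[c1 fZ c2] : [&& copy T G f, f w \in Z & copy T G (upd f w y)] by move: fD; rewrite inE.
by rewrite inE /= fZ inE link_others // upd_id.
Qed.

End Links.

Section Connect.
Variables (R : realType) (r : nat) (T : rel 'I_r) (V : finType) (G : rel V).
Hypotheses (tourT : forall i j, i != j -> T i j (+) T j i) (irrG : irreflexive G).
Local Notation n := (#|V|%:R : R).
Local Notation copy := (copy T G).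
Local Notation partial := (partial T G).
Local Notation compat := (compat T G).
Local Notation q := (r%:R^-1 : R).
Implicit Types (f : {ffun 'I_r -> V}) (L M : {set 'I_r}) (x y z v : V).
Variables (gam theta ze : R).
Hypotheses (n0 : 0 < n) (r3 : (3 <= r)%N) (rob : robust r G theta gam) (th0 : 0 <= theta).
Hypotheses (ze0 : 0 < ze) (zeg : ze <= gam / 8) (ze1 : ze <= 1).
Hypotheses (rth : r%:R * theta <= ze ^+ 2 / 4) (rthq : r%:R * theta <= q / 4).

Let D := (q + theta) * n.

Local Ltac qlra := move: (r%:R^-1 : R) => ?; lra.

Let rR : 3 <= r%:R :> R. Proof. by rewrite ler_nat. Qed.
Let q0 : 0 < q. Proof. by rewrite invr_gt0; apply: lt_le_trans rR. Qed.
Let D0 : 0 <= D. Proof. by rewrite /D mulr_ge0 ?(ltW n0) // addr_ge0 // ltW. Qed.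
Let rD : r%:R * D = n + r%:R * theta * n.
Proof.
rewrite /D mulrA mulrDr divff ?mulrDl ?mul1r // gt_eqF //.
by apply: lt_le_trans rR.
Qed.
Let rthn : r%:R * theta * n <= q / 4 * n. Proof. by rewrite ler_wpM2r // ltW. Qed.
Let thn : 0 <= theta * n. Proof. by rewrite mulr_ge0 // ltW. Qed.
Let qn : 0 < q * n. Proof. by rewrite mulr_gt0. Qed.

Let ncD i k x : i != k -> #|ncompat T G i k x|%:R <= D.
Proof. exact: (ncompat_card tourT x rob). Qed.

Let card_lt L M k : L \subset M -> k \in M -> k \notin L -> (#|L| < #|M|)%N.
Proof.
move=> sL kM kL; apply: proper_card; rewrite properE sL.
by apply/negP => /subsetP/(_ k kM); rewrite (negbTE kL).
Qed.

Let candD (S : {set V}) L k f : k \notin L ->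
  #|S|%:R - #|L|%:R * D <= #|[set v in S | [forall i in L, compat i k (f i) v]]|%:R.
Proof.
move=> kL; apply: cand_card => i iL; apply: le_trans (lecard R (subsetIr _ _)) (ncD _ _).
by apply: contraNneq kL => <-.
Qed.

Lemma direct_or_clique_aux (w a b : 'I_r) x y : w != a -> w != b -> a != b ->
  T w a -> T w b -> T a b ->
  ze ^+ 3 / 8 * q ^+ (r - 3) * n ^+ r <=
    #|[set f | copy (upd f w x) && copy (upd f w y)]|%:R
  \/ exists A B K, near_clique r G gam ze A B K /\ (r = 3%N -> A = B).
Proof.
move=> nwa nwb nab Twa Twb Tab.
pose M := ~: [set w; a; b].
have cM : (#|M| + 3 = r)%N.
  have h3 : #|[set w; a; b]| = 3%N.
    by rewrite cardsU cards2 cards1 nwa /= (_ : _ :&: _ = set0) ?cards0 //;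
      apply/setP => i; rewrite !inE; apply/negP => /andP[/orP[/eqP->|/eqP->] /eqP e];
      [rewrite e eqxx in nwb | rewrite e eqxx in nab].
  by rewrite -h3 addnC cardsC card_ord.
pose S i := [set v | compat w i x v && compat w i y v].
have cS i : i != w -> n - 2 * D <= #|S i|%:R.
  move=> ni; have sub : ~: S i \subset ncompat T G w i x :|: ncompat T G w i y.
    by apply/subsetP => v; rewrite !inE negb_and.
  have := cardR_C R (S i); have := le_trans (lecard R sub) (cardR_U R _ _).
  have := ncD (k := i) x (i := w); have := ncD (k := i) y (i := w).
  by rewrite eq_sym ni => /(_ isT) h1 /(_ isT) h2; lra.
have Mw i : i \in M -> [/\ i != w, i != a & i != b].
  by rewrite !inE !negb_or => /andP[/andP[-> ->] ->].
pose X := [set f | [&& partial M f, true & [forall i in M :\: set0, f i \in S i]]].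
have cX : q ^+ #|M| * n ^+ r <= #|X|%:R.
  have := @greedy_place R r T V G (fun _ i => S i) xpredT set0 M (q * n) (ltW qn) (sub0set _)
     (fun _ _ _ _ _ _ => isT) (fun _ _ _ _ _ => fun i => erefl).
  rewrite setD0 => gp; have {gp} := gp _.
  have -> : [set f | partial set0 f && xpredT f] = setT.
    by apply/setP => f; rewrite !inE partial0.
  rewrite cardsT card_ffun card_ord natrX exprMn => gp.
  rewrite -(ler_pM2r (exprn_gt0 #|M| n0)) mulrAC.
  have -> : #|X| = #|[set f | [&& partial M f, xpredT f & [forall i in M, f i \in S i]]]|.
    by rewrite /X setD0.
  apply: gp => L k f _ sL kM kL _ _ _.
  apply: le_trans (candD (S k) f kL); have [kw _ _] := Mw k kM.
  have h1 := cS k kw; have h2 : (#|L| + 4 <= r)%N by move: (card_lt sL kM kL) cM; move: #|L| #|M| => c1 c2; nlia.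
  have h3 : #|L|%:R * D <= (r%:R - 4) * D.
    by rewrite ler_wpM2r // lerBrDr -natrD ler_nat.
  by move: h1 h3 rthn thn qn; rewrite mulrBl rD /D; qlra.
pose A f := [set v in S a | [forall i in M, compat i a (f i) v]].
pose B f := [set v in S b | [forall i in M, compat i b (f i) v]].
have wM : w \notin M by rewrite !inE eqxx.
have aM : a \notin M by rewrite !inE eqxx orbT.
have bM : b \notin M by rewrite !inE eqxx orbT.
have cMR : #|M|%:R * D = n + r%:R * theta * n - 3 * D.
  by rewrite -rD; have := congr1 (fun m => m%:R : R) cM; rewrite natrD => <-; ring.
have cA f : (q - r%:R * theta) * n <= #|A f|%:R.
  apply: le_trans (candD (S a) f aM); have := cS a; rewrite eq_sym nwa cMR => /(_ isT).
  by rewrite /D; move: thn; qlra.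
have cB f : (q - r%:R * theta) * n <= #|B f|%:R.
  apply: le_trans (candD (S b) f bM); have := cS b; rewrite eq_sym nwb cMR => /(_ isT).
  by rewrite /D; move: thn; qlra.
have kap0 : 0 < ze ^+ 3 / 8 by pos.
have rth0 : 0 <= r%:R * theta by rewrite mulr_ge0.
have r_neq0 : 0 < r%:R :> R by apply: lt_le_trans rR.
have th_le : theta <= r%:R * theta by rewrite ler_peMl //; apply: le_trans rR; lra.
have [/existsP[f /andP[fX sparse]]|dense] := boolP [exists f, (f \in X) &&
    (#|[set p : V * V | [&& p.1 \in A f, p.2 \in B f & G p.1 p.2]]|%:R <= ze ^+ 3 / 8 * n ^+ 2)].
  right; have [K nc] : exists K, near_clique r G gam ze (A f) (B f) K.
    have rth2 : theta + (r%:R - 1) * theta <= ze ^+ 2 / 4.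
      by apply: le_trans rth; rewrite mulrBl mul1r subrKC.
    have sub1 : (q - (r%:R - 1) * theta) * n <= #|A f|%:R.
      apply: le_trans (candD (S a) f aM); have := cS a; rewrite eq_sym nwa cMR => /(_ isT).
      by rewrite /D; qlra.
    have sub2 : (q - (r%:R - 1) * theta) * n <= #|B f|%:R.
      apply: le_trans (candD (S b) f bM); have := cS b; rewrite eq_sym nwb cMR => /(_ isT).
      by rewrite /D; qlra.
    have xi0 : 0 <= (r%:R - 1) * theta by rewrite mulr_ge0 // subr_ge0; apply: le_trans rR; lra.
    exact: near_clique_of_sparse n0 rob ze0 zeg ze1 th0 xi0 rth2 kap0 (lexx _) sub1 sub2 sparse.
  exists (A f), (B f), K; split => // e3.
  have M0 : M = set0 by apply/eqP; rewrite -cards_eq0; move: e3 cM; move: {+}r #|M| => c1 c2; nlia.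
  apply/setP => v; rewrite !inE M0.
  have -> : [forall i in set0, compat i a (f i) v] by apply/forall_inP => i; rewrite inE.
  have -> : [forall i in set0, compat i b (f i) v] by apply/forall_inP => i; rewrite inE.
  by rewrite !(compat_out G tourT _ _ nwa Twa) !(compat_out G tourT _ _ nwb Twb).
left; set Y := [set f | _].
have st : ze ^+ 3 / 8 * n ^+ 2 * #|X|%:R <= #|Y|%:R * n ^+ 2.
  apply: (step_count2 nab) => f fX.
  have h : ze ^+ 3 / 8 * n ^+ 2 <=
     #|[set p : V * V | [&& p.1 \in A f, p.2 \in B f & G p.1 p.2]]|%:R.
    by move: dense; rewrite negb_exists => /forallP/(_ f); rewrite fX /= -ltNge => /ltW.
  apply: (le_trans h); apply/lecard/subsetP => -[u v]; rewrite inE /=.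
  rewrite [in X in X -> _]inE [v \in _]inE => /and3P[/andP[uS /forall_inP uc] /andP[vS /forall_inP vc] Guv].
  move: fX; rewrite inE /= setD0 => /andP[pM /forall_inP sM].
  set f' := upd (upd f a u) b v.
  have f'a : f' a = u by rewrite /f' upd_neq // upd_eq.
  have f'b : f' b = v by rewrite /f' upd_eq.
  have f'M i : i \in M -> f' i = f i by move=> /Mw[_ ia ib]; rewrite /f' !upd_neq.
  have pf : partial [set~ w] f'.
    rewrite (_ : [set~ w] = b |: (a |: M)).
      apply: partial_upd.
      - by rewrite in_setU1 (negbTE bM) orbF eq_sym.
      - by apply: partial_upd.
      - move=> i; rewrite in_setU1 => /orP[/eqP->|iM].
          by rewrite upd_eq compat_out.
        by rewrite upd_neq; [apply: vc | have [] := Mw i iM].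
    apply/setP => i; rewrite !inE; case: (eqVneq i w) => [->|nw] /=.
      by rewrite (negbTE nwa) (negbTE nwb).
    by case: (i == a); case: (i == b).
  have cw i z : i != w -> z = x \/ z = y -> compat i w (f' i) z.
    move=> iw zz; rewrite compat_sym.
    have [->|ia] := eqVneq i a.
      by rewrite f'a; move: uS; rewrite inE => /andP[c1 c2]; case: zz => ->.
    have [->|ib] := eqVneq i b.
      by rewrite f'b; move: vS; rewrite inE => /andP[c1 c2]; case: zz => ->.
    have iM : i \in M by rewrite !inE !negb_or iw ia ib.
    by rewrite f'M //; move: (sM i iM); rewrite inE => /andP[c1 c2]; case: zz => ->.
  rewrite inE /= -/f' [_ \in Y]inE; apply/andP; split; apply: copy_upd => // i iw; apply: cw => //.
  - by left.
  - by right.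
have {st}st : ze ^+ 3 / 8 * #|X|%:R <= #|Y|%:R.
  by rewrite -(ler_pM2r (exprn_gt0 2 n0)) mulrAC.
have e3 : #|M| = (r - 3)%N by move: cM; move: {+}r #|M| => c1 c2; nlia.
rewrite -e3 -mulrA; apply: le_trans st.
by rewrite ler_pM2l.
Qed.

Lemma direct_or_clique (w a b : 'I_r) x y : w != a -> w != b -> a != b ->
  T w a -> T w b ->
  ze ^+ 3 / 8 * q ^+ (r - 3) * n ^+ r <=
    #|[set f | copy (upd f w x) && copy (upd f w y)]|%:R
  \/ (4 <= r)%N /\ exists A B K, near_clique r G gam ze A B K.
Proof.
move=> wa wb ab Ta Tb.
have main a' b' : w != a' -> w != b' -> a' != b' -> T w a' -> T w b' -> T a' b' ->
  ze ^+ 3 / 8 * q ^+ (r - 3) * n ^+ r <=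
    #|[set f | copy (upd f w x) && copy (upd f w y)]|%:R
  \/ (4 <= r)%N /\ exists A B K, near_clique r G gam ze A B K.
  move=> h1 h2 h3 h4 h5 h6.
  have [->|[A [B [K [nc e]]]]] := direct_or_clique_aux x y h1 h2 h3 h4 h5 h6; first by left.
  right; split; last by exists A, B, K.
  rewrite ltn_neqAle r3 andbT; apply/eqP => e3; have eAB := e (esym e3).
  have := nc_big nc; have /eqP -> : K == set0.
    by rewrite -subset0 -(setDv B) -{1}eAB; apply: nc_sub nc.
  have g0 : 0 < gam by rewrite -(pmulr_lgt0 _ (_ : 0 < 8^-1 :> R)) ?invr_gt0 //; apply: lt_le_trans zeg.
  by rewrite cards0 leNgt (_ : 0 < gam / 4 * n) // mulr_gt0 // divr_gt0.
case Tab : (T a b); first exact: main Ta Tb Tab.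
apply: main Tb Ta _ => //; first by rewrite eq_sym.
by have := tourT ab; rewrite Tab.
Qed.

End Connect.

Lemma popular (R : realType) (A B : finType) (X : {set A}) (Y : {set B}) (P : A -> B -> bool) (s : R) :
  0 <= s -> (0 < #|X|)%N ->
  (forall a, a \in X -> 2 * s * #|B|%:R <= #|[set b in Y | P a b]|%:R) ->
  s * #|B|%:R <= #|[set b in Y | s * #|X|%:R <= #|[set a in X | P a b]|%:R]|%:R.
Proof.
move=> s0 X0 h; set Z := [set b in Y | _].
have h1 : #|X|%:R * (2 * s * #|B|%:R) <= \sum_(a in X) #|[set b in Y | P a b]|%:R.
  by rewrite mulr_natl -sumr_const; apply: ler_sum.
have h2 : \sum_(b in Y) #|[set a in X | P a b]|%:R <= #|Z|%:R * #|X|%:R + #|B|%:R * (s * #|X|%:R).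
  rewrite (bigID (mem Z)) /=; apply: lerD.
    apply: (@le_trans _ _ (\sum_(b in Y | b \in Z) #|X|%:R)).
      by apply: ler_sum => b _; apply/lecard/subsetP => a; rewrite inE => /andP[].
    rewrite sumr_const -[X in X <= _]mulr_natl ler_wpM2r // ler_nat.
    by apply/subset_leq_card/subsetP => b /andP[].
  apply: (@le_trans _ _ (\sum_(b in Y | b \notin Z) s * #|X|%:R)).
    by apply: ler_sum => b /andP[bY]; rewrite inE bY /= -ltNge => /ltW.
  by rewrite sumr_const -[X in X <= _]mulr_natl ler_wpM2r ?mulr_ge0 // ler_nat max_card.
rewrite -(ler_pM2r (_ : 0 < #|X|%:R)) ?ltr0n //.
move: h1 h2; rewrite (double_count R X Y P).
by move: (\sum_(b in Y) _) (#|Z|%:R : R) (#|B|%:R : R) (#|X|%:R : R) => a b c d; clear; lra.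
Qed.

Section Clique.
Variables (R : realType) (r : nat) (T : rel 'I_r) (V : finType) (G : rel V).
Hypotheses (tourT : forall i j, i != j -> T i j (+) T j i) (irrG : irreflexive G).
Local Notation n := (#|V|%:R : R).
Local Notation copy := (copy T G).
Local Notation partial := (partial T G).
Local Notation compat := (compat T G).
Local Notation ncompat := (ncompat T G).
Local Notation nonout := (nonout G).
Local Notation nonin := (nonin G).
Local Notation q := (r%:R^-1 : R).
Implicit Types (f : {ffun 'I_r -> V}) (L M : {set 'I_r}) (x y z v : V).

Lemma two_phase w (S : 'I_r -> {set V}) (U : {set V}) (h : R) : 0 < n -> 0 <= h ->
  (forall L k f, L \subset [set~ w] -> k != w -> k \notin L -> partial L f ->
     (forall i, i \in L -> f i \in S i) ->
     h * n <= #|[set v in S k | [forall i in L, compat i k (f i) v]]|%:R) ->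
  (forall f, partial [set~ w] f -> (forall i, i != w -> f i \in S i) ->
     h * n <= #|[set v in U | [forall i in [set~ w], compat i w (f i) v]]|%:R) ->
  (h * n) ^+ r <= #|[set f | [&& copy f, f w \in U & [forall i in [set~ w], f i \in S i]]]|%:R.
Proof.
move=> n0 h0 ph1 ph2; have hn : 0 <= h * n by rewrite mulr_ge0 // ltW.
pose X := [set f | [&& partial [set~ w] f, true & [forall i in [set~ w] :\: set0, f i \in S i]]].
have cX : h ^+ r.-1 * n ^+ r <= #|X|%:R.
  have := @greedy_place R r T V G (fun _ i => S i) xpredT set0 [set~ w] (h * n) hn (sub0set _)
     (fun _ _ _ _ _ _ => isT) (fun _ _ _ _ _ => fun i => erefl).
  rewrite setD0 => gp; have {gp} := gp _.
  have -> : [set f | partial set0 f && xpredT f] = setT.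
    by apply/setP => f; rewrite !inE partial0.
  have -> : #|[set~ w]| = r.-1 by rewrite cardsC1 card_ord.
  rewrite cardsT card_ffun card_ord natrX exprMn => gp.
  rewrite -(ler_pM2r (exprn_gt0 r.-1 n0)) mulrAC /X setD0.
  apply: gp => L k f _ sL kM kL pf _ hf.
  by apply: ph1 => // [|i iL]; [move: kM; rewrite !inE | apply: hf => //; rewrite inE].
set Y := [set f | _].
have st : h * n * #|X|%:R <= #|Y|%:R * n.
  apply: (step_count (k := w)) => f; rewrite inE setD0 /= => /andP[pf /forall_inP sf].
  apply: le_trans (ph2 f pf _) _ => [i iw|]; first by apply: sf; rewrite !inE.
  apply/lecard/subsetP => v; rewrite !inE => /andP[vU /forall_inP vc].
  rewrite upd_eq vU copy_upd // => [|i iw]; last by apply: vc; rewrite !inE.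
  by apply/forall_inP => i iw; rewrite upd_neq ?sf //; move: iw; rewrite !inE.
have r0 : (0 < r)%N by apply: leq_ltn_trans (ltn_ord w).
rewrite -(ler_pM2r n0); apply: le_trans st.
have -> : (h * n) ^+ r = h * (h ^+ r.-1 * n ^+ r) by rewrite exprMn mulrA -exprS prednK.
by rewrite [X in _ <= X]mulrAC ler_wpM2r ?(ltW n0) // ler_wpM2l.
Qed.

Variables (gam theta ze u eta : R) (A B K : {set V}).
Hypotheses (n0 : 0 < n) (r4 : (4 <= r)%N) (rob : robust r G theta gam) (th0 : 0 <= theta).
Hypotheses (nc : near_clique r G gam ze A B K).
Hypotheses (gam0 : 0 < gam) (gam1 : gam <= 1) (ze0 : 0 < ze) (u0 : 0 < u) (eta0 : 0 < eta).
Hypotheses (rth : r%:R * theta <= ze) (ru : r%:R * u <= q / 64).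
Hypotheses (eq4 : eta <= q / 64) (eu : eta <= u / 4) (eg : eta <= gam / 16).
Hypothesis (e2 : eta * 2 <= gam * u * (q / 4) ^+ r).
Hypothesis (rze : r%:R * ze <= eta).

Let be := gam * u.
Let D := (q + theta) * n.

Local Ltac qlra := move: (r%:R^-1 : R) => ?; lra.

Let rR : 4 <= r%:R :> R. Proof. by rewrite ler_nat. Qed.
Let q0 : 0 < q. Proof. by rewrite invr_gt0; apply: lt_le_trans rR. Qed.
Let D0 : 0 <= D. Proof. by rewrite /D mulr_ge0 ?(ltW n0) // addr_ge0 // ltW. Qed.
Let rD : r%:R * D = n + r%:R * theta * n.
Proof.
rewrite /D mulrA mulrDr divff ?mulrDl ?mul1r // gt_eqF //.
by apply: lt_le_trans rR.
Qed.
Let DE : D = q * n + theta * n. Proof. by rewrite /D mulrDl. Qed.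
Let rthn : r%:R * theta * n <= ze * n. Proof. by rewrite ler_wpM2r // ltW. Qed.
Let thn : 0 <= theta * n. Proof. by rewrite mulr_ge0 // ltW. Qed.
Let rthn4 : 4 * (theta * n) <= r%:R * theta * n. Proof. by rewrite -[X in _ <= X]mulrA ler_wpM2r. Qed.
Let zen : 0 < ze * n. Proof. by rewrite mulr_gt0. Qed.
Let rzen : r%:R * ze * n <= eta * n. Proof. by rewrite ler_wpM2r // ltW. Qed.
Let rzen4 : 4 * (ze * n) <= r%:R * ze * n.
Proof. by rewrite -[X in _ <= X]mulrA ler_wpM2r // ltW. Qed.
Let etaq : eta * n <= q / 64 * n. Proof. by rewrite ler_wpM2r // ltW. Qed.
Let etau : eta * n <= u / 4 * n. Proof. by rewrite ler_wpM2r // ltW. Qed.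
Let etag : eta * n <= gam / 16 * n. Proof. by rewrite ler_wpM2r // ltW. Qed.
Let run : r%:R * u * n <= q / 64 * n. Proof. by rewrite ler_wpM2r // ltW. Qed.
Let run4 : 4 * (u * n) <= r%:R * u * n.
Proof. by rewrite -[X in _ <= X]mulrA ler_wpM2r // mulr_ge0 // ltW. Qed.
Let rq : r%:R * (q * n) = n.
Proof. by rewrite mulrA divff ?mul1r // gt_eqF //; apply: lt_le_trans rR. Qed.
Let qn : 0 < q * n. Proof. by rewrite mulr_gt0. Qed.
Let ben : 0 < be * n. Proof. by rewrite !mulr_gt0. Qed.
Let beu : be * n <= u * n. Proof. by rewrite ler_wpM2r ?(ltW n0) // ler_piMl // ltW. Qed.
Let beg : be * n <= gam / 64 * n.
Proof.
rewrite ler_wpM2r ?(ltW n0) // /be ler_wpM2l ?(ltW gam0) //.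
have : r%:R * u <= 1 / 64.
  have q1 : q <= 1 by rewrite invf_le1; [apply: le_trans rR; lra | apply: lt_le_trans rR].
  by move: ru q1; qlra.
have : 1 * u <= r%:R * u by rewrite ler_wpM2r ?(ltW u0) //; apply: le_trans rR; lra.
by rewrite mul1r => h1 h2; apply: (le_trans h1); apply: (le_trans h2); rewrite div1r.
Qed.

Let LD L m : (#|L| + m <= r)%N -> #|L|%:R * D <= n + r%:R * theta * n - m%:R * D.
Proof.
move=> h; rewrite -rD -mulrBl ler_wpM2r // lerBrDr -natrD ler_nat //.
Qed.

Let ncD i k x : i != k -> #|ncompat i k x|%:R <= D.
Proof. exact: (ncompat_card tourT x rob). Qed.

Let card_out L k : k \notin L -> (#|L| + 1 <= r)%N.
Proof.
move=> kL; have : (#|k |: L| <= r)%N by rewrite -[X in (_ <= X)%N]card_ord max_card.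
by rewrite cardsU1 kL addnC.
Qed.

Let card_out2 L k w : k != w -> w \notin L -> k \notin L -> (#|L| + 2 <= r)%N.
Proof.
move=> kw wL kL; have : w \notin k |: L by rewrite in_setU1 negb_or eq_sym kw.
by move/card_out; rewrite cardsU1 kL /= add1n addn1 addn2.
Qed.

Let candD (S : {set V}) L k f : k \notin L ->
  #|S|%:R - #|L|%:R * D <= #|[set v in S | [forall i in L, compat i k (f i) v]]|%:R.
Proof.
move=> kL; apply: cand_card => i iL; apply: le_trans (lecard R (subsetIr _ _)) (ncD _ _).
by apply: contraNneq kL => <-.
Qed.

Let Kn : gam / 4 * n <= #|K|%:R := nc_big nc.

Lemma clique_pair w x y : x \in K -> y \in K ->
  (eta * n) ^+ r <= #|[set f | copy (upd f w x) && copy (upd f w y)]|%:R.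
Proof.
move=> xK yK; pose S i := [set v in K | compat w i x v && compat w i y v].
have cS i : i != w -> #|K|%:R - 2 * (ze * n) <= #|S i|%:R.
  rewrite eq_sym => ni.
  have sub : K :\: S i \subset (K :&: ncompat w i x) :|: (K :&: ncompat w i y).
    apply/subsetP => v; rewrite !inE => /andP[+ vK]; rewrite vK /= negb_and.
    by rewrite /compat /ncompat.
  have := near_clique_ncompat tourT nc xK ni; have := near_clique_ncompat tourT nc yK ni.
  have := le_trans (lecard R sub) (cardR_U R _ _); have := cardR_D R K (K :\: S i).
  have : #|K :\: (K :\: S i)|%:R <= #|S i|%:R :> R by rewrite setDDr setDv set0U lecard // subsetIr.
  by lra.
have room : forall L k f, k \notin L -> (forall i, i \in L -> f i \in K) ->
    forall S' : {set V}, S' \subset K -> #|K|%:R - 2 * (ze * n) <= #|S'|%:R ->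
    eta * n <= #|[set v in S' | [forall i in L, compat i k (f i) v]]|%:R.
  move=> L k f kL fL S' sS' cS'.
  apply: (@le_trans _ _ (#|S'|%:R - #|L|%:R * (ze * n))).
    have : #|L|%:R * (ze * n) <= r%:R * ze * n.
      by rewrite -[X in _ <= X]mulrA ler_wpM2r ?(ltW zen) // ler_nat -[X in (_ <= X)%N]card_ord max_card.
    by move: cS' Kn etag rzen rzen4 zen; lra.
  apply: cand_card => i iL; have iK := fL i iL.
  apply: le_trans (near_clique_ncompat tourT nc iK (_ : i != k)).
    exact/lecard/setSI.
  by apply: contraNneq kL => <-.
have tp : (eta * n) ^+ r <= #|[set f | [&& copy f, f w \in K & [forall i in [set~ w], f i \in S i]]]|%:R.
  apply: two_phase => //; first exact: ltW.
    move=> L k f sL kw kL _ fS; apply: room => //; last exact: cS.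
      by move=> i /fS; rewrite inE => /andP[].
    by apply/subsetP => v; rewrite inE => /andP[].
  move=> f _ fS; apply: room => //.
  - by rewrite !inE eqxx.
  - by move=> i; rewrite !inE => /fS; rewrite inE => /andP[].
  - by move: zen; lra.
apply: (le_trans tp); apply/lecard/subsetP => f; rewrite !inE => /and3P[cf _ /forall_inP fS].
have pf : partial [set~ w] f by apply: partialS cf; apply: subsetT.
have sw i : i != w -> compat i w (f i) x && compat i w (f i) y.
  move=> iw; have := fS i; rewrite !inE => /(_ iw) /andP[_].
  by rewrite ![compat w _ _ _]compat_sym.
by rewrite !copy_upd // => i /sw /andP[].
Qed.

(* The vertices that cannot be linked directly to [K]. *)
Definition far := [set y | (#|K :\: nonout y|%:R < be * n) && (#|K :\: nonin y|%:R < be * n)].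

Lemma far_clique y : y \in K -> y \notin far.
Proof.
move=> yK; rewrite inE negb_and; apply/orP; right; rewrite -leNgt.
have := nc_in nc yK; have := cardR_D R K (nonin y :&: K).
have -> : K :\: nonin y :&: K = K :\: nonin y by rewrite setIC setDIr setDv set0U.
by move: Kn beg etag rzen rzen4 zen; lra.
Qed.

Lemma far_few w y : #|far|%:R < (q - u) * n ->
  (eta * n) ^+ r <= #|[set f | [&& copy f, f w \in ~: far & copy (upd f w y)]]|%:R.
Proof.
move=> few; pose S i := ~: ncompat w i y.
have tp : (eta * n) ^+ r <= #|[set f | [&& copy f, f w \in ~: far & [forall i in [set~ w], f i \in S i]]]|%:R.
  apply: two_phase => //; first exact: ltW.
    move=> L k f sL kw kL _ fS; apply: le_trans (candD (S k) f kL).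
    have wL : w \notin L by apply/negP => /(subsetP sL); rewrite !inE eqxx.
    have := LD (card_out2 kw wL kL); have := cardR_C R (ncompat w k y).
    have := @ncD w k y; rewrite eq_sym kw => /(_ isT).
    by rewrite DE; move: rthn thn zen rzen rzen4 etaq rthn4; qlra.
  have wL : w \notin [set~ w] by rewrite !inE eqxx.
  move=> f _ _; apply: le_trans (candD _ f wL); have := LD (card_out wL).
  have := cardR_C R far; move: few; rewrite mulrBl DE.
  by move: rthn thn zen rzen rzen4 etaq rthn4 etau; qlra.
apply: (le_trans tp); apply/lecard/subsetP => f; rewrite !inE => /and3P[cf -> /forall_inP fS].
rewrite cf /= copy_upd // => [|i iw]; first by apply: partialS cf; apply: subsetT.
by have := fS i; rewrite !inE iw negbK compat_sym => /(_ isT).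
Qed.

Lemma far_many w y : (q - u) * n <= #|far|%:R -> y \in far ->
  (eta * n) ^+ r <= #|[set f | [&& copy f, f w \in ~: far & copy (upd f w y)]]|%:R.
Proof.
move=> many yF.
have outD v : v \in far -> [/\ #|nonout v|%:R <= D, #|nonin v|%:R <= D,
    #|K|%:R - be * n <= #|K :&: nonout v|%:R & #|K|%:R - be * n <= #|K :&: nonin v|%:R].
  rewrite inE => /andP[h1 h2]; have [r1 r2 _] := rob; split; [exact: r1|exact: r2| |].
    by have := cardR_ID R K (nonout v); lra.
  by have := cardR_ID R K (nonin v); lra.
have Kle : #|K|%:R <= q * n + theta * n + be * n.
  have [h1 _ h3 _] := outD y yF; have := lecard R (subsetIr K (nonout y)).
  by move: h1 h3; rewrite DE; lra.
have Kdis v : v \in K -> v \in B -> False.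
  by move=> /(subsetP (nc_sub nc)); rewrite inE => /andP[/negP].
have farB : #|far :\: B|%:R <= ze * n + 4 * u * n.
  have h1 : #|K|%:R * (#|far :\: B|%:R - ze * n) <= \sum_(v in K) #|[set z in far :\: B | G v z]|%:R.
    rewrite [X in X <= _]mulr_natl -sumr_const; apply: ler_sum => v vK.
    have := nc_out nc vK; have := cardR_D R (far :\: B) (nonout v :\: B).
    have -> : (far :\: B) :\: (nonout v :\: B) = [set z in far :\: B | G v z].
      by apply/setP => z; rewrite !inE; case: (z \in B); case: (G v z); rewrite //= ?andbF ?andbT.
    by lra.
  have h2 : \sum_(z in far :\: B) #|[set v in K | G v z]|%:R <= n * (be * n).
    apply: (@le_trans _ _ (\sum_(z in far :\: B) be * n)).
      apply: ler_sum => z; rewrite inE => /andP[_]; rewrite inE => /andP[_ /ltW].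
      by apply: le_trans; apply/lecard/subsetP => v; rewrite !inE andbC negbK.
    by rewrite sumr_const -[X in X <= _]mulr_natl ler_wpM2r ?(ltW ben) // ler_nat max_card.
  have h3 : #|K|%:R * (#|far :\: B|%:R - ze * n) <= n * (be * n).
    by apply: (le_trans h1); rewrite double_count.
  rewrite -lerBlDl; have [|h4] := leP (#|far :\: B|%:R - ze * n) 0.
    by move/le_trans; apply; rewrite !mulr_ge0 // ltW.
  have h5 := le_trans (ler_wpM2r (ltW h4) Kn) h3.
  have gn : 0 < gam / 4 * n by rewrite mulr_gt0 // divr_gt0.
  by rewrite -(ler_pM2l gn) (le_trans h5) // /be; move: n => m; rewrite le_eqVlt; apply/orP; left; apply/eqP; field.
have farA : #|A :&: far|%:R <= ze * n.
  apply: le_trans (nc_exc nc); apply/lecard/subsetP => v; rewrite [v \in _ :&: _]inE => /andP[vA vF]; rewrite inE vA /=.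
  have [_ _ h _] := outD v vF.
  have : #|K :&: nonout v|%:R <= #|nonout v :\: B|%:R :> R.
    apply/lecard/subsetP => z; rewrite !inE => /andP[zK ->]; rewrite andbT.
    by apply/negP; apply: Kdis.
  by move: h Kn beg etag rzen rzen4 zen; lra.
have AB : #|A :&: B|%:R <= 3 * (ze * n) + 5 * (u * n).
  have sub : A :&: B \subset (A :&: far) :|: (B :\: far).
    by apply/subsetP => v; rewrite !inE => /andP[-> ->]; rewrite andbT orbN.
  have h := le_trans (lecard R sub) (cardR_U R _ _).
  have h1 := cardR_ID R B far; have h2 := cardR_ID R far B; rewrite setIC in h2.
  have h3 := nc_Ble nc; rewrite mulrDl in h3; move: many; rewrite mulrBl => h4.
  by move: h h1 h2 h3 h4 farA farB; qlra.
have Kge : q * n - 5 * (ze * n) - 5 * (u * n) <= #|K|%:R.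
  by have := nc_AleK nc; have := nc_Age nc; rewrite mulrBl; move: AB; qlra.
pose sig := 7 * (ze * n) + 7 * (u * n).
have sigP v i k : v \in far -> i != k -> #|ncompat i k v :\: K|%:R <= sig.
  move=> vF ik; rewrite ncompatE //; have [h1 h2 h3 h4] := outD v vF.
  have h5 := cardR_ID R (nonout v) K; have h6 := cardR_ID R (nonin v) K.
  rewrite setIC in h3; rewrite setIC in h4.
  rewrite DE in h1 h2; move: rthn rthn4 beu; rewrite /sig.
  by case: ifP => _; move: h1 h2 h3 h4 h5 h6 Kge zen ben; qlra.
have sig0 : 0 <= sig by rewrite /sig !addr_ge0 // !mulr_ge0 // ltW.
have rsig : r%:R * sig <= q / 4 * n.
  by rewrite /sig; move: etaq rzen run qn; qlra.
have room : forall (S : {set V}) L k f, k \notin L -> (forall i, i \in L -> f i \in far) ->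
    [disjoint S & K] -> q * n - 2 * (q / 4 * n) + eta * n <= #|S|%:R ->
    #|S|%:R - q / 4 * n <= #|[set v in S | [forall i in L, compat i k (f i) v]]|%:R.
  move=> S L k f kL fL dSK _; apply: (@le_trans _ _ (#|S|%:R - #|L|%:R * sig)).
    rewrite lerD2l lerN2; apply: le_trans rsig; rewrite ler_wpM2r // ler_nat.
    by rewrite -[X in (_ <= X)%N]card_ord max_card.
  apply: cand_card => i iL; apply: le_trans (sigP _ i k (fL i iL) _).
    apply/lecard/subsetP => v; rewrite [v \in _ :&: _]inE => /andP[vS vn]; rewrite inE vn andbT.
    by apply/negP => vK; move/disjointP: dSK => /(_ v vS vK).
  by apply: contraNneq kL => <-.
pose S i := far :\: ncompat w i y; pose U := ~: (far :|: K).
have dfK : [disjoint far & K].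
  by apply/disjointP => v vF vK; move: vF; apply/negP; apply: far_clique.
have sSfar i : S i \subset far by apply: subsetDl.
have cS i : i != w -> q * n - u * n - sig <= #|S i|%:R.
  rewrite eq_sym => iw; have := cardR_D R far (ncompat w i y :\: K).
  have -> : far :\: (ncompat w i y :\: K) = S i.
    apply/setP => v; rewrite !inE; case: (boolP (v \in K)) => vK //=.
    have := far_clique vK; rewrite inE => /negbTE ->; rewrite !andbF //.
  by have := sigP y w i yF iw; move: many; rewrite mulrBl; lra.
have cU : n - 2 * (q * n) - 3 * (ze * n) - 6 * (u * n) <= #|U|%:R.
  have := cardR_C R (far :|: K); have := cardR_U R far K; have := cardR_ID R far B.
  have := lecard R (subsetIr far B); have := nc_Ble nc; rewrite mulrDl.
  by move: farB Kle rthn rthn4 beu ben zen; rewrite -/U; qlra.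
have sig4 : 4 * sig <= r%:R * sig by rewrite ler_wpM2r.
have tp : (eta * n) ^+ r <= #|[set f | [&& copy f, f w \in U & [forall i in [set~ w], f i \in S i]]]|%:R.
  have qr : 4 * (q * n) <= n by rewrite -[X in _ <= X]rq ler_wpM2r // mulr_ge0 // ltW.
  apply: two_phase => //; first exact: ltW.
    move=> L k f sL kw kL _ fS; apply: le_trans (room (S k) L k f kL _ _ _).
    - by have := cS k kw; move: rsig sig4 etaq run run4 rzen rzen4 zen ben beu qn; qlra.
    - by move=> i /fS; apply/subsetP.
    - by apply: disjointWl dfK.
    - by have := cS k kw; move: rsig sig4 etaq run run4 rzen rzen4 zen ben beu qn; qlra.
  move=> f _ fS; apply: le_trans (room U _ w f _ _ _ _).
  - by move: cU qr etaq run run4 rzen rzen4 zen ben beu qn; qlra.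
  - by rewrite !inE eqxx.
  - by move=> i; rewrite !inE => /fS /(subsetP (sSfar i)); rewrite inE.
  - by apply/disjointP => v; rewrite inE => /negP vU vK; apply: vU; rewrite inE vK orbT.
  - by move: cU qr etaq run run4 rzen rzen4 zen ben beu qn; qlra.
apply: (le_trans tp); apply/lecard/subsetP => f; rewrite inE => /and3P[cf fU /forall_inP fS].
rewrite inE cf /=; apply/andP; split.
  by move: fU; rewrite /U !inE negb_or => /andP[].
rewrite copy_upd // => [|i iw]; first by apply: partialS cf; apply: subsetT.
by have := fS i; rewrite !inE iw negbK compat_sym => /(_ isT) /andP[].
Qed.

Lemma clique_reach w y (KR : {set 'I_r}) (K1 : {set V}) :
  w \notin KR -> (#|~: (w |: KR)| + 3 <= r)%N -> K1 \subset K -> be * n <= #|K1|%:R ->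
  (forall v i, v \in K1 -> i \in KR -> compat w i y v) ->
  (eta * n) ^+ r <= #|[set f | [&& copy f, f w \in K & copy (upd f w y)]]|%:R.
Proof.
move=> wKR cQ sK1 cK1 K1c; pose Q := ~: (w |: KR); pose s := q / 4.
have s0 : 0 < s by rewrite divr_gt0.
have sn : s * n = q / 4 * n by [].
have qr : 4 * (q * n) <= n by rewrite -[X in _ <= X]rq ler_wpM2r // mulr_ge0 // ltW.
have etan : 0 <= eta * n by rewrite mulr_ge0 // ltW.
pose Kf L f := [set v in K1 | [forall i in L, G v (f i) && G (f i) v]].
pose P L f := [&& partial L f, [forall i in L, compat w i y (f i)]
  & s ^+ #|L| * (be * n) <= #|Kf L f|%:R].
have wQ : w \notin Q by rewrite !inE eqxx.
have ph1 : (eta * n) ^+ #|Q| * n ^+ r <= #|[set f | P Q f]|%:R * n ^+ #|Q|.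
  have := @greedy_set _ _ R P set0 Q (eta * n) etan (sub0set _); rewrite setD0 => gs.
  have {gs} := gs _.
  have -> : [set f | P set0 f] = setT.
    apply/setP => f; rewrite !inE /P partial0 cards0 expr0 mul1r.
    rewrite (_ : Kf set0 f = K1) ?cK1 ?andbT //.
      by apply/forall_inP => i; rewrite inE.
    apply/setP => v; rewrite !inE (_ : [forall i in set0, _]) ?andbT //.
    by apply/forall_inP => i; rewrite inE.
  rewrite cardsT card_ffun card_ord natrX; apply => L k f _ sL kQ kL /and3P[pf /forall_inP wf cK].
  have wk : w != k by apply: contraNneq wQ => ->.
  have cL : (#|L| + 4 <= r)%N.
    have : (#|L| < #|Q|)%N.
      by apply: proper_card; rewrite properE sL; apply/subsetPn; exists k.
    by move: cQ; rewrite -/Q; move: {+}r #|L| #|Q| => a b c; nlia.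
  pose S := (~: B) :\: ncompat w k y.
  pose Z := [set z in S | [forall i in L, compat i k (f i) z]].
  have cZ : 3 / 2 * (q * n) + 2 * (ze * n) + theta * n <= #|Z|%:R.
    apply: le_trans (candD S f kL); have := cardR_D R (~: B) (ncompat w k y).
    have := ncD y wk; have := cardR_C R B; have := nc_Ble nc; have := LD cL; rewrite -/S DE mulrDl.
    by move: rthn rthn4 thn etaq rzen rzen4 zen qn; qlra.
  have Kf0 : (0 < #|Kf L f|)%N.
    by rewrite -(ltr0n R); apply: lt_le_trans cK; rewrite mulr_gt0 // exprn_gt0.
  have := @popular R _ _ (Kf L f) Z (fun v z => G v z && G z v) s (ltW s0) Kf0.
  move=> pop; apply: (@le_trans _ _ (s * n)); first by rewrite sn; move: etaq qn; qlra.
  apply: (le_trans (pop _)) => [v vKf|{pop}].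
    have vK : v \in K by apply: (subsetP sK1); move: vKf; rewrite inE => /andP[].
    set Z' := [set b in Z | _].
    have sub : Z :\: Z' \subset (nonout v :\: B) :|: nonin v.
      apply/subsetP => z; rewrite inE => /andP[+ zZ].
      have zB : z \notin B by move: zZ; rewrite !inE => /andP[/andP[]].
      by rewrite /Z' inE zZ /= !inE zB /= negb_and.
    have [_ h2 _] := rob; have := h2 v; have := nc_out nc vK.
    have := le_trans (lecard R sub) (cardR_U R _ _); have := cardR_D R Z (Z :\: Z').
    have : #|Z :\: (Z :\: Z')|%:R <= #|Z'|%:R :> R by rewrite setDDr setDv set0U lecard // subsetIr.
    rewrite (_ : 2 * s * n = q * n / 2); last by rewrite /s; move: {+}n q => a b; field.
    by move: cZ zen thn; rewrite mulrDl; qlra.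
  apply/lecard/subsetP => z; rewrite inE => /andP[zZ hz]; rewrite inE.
  move: zZ; rewrite inE => /andP[zS /forall_inP zc].
  apply/and3P; split; first exact: partial_upd.
    apply/forall_inP => i; rewrite in_setU1 updE; case: eqVneq => [-> _|_ /= /wf//].
    by move: zS; rewrite !inE negbK => /andP[].
  rewrite cardsU1 kL /= add1n exprS -mulrA; apply: (le_trans (ler_wpM2l (ltW s0) cK)).
  apply: (le_trans hz); apply/lecard/subsetP => v.
  rewrite inE => /andP[]; rewrite inE => /andP[vK1 /forall_inP vf] vz; rewrite inE vK1 /=.
  apply/forall_inP => i; rewrite in_setU1 updE; case: eqVneq => [_ _|_ /= /vf//].
  exact: vz.
pose Pq f := [forall i in Q, compat w i y (f i)] && (s ^+ #|Q| * (be * n) <= #|Kf Q f|%:R).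
have kfE f (g : {ffun 'I_r -> V}) : (forall i, i \in Q -> f i = g i) -> Kf Q f = Kf Q g.
  move=> e; apply/setP => v; rewrite !inE; congr (_ && _).
  by apply: eq_forallb => i; case: (boolP (i \in Q)) => //= /e ->.
have ph2 : (eta * n) ^+ #|setT :\: Q| * #|[set f | P Q f]|%:R <=
   #|[set f | [&& partial setT f, Pq f & [forall i in setT :\: Q, f i \in Kf Q f]]]|%:R
    * n ^+ #|setT :\: Q|.
  apply: (@greedy_place R r T V G (fun f _ => Kf Q f) Pq) => //.
  - move=> f k v _ kQ /andP[/forall_inP h1 h2].
    have e i : i \in Q -> upd f k v i = f i.
      by move=> iQ; rewrite upd_neq //; apply: contraNneq kQ => <-.
    rewrite /Pq (kfE _ _ e) h2 andbT.
    by apply/forall_inP => i iQ; rewrite e ?h1.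
  - move=> f k v _ kQ i; apply: kfE => j jQ.
    by rewrite upd_neq //; apply: contraNneq kQ => <-.
  move=> L k f sQL _ _ kL pf /andP[_ cK] fL.
  apply: (@le_trans _ _ (#|Kf Q f|%:R - #|L|%:R * (ze * n))).
    have h1 : #|L|%:R * (ze * n) <= r%:R * ze * n.
      by rewrite -[X in _ <= X]mulrA ler_wpM2r ?(ltW zen) // ler_nat -[X in (_ <= X)%N]card_ord max_card.
    have h2 : s ^+ r * (be * n) <= s ^+ #|Q| * (be * n).
      rewrite ler_wpM2r ?(ltW ben) // ler_wiXn2l ?(ltW s0) //.
        rewrite /s; apply: le_trans (_ : q <= 1); first by move: q0; qlra.
        by rewrite invf_le1; [apply: le_trans rR; lra | apply: lt_le_trans rR].
      by rewrite -[X in (_ <= X)%N]card_ord max_card.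
    have h3 : eta * 2 * n <= s ^+ r * (be * n).
      by rewrite mulrA [s ^+ r * be]mulrC ler_wpM2r ?(ltW n0).
    by move: (le_trans h3 h2) cK h1 rzen; move: (s ^+ #|Q| * _) (#|Kf Q f|%:R : R) => a b; lra.
  apply: cand_card => i iL; have ik : i != k by apply: contraNneq kL => <-.
  have KfK : Kf Q f \subset K.
    by apply: subset_trans sK1; apply/subsetP => v; rewrite inE => /andP[].
  have [iQ|iQ] := boolP (i \in Q).
    rewrite (_ : _ :&: _ = set0) ?cards0 ?(ltW zen) //.
    apply/setP => v; rewrite !inE; apply/negP => /andP[/andP[_ /forall_inP/(_ i iQ)/andP[g1 g2]]].
    by rewrite compatW.
  apply: le_trans (near_clique_ncompat tourT nc (subsetP KfK _ (fL i iL iQ)) ik).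
  exact/lecard/setSI.
rewrite -(ler_pM2r (exprn_gt0 r n0)).
have er : r = (#|Q| + #|setT :\: Q|)%N.
  by have := cardsID Q [set: 'I_r]; rewrite setTI cardsT card_ord => ->.
have E1 : (eta * n) ^+ r = (eta * n) ^+ #|Q| * (eta * n) ^+ #|setT :\: Q| by rewrite -exprD -er.
have E2 : n ^+ r = n ^+ #|Q| * n ^+ #|setT :\: Q| by rewrite -exprD -er.
rewrite E1 [X in _ <= _ * X]E2 mulrAC.
apply: le_trans (ler_wpM2r (exprn_ge0 _ etan) ph1) _.
rewrite mulrAC mulrA [X in _ <= X]mulrAC ler_wpM2r ?exprn_ge0 // mulrC.
apply: (le_trans ph2); rewrite ler_wpM2r ?exprn_ge0 //; apply/lecard/subsetP => f.
rewrite inE => /and3P[cf /andP[/forall_inP wf _] /forall_inP fK]; rewrite inE.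
have fKf i : i \notin Q -> f i \in K1.
  by move=> iQ; have := fK i; rewrite inE iQ in_setT => /(_ isT); rewrite inE => /andP[].
apply/and3P; split; [exact: cf | by apply/(subsetP sK1)/fKf | ].
apply: copy_upd => [|i iw]; first by apply: partialS cf; apply: subsetT.
rewrite compat_sym; case: (boolP (i \in Q)) => iQ; first exact: wf.
by apply: K1c; [exact: fKf | move: iQ; rewrite !inE negbK (negbTE iw)].
Qed.

End Clique.

Definition forks r (T : rel 'I_r) w := (2 <= #|[set i | T w i]|)%N.

Lemma tournament_forks r (T : rel 'I_r) : (forall i j, i != j -> T i j (+) T j i) ->
  irreflexive T -> (4 <= r)%N -> exists w, forks T w.
Proof.
move=> tourT irT r4; apply/existsP; apply: contraT; rewrite negb_exists => /forallP nof.
have le1 i : (#|[set j | T i j]| <= 1)%N by have := nof i; rewrite /forks -leqNgt.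
have sum1 : (\sum_i #|[set j | T i j]| <= r)%N.
  by rewrite -[X in (_ <= X)%N]card_ord -sum1_card; apply: leq_sum.
have card i : (#|[set j | T i j]| + #|[set j | T j i]| = r.-1)%N.
  rewrite -[r in RHS]card_ord -(cardsC1 i) -cardsUI [X in (_ + X)%N](_ : _ = 0%N) ?addn0.
    congr #|pred_of_set _|; apply/setP => j; rewrite !inE; case: (eqVneq j i) => [->|ji].
      by rewrite irT.
    by have := tourT _ _ ji; case: (T j i); case: (T i j).
  apply/eqP; rewrite cards_eq0; apply/eqP/setP => j; rewrite !inE.
  case: (eqVneq j i) => [->|ji]; first by rewrite irT.
  by have := tourT _ _ ji; case: (T j i); case: (T i j).
have sw : (\sum_i #|[set j | T j i]| = \sum_i #|[set j | T i j]|)%N.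
  have e (U : rel 'I_r) : (\sum_i #|[set j | U i j]| = \sum_i \sum_j U i j)%N.
    by apply: eq_bigr => i _; rewrite -sum1dep_card big_mkcond; apply: eq_bigr => j _; case: ifP.
  by rewrite (e (fun i j => T j i)) (e T) exchange_big.
have : (\sum_(i < r) (#|[set j | T i j]| + #|[set j | T j i]|) = r * r.-1)%N.
  by under eq_bigr do rewrite card; rewrite sum_nat_const card_ord.
rewrite big_split /= sw => e; have : (r * r.-1 <= r * 2)%N by rewrite -e muln2 -addnn leq_add.
by rewrite leq_pmul2l; [move: r4; case: (r) => [|[|[|[|m]]]] | apply: leq_trans r4].
Qed.

Section Chain.
Variables (R : realType) (r : nat) (T : rel 'I_r) (V : finType) (G : rel V).
Local Notation n := (#|V|%:R : R).
Local Notation links k := (links T G k).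
Variable c : R.
Hypotheses (r0 : (0 < r)%N) (c0 : 0 < c) (c1 : c <= 1).
Hypothesis nbig : (5 * r * (r + 1))%:R <= 2 * (c / 4) ^+ 5 * n.

Let cm m := 4 * (c / 4) ^+ m.

Lemma links_chain m x y (Z : {set V}) : (1 <= m <= 4)%N ->
  c * n ^+ r <= \sum_(z in Z) #|links r.-1 x z|%:R ->
  (forall z, z \in Z -> cm m * n ^+ (m * r).-1 <= #|links (m * r).-1 z y|%:R) ->
  cm m.+1 * n ^+ (m.+1 * r).-1 <= #|links (m.+1 * r).-1 x y|%:R.
Proof.
move=> /andP[m1 m4] h1 h2.
have c40 : 0 < c / 4 by rewrite divr_gt0.
have c41 : c / 4 <= 1 by move: c1; lra.
have nn : 0 < n.
  rewrite ltr0n lt0n; apply/eqP => e; move: nbig; rewrite e mulr0 lern0.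
  by rewrite !muln_eq0 addn1 /= orbF; case: (r) r0.
have mono j : (j <= 5)%N -> 2 * (c / 4) ^+ 5 * n <= cm j / 2 * n.
  move=> j5; rewrite ler_wpM2r ?(ltW nn) // /cm [4 * _]mulrC -mulrA (_ : 4 / 2 = 2 :> R); last by field.
  by rewrite mulrC ler_pM2r // ler_wiXn2l // ltW.
have kE : (r.-1 + (m * r).-1.+1)%N = (m.+1 * r).-1.
  by rewrite prednK ?muln_gt0 ?m1 // mulSn; case: (r) r0.
have cE : cm 1 * cm m / 4 = cm m.+1 by rewrite /cm expr1 exprS; move: (_ ^+ m) => a; field.
have e1 : cm 1 = c by rewrite /cm expr1; field.
rewrite -cE -kE; apply: (@links_trans _ _ _ _ _ _ _ (cm 1) (cm m) x y Z) => //.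
- by rewrite e1 ltW.
- by rewrite /cm mulr_ge0 ?exprn_ge0 ?ltW.
- by rewrite e1 prednK.
- apply: le_trans (mono 1%N isT); apply: le_trans nbig; rewrite ler_nat.
  by case: (r) r0 => // k _ /=; nlia.
- apply: le_trans (mono m (leqW m4)); apply: le_trans nbig; rewrite ler_nat.
  apply: leq_mul; first by apply: leq_trans (leq_pred _) _; rewrite leq_mul2r (leqW m4) orbT.
  by case: (r) r0 => // k _; rewrite addn2 addn1.
Qed.

Lemma links_dense : (forall x y, c * n ^+ r.-1 <= #|links r.-1 x y|%:R) ->
  forall x y, cm 5 * n ^+ (5 * r).-1 <= #|links (5 * r).-1 x y|%:R.
Proof.
move=> h.
have hs x : c * n ^+ r <= \sum_(z in [set: V]) #|links r.-1 x z|%:R.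
  apply: (@le_trans _ _ (\sum_(z in [set: V]) c * n ^+ r.-1)); last by apply: ler_sum.
  by rewrite sumr_const cardsT -[X in _ <= X]mulr_natl mulrCA -exprS prednK.
have h1 x y : cm 1 * n ^+ (1 * r).-1 <= #|links (1 * r).-1 x y|%:R.
  by rewrite mul1n (_ : cm 1 = c) // /cm expr1; field.
have h2 x y := @links_chain 1 x y setT isT (hs x) (fun z _ => h1 z y).
have h3 x y := @links_chain 2 x y setT isT (hs x) (fun z _ => h2 z y).
have h4 x y := @links_chain 3 x y setT isT (hs x) (fun z _ => h3 z y).
by move=> x y; apply: (@links_chain 4 x y setT isT (hs x) (fun z _ => h4 z y)).
Qed.

Lemma links_through (K F : {set V}) : K \subset F ->
  (forall x y, x \in K -> y \in K -> c * n ^+ r.-1 <= #|links r.-1 x y|%:R) ->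
  (forall x, x \in F -> c * n ^+ r <= \sum_(z in K) #|links r.-1 x z|%:R) ->
  (forall x, x \notin F -> c * n ^+ r <= \sum_(z in F) #|links r.-1 x z|%:R) ->
  forall x y, cm 5 * n ^+ (5 * r).-1 <= #|links (5 * r).-1 x y|%:R.
Proof.
move=> sKF hKK hFK hF.
have {}hF x : c * n ^+ r <= \sum_(z in F) #|links r.-1 x z|%:R.
  case: (boolP (x \in F)) => [xF|]; last exact: hF.
  apply: (le_trans (hFK x xF)); rewrite [X in _ <= X](big_setID K) /= (setIidPr sKF) lerDl.
  exact: sumr_ge0.
have h1 x y : x \in K -> y \in K -> cm 1 * n ^+ (1 * r).-1 <= #|links (1 * r).-1 x y|%:R.
  by rewrite mul1n (_ : cm 1 = c); [exact: hKK | rewrite /cm expr1; field].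
have h2 x y : x \in F -> y \in K -> cm 2 * n ^+ (2 * r).-1 <= #|links (2 * r).-1 x y|%:R.
  by move=> xF yK; apply: (@links_chain 1 x y K isT (hFK x xF)) => z zK; apply: h1.
have h3 x y : x \in F -> y \in F -> cm 3 * n ^+ (3 * r).-1 <= #|links (3 * r).-1 x y|%:R.
  move=> xF yF; apply: (@links_chain 2 x y K isT (hFK x xF)) => z zK.
  by rewrite links_sym; apply: h2.
have h4 x y : y \in F -> cm 4 * n ^+ (4 * r).-1 <= #|links (4 * r).-1 x y|%:R.
  by move=> yF; apply: (@links_chain 3 x y F isT (hF x)) => z zF; apply: h3.
move=> x y; apply: (@links_chain 4 x y F isT (hF x)) => z zF.
by rewrite links_sym; apply: h4.
Qed.

End Chain.

Lemma copies_of_swap (R : realType) (r : nat) (T : rel 'I_r) (V : finType) (G : rel V) (w : 'I_r) (h : R) :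
  0 < #|V|%:R :> R ->
  (forall x y, h <= #|[set f | copy T G (upd f w x) && copy T G (upd f w y)]|%:R) ->
  h <= #|[set f | copy T G f]|%:R.
Proof.
move=> n0 hx; pose D := [set p : V * {ffun 'I_r -> V} | copy T G (upd p.2 w p.1)].
have h1 : #|V|%:R * h <= #|D|%:R.
  rewrite sum_card_fst natr_sum [X in X <= _]mulr_natl -sumr_const; apply: ler_sum => x _.
  apply: (le_trans (hx x x)); apply/lecard/subsetP => f.
  by rewrite inE => /andP[cf _]; rewrite inE inE.
have inj : injective (fun p : V * {ffun 'I_r -> V} => (upd p.2 w p.1, p.2 w)).
  move=> [x f] [y g] e; have e1 : upd f w x = upd g w y := congr1 fst e.
  have e2 : f w = g w := congr1 snd e.
  congr pair; first by have := congr1 (fun f : {ffun _} => f w) e1; rewrite !upd_eq.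
  by rewrite -[f](upd_id f w) -(upd_upd f w x) e1 upd_upd e2 upd_id.
rewrite -(ler_pM2l n0); apply: (le_trans h1).
rewrite -(card_imset _ inj) mulrC -natrM ler_nat -(cardsT V) -cardsX.
apply: subset_leq_card; apply/subsetP => p /imsetP[[x f]]; rewrite inE => cf ->.
by rewrite inE /= inE cf inE.
Qed.

Lemma links_many (R : realType) (r : nat) (gam : R) : (3 <= r)%N -> 0 < gam -> gam <= 1 ->
  exists theta c : R, [/\ 0 < theta, 0 < c & exists N, forall (T : rel 'I_r) (V : finType) (G : rel V),
    (forall i j, i != j -> T i j (+) T j i) -> irreflexive T -> irreflexive G ->
    (exists w, forks T w) -> (N <= #|V|)%N -> robust r G theta gam ->
    c * #|V|%:R ^+ r <= #|[set f | copy T G f]|%:R /\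
    forall x y, c * #|V|%:R ^+ (5 * r).-1 <= #|links T G (5 * r).-1 x y|%:R].
Proof.
move=> r3 gam0 gam1; pose q : R := r%:R^-1.
have r_gt0 : 0 < r%:R :> R by rewrite ltr0n; apply: leq_trans r3.
have rR : 3 <= r%:R :> R by rewrite ler_nat.
have q0 : 0 < q by rewrite invr_gt0.
have rq : r%:R * q = 1 by rewrite divff // gt_eqF.
have q1 : q <= 1 by rewrite invf_le1 //; lra.
pose u := q * q / 64; have u0 : 0 < u by apply: divr_gt0; rewrite ?mulr_gt0.
pose s := (q / 4) ^+ r; have s0 : 0 < s by rewrite exprn_gt0 // divr_gt0.
have s1 : s <= 1 / 4.
  rewrite /s -(prednK (leq_trans _ r3 : (0 < r)%N)) // exprS.
  apply: le_trans (_ : q / 4 * 1 <= _); last by lra.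
  by rewrite ler_wpM2l ?divr_ge0 ?exprn_ile1 ?divr_ge0 ?(ltW q0) //; lra.
pose eta := gam * u * s / 2; have eta0 : 0 < eta := divr_gt0 (mulr_gt0 (mulr_gt0 gam0 u0) s0) (ltr0Sn R 1).
have qq : q * q <= q by rewrite ler_piMl // ltW.
have uq : u <= q / 64 by rewrite /u; lra.
have gu : gam * u <= u by rewrite ler_piMl // ltW.
have gug : gam * u <= gam / 64 by rewrite ler_wpM2l ?(ltW gam0) //; lra.
have gus : gam * u * s <= gam * u * (1 / 4) by rewrite ler_wpM2l // mulr_ge0 ?ltW.
have gu0 : 0 < gam * u := mulr_gt0 gam0 u0.
have eu : eta <= u / 4 by rewrite /eta; move: gus gu gu0; glra.
have eg : eta <= gam / 16 by rewrite /eta; move: gus gug gu0; glra.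
have eq4 : eta <= q / 64 by move: eu uq u0; glra.
pose ze := eta * q; have ze0 : 0 < ze by rewrite mulr_gt0.
have zeE : r%:R * ze = eta by rewrite /ze mulrCA rq mulr1.
have zeta : ze <= eta by rewrite /ze ler_piMr // ltW.
have zeq : ze <= q by move: zeta eq4 q0; glra.
have ze1 : ze <= 1 by move: zeq q1; glra.
pose theta := ze ^+ 2 / 4 * q; have th0 : 0 < theta by rewrite mulr_gt0 // divr_gt0 // exprn_gt0.
have thE : r%:R * theta = ze ^+ 2 / 4 by rewrite /theta mulrCA rq mulr1.
have zz : ze ^+ 2 <= ze by rewrite expr2 ler_piMl // ltW.
have q3 : 0 < q ^+ (r - 3) by rewrite exprn_gt0.
pose c := Num.min (ze ^+ 3 / 8 * q ^+ (r - 3)) (eta ^+ r).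
have c0 : 0 < c by rewrite lt_min exprn_gt0 // andbT mulr_gt0 // divr_gt0 ?exprn_gt0.
have c1 : c <= 1.
  rewrite /c ge_min; apply/orP; right; apply: exprn_ile1; first exact: ltW.
  by move: eg gam1; glra.
have c40 : 0 < c / 4 by rewrite divr_gt0.
have c4c : 4 * (c / 4) ^+ 5 <= c.
  rewrite exprS mulrA (_ : 4 * (c / 4) = c); last by field.
  by rewrite ler_piMr ?(ltW c0) // exprn_ile1 ?(ltW c40) //; move: c1; glra.
exists theta, (4 * (c / 4) ^+ 5); split => //; first by rewrite mulr_gt0 ?exprn_gt0.
have [N HN] := eventually_ge (5 * r * (r + 1))%:R (mulr_gt0 (ltr0Sn R 1) (exprn_gt0 5 c40)).
exists (maxn N 1) => T V G tourT irT irG fT; rewrite geq_max => /andP[nN n1] rob.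
have n0 : 0 < #|V|%:R :> R by rewrite ltr0n.
have nbig := HN _ nN.
have r0 : (0 < r)%N by apply: leq_trans r3.
have swap w c' x y : c <= c' ->
  c' * #|V|%:R ^+ r <= #|[set f | copy T G (upd f w x) && copy T G (upd f w y)]|%:R ->
  c * #|V|%:R ^+ r.-1 <= #|links T G r.-1 x y|%:R.
  move=> cc h; rewrite -(ler_pM2r n0) -mulrA -exprSr prednK //.
  apply: le_trans (links_of_swap tourT irG R w x y); apply: le_trans h.
  by rewrite ler_wpM2r ?exprn_ge0.
have c_le1 : c <= ze ^+ 3 / 8 * q ^+ (r - 3) by rewrite ge_min lexx.
have c_le2 : c <= eta ^+ r by rewrite ge_min lexx orbT.
have wn w i : i \in [set i | T w i] -> w != i.
  by rewrite inE => Ti; apply: contraTneq Ti => <-; rewrite irT.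
have th0w : 0 <= theta by rewrite ltW.
have zeg8 : ze <= gam / 8 by move: zeta eg gam0; glra.
have rth1 : r%:R * theta <= ze ^+ 2 / 4 by rewrite thE.
have rth2 : r%:R * theta <= q / 4 by rewrite thE; move: zz zeq; glra.
have rth3 : r%:R * theta <= ze by rewrite thE; move: zz ze0; glra.
have [x0 _] : exists x0 : V, true by move/card_gt0P: n1 => [x0]; exists x0.
have [w fw] := fT.
have [clq|nclq] := pselect ((4 <= r)%N /\ exists A B K, near_clique r G gam ze A B K); last first.
  have direct x y : c * #|V|%:R ^+ r <=
      #|[set f | copy T G (upd f w x) && copy T G (upd f w y)]|%:R.
    have /card_gt1P[a [b [Ta Tb ab]]] := fw.
    have Twa : T w a by move: Ta; rewrite inE.
    have Twb : T w b by move: Tb; rewrite inE.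
    have [h|//] := direct_or_clique tourT n0 r3 rob th0w ze0 zeg8 ze1 rth1 rth2 x y (wn _ _ Ta) (wn _ _ Tb) ab Twa Twb.
    by apply: le_trans h; rewrite ler_wpM2r ?exprn_ge0.
  split; last by apply: links_dense => // x y; apply: swap (direct x y).
  apply: (@le_trans _ _ (c * #|V|%:R ^+ r)); first by rewrite ler_wpM2r ?exprn_ge0.
  exact: (copies_of_swap (w := w)).
have [r4 [A [B [K nc]]]] := clq.
have ru : r%:R * u <= q / 64 by rewrite /u !mulrA rq mul1r.
have e2 : eta * 2 <= gam * u * (q / 4) ^+ r by rewrite /eta divfK // lt0r_neq0.
have rze : r%:R * ze <= eta by rewrite zeE.
have sKF : K \subset ~: far G gam u K.
  by apply/subsetP => k kK; rewrite inE; apply: (far_clique (r := r) (A := A) (B := B) (ze := ze) (eta := eta)) kK.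
pose reached (F : {set V}) x := exists w, c * #|V|%:R ^+ r <=
  #|[set f | [&& copy T G f, f w \in F & copy T G (upd f w x)]]|%:R.
have reach_links F x : reached F x -> c * #|V|%:R ^+ r <= \sum_(z in F) #|links T G r.-1 x z|%:R.
  by case=> w' h; apply: (le_trans h); apply: links_of_copies.
have eta_c : c * #|V|%:R ^+ r <= (eta * #|V|%:R) ^+ r by rewrite exprMn ler_wpM2r ?exprn_ge0.
have hK x : x \in ~: far G gam u K -> reached K x.
  rewrite inE [x \in _]inE negb_and -!leNgt.
  have reach w' (KR : {set 'I_r}) (K1 : {set V}) :
      w' \notin KR -> (2 <= #|KR|)%N -> K1 \subset K -> gam * u * #|V|%:R <= #|K1|%:R ->
      (forall v i, v \in K1 -> i \in KR -> compat T G w' i x v) -> reached K x.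
    move=> wKR cKR sK cK hK; exists w'; apply: (le_trans eta_c).
    apply: (clique_reach tourT n0 r4 rob th0w nc gam0 ze0 u0 eta0 rth3 eq4 e2 rze wKR _ sK cK hK).
    have := cardsC (w' |: KR); rewrite cardsU1 wKR card_ord; move: cKR.
    by move: #|~: _| #|KR| => a b; nlia.
  case/orP => h.
    apply: (reach w [set i | T w i] (K :\: nonout G x)) => //.
    + by apply/negP => /wn; rewrite eqxx.
    + exact: subsetDl.
    + move=> v i; rewrite !inE negbK => /andP[Gxv _] Twi.
      by rewrite (compat_out G tourT) // wn ?inE.
  have [w' fw'] : exists w', forks (fun i j => T j i) w'.
    apply: tournament_forks => // i j ij.
    by rewrite addbC; apply: tourT.
  apply: (reach w' [set i | T i w'] (K :\: nonin G x)) => //.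
  + by rewrite inE irT.
  + exact: subsetDl.
  + move=> v i; rewrite !inE negbK => /andP[Gvx _] Tiw.
    by rewrite (compat_in G tourT) //; apply: contraTneq Tiw => ->; rewrite irT.
have hF x : x \in far G gam u K -> reached (~: far G gam u K) x.
  move=> xF; exists w; apply: (le_trans eta_c).
  have [few|many] := ltP #|far G gam u K|%:R ((q - u) * #|V|%:R).
    exact: (far_few tourT n0 r4 rob th0w ze0 eta0 rth3 eq4 eu rze).
  exact: (far_many tourT n0 r4 rob th0w nc gam0 gam1 ze0 u0 eta0 rth3 ru eq4 eg rze).
split.
  have [F [w' h]] : exists F, reached F x0.
    by case: (boolP (x0 \in far G gam u K)) => h; [exists (~: far G gam u K); apply: hF | exists K; apply: hK; rewrite inE].
  apply: (@le_trans _ _ (c * #|V|%:R ^+ r)); first by rewrite ler_wpM2r ?exprn_ge0.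
  by apply: (le_trans h); apply/lecard/subsetP => f; rewrite !inE => /and3P[].
apply: (links_through r0 c0 c1 nbig sKF) => [x y xK yK|x xF|x xF].
- apply: (swap w (eta ^+ r)) => //; rewrite -exprMn.
  exact: (clique_pair tourT n0 r4 nc ze0 eta0 eg rze).
- by apply/reach_links/hK.
- by apply/reach_links/hF; move: xF; rewrite inE negbK.
Qed.

(** * Absorption *)

(* The members of [F] are picked one by one so that the potential, the sum over [q] of
   2^-(number of hits), is multiplied by at most [1 - a / 2] each time. *)
Lemma disjoint_hitting (R : realType) (W Q V : finType) (A : Q -> {set W})
    (supp : W -> {set V}) (a : R) (m p : nat) (q0 : Q) :
  (0 < #|W|)%N -> 0 < a -> a <= 1 -> (forall w, supp w != set0) -> (forall w, #|supp w| <= m)%N ->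
  (forall (U : {set V}) q, (#|U| <= m * p)%N ->
     a * #|W|%:R <= #|[set w in A q | [disjoint supp w & U]]|%:R) ->
  exists F : {set W}, [/\ (#|F| <= p)%N,
    forall w, w \in F -> exists q, w \in A q,
    forall w w', w \in F -> w' \in F -> w != w' -> [disjoint supp w & supp w']
  & \sum_q 2^-1 ^+ #|F :&: A q| <= (1 - a / 2) ^+ p * #|Q|%:R :> R].
Proof.
move=> W0 a0 a1 supp0 suppm.
elim: p => [|p IH] hit.
  exists set0; split => [|w|w w'|]; rewrite ?cards0 ?inE //.
  rewrite (eq_bigr (fun=> 1)) => [|q _]; last by rewrite set0I cards0.
  by rewrite sumr_const expr0 mul1r.
have [|F [cF FA dF pot]] := IH.
  by move=> U q cU; apply: hit; apply: leq_trans cU _; rewrite leq_mul2l leqnSn orbT.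
pose U := \bigcup_(w in F) supp w.
have cU : (#|U| <= m * p.+1)%N.
  apply: leq_trans (_ : \sum_(w in F) m <= _)%N.
    apply: leq_trans (_ : \sum_(w in F) #|supp w| <= _)%N; last by apply: leq_sum.
    by rewrite /U; elim/big_rec2: _ => [|w x B _ h]; rewrite ?cards0 // (leq_trans (leq_card_setU _ _)) // leq_add2l.
  by rewrite sum_nat_const mulnC leq_mul2l (leqW cF) orbT.
pose A' q := [set w in A q | [disjoint supp w & U]].
pose wt q : R := 2^-1 ^+ #|F :&: A q|.
have wt0 q : 0 < wt q by rewrite exprn_gt0 // invr_gt0.
pose pick w := \sum_(q | w \in A' q) wt q.
have tot : \sum_w pick w >= #|W|%:R * (a * \sum_q wt q).
  rewrite /pick (exchange_big_dep xpredT) //= mulrCA mulrA mulr_sumr; apply: ler_sum => q _.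
  rewrite sumr_const -[X in _ <= X]mulr_natl ler_wpM2r ?(ltW (wt0 q)) //.
  apply: le_trans (hit U q cU) _; rewrite ler_nat; apply/subset_leq_card/subsetP => w.
  by rewrite /A' unfold_in.
have [w hw] : exists w, a * \sum_q wt q <= pick w.
  apply: contrapT => /forallNP no.
  have : \sum_w pick w < \sum_(w : W) a * \sum_q wt q.
    move/card_gt0P: W0 => [w0 _]; apply: ltr_sum; first by apply/hasP; exists w0; rewrite ?mem_index_enum.
    by move=> w _; rewrite ltNge; apply/negP/no.
  by rewrite sumr_const -[X in _ < X]mulr_natl ltNge tot.
have S0 : 0 < \sum_q wt q.
  rewrite (bigD1 q0) //= ltr_pwDl // sumr_ge0 // => q _; exact: ltW.
have [q1 wq1] : exists q, w \in A' q.
  apply: contrapT => /forallNP no; move: hw; rewrite leNgt /pick big_pred0 ?mulr_gt0 //.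
  by move=> q; apply/negP/no.
have [wAq1 wU] : w \in A q1 /\ [disjoint supp w & U] by move: wq1; rewrite inE => /andP[].
have dw w' : w' \in F -> [disjoint supp w & supp w'].
  move=> w'F; apply/disjointP => v vw vw'; move/disjointP: wU => /(_ v vw); apply.
  by apply/bigcupP; exists w'.
have wF : w \notin F.
  apply/negP => /dw; rewrite -setI_eq0 setIid; exact/negP.
exists (w |: F); split.
- by rewrite cardsU1 wF.
- by move=> w'; rewrite in_setU1 => /orP[/eqP->|/FA//]; exists q1.
- move=> w1 w2; rewrite !in_setU1 => /orP[/eqP->|w1F] /orP[/eqP->|w2F]; rewrite ?eqxx // => ne.
  + exact: dw.
  + by rewrite disjoint_sym; apply: dw.
  + exact: dF.
have -> : \sum_q 2^-1 ^+ #|(w |: F) :&: A q| = \sum_q wt q - (\sum_(q | w \in A q) wt q) / 2.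
  rewrite [X in _ - X / _]big_mkcond /= mulr_suml -sumrB; apply: eq_bigr => q _.
  rewrite setIUl; case: ifP => wA.
    rewrite (setIidPl _) ?sub1set // cardsU1 inE (negbTE wF) /= add1n exprS /wt.
    by move: (_ ^+ _) => b; field.
  rewrite mul0r subr0 /wt (_ : [set w] :&: A q = set0) ?set0U //.
  by apply/setP => x; rewrite !inE; case: eqP => // ->; rewrite wA.
have le1 : pick w <= \sum_(q | w \in A q) wt q.
  rewrite /pick [X in X <= _]big_mkcond [X in _ <= X]big_mkcond; apply: ler_sum => q _ /=.
  rewrite [w \in A' q]inE; case: ifP => [/andP[-> _]//|_]; case: ifP => _ //; exact: ltW.
rewrite exprS -mulrA.
apply: le_trans (_ : (1 - a / 2) * \sum_q wt q <= _).
  by move: (le_trans hw le1); move: (\sum_q wt q) (\sum_(q | _) _) => b d; clear; lra.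
by rewrite ler_wpM2l //; move: a1; clear; lra.
Qed.

Section Absorbers.
Variables (r : nat) (T : rel 'I_r) (V : finType) (G : rel V) (k : nat).
Hypotheses (tourT : forall i j, i != j -> T i j (+) T j i) (irrG : irreflexive G).
Local Notation copy := (copy T G).
Local Notation packable := (packable T G).
Local Notation links := (links T G k).

Implicit Types (q : {ffun 'I_r -> V}).

Lemma packable_bigcup (I : finType) (P : {set I}) (F : I -> {set V}) :
  (forall i, i \in P -> packable (F i)) ->
  (forall i j, i \in P -> j \in P -> i != j -> [disjoint F i & F j]) ->
  packable (\bigcup_(i in P) F i).
Proof.
move: {2}#|P| (erefl #|P|) => m; elim: m P => [|m IH] P eP pF dF.
  by move/eqP: eP; rewrite cards_eq0 => /eqP->; rewrite big_set0 packable0.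
have [i iP] : exists i, i \in P by apply/set0Pn; rewrite -card_gt0 eP.
rewrite (big_setD1 i) //=; apply: packableU.
- apply/disjointP => v vi /bigcupP[j]; rewrite !inE => /andP[ji jP] vj.
  rewrite eq_sym in ji; by have /disjointP/(_ v vi vj) := dF i j iP jP ji.
- exact: pF.
- apply: IH.
  + by move: eP; rewrite (cardsD1 i) iP => -[].
  + by move=> j; rewrite inE => /andP[_]; apply: pF.
  + by move=> j j'; rewrite !inE => /andP[_ jP] /andP[_ jP']; apply: dF.
Qed.

(* A copy [w.1] of [T] together with tuples [w.2 i] linking [w.1 i] to the vertex [q i] to be
   absorbed. *)
Definition gadget := ({ffun 'I_r -> V} * {ffun 'I_r -> k.-tuple V})%type.

Definition gadget_set (w : gadget) : {set V} :=
  \bigcup_i (w.1 i |: [set z in w.2 i]).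

Definition absorbs (q : {ffun 'I_r -> V}) (w : gadget) :=
  [&& copy w.1, [forall i, w.2 i \in links (q i) (w.1 i)],
      [forall i, forall j, w.1 i \notin w.2 j] &
      [forall i, forall j, (i != j) ==> ~~ has (mem (w.2 i)) (w.2 j)]].

Lemma absorbsP q (w : gadget) : reflect [/\ copy w.1, forall i, w.2 i \in links (q i) (w.1 i),
    forall i j, w.1 i \notin w.2 j &
    forall i j, i != j -> [disjoint [set z in w.2 i] & [set z in w.2 j]]] (absorbs q w).
Proof.
apply: (iffP and4P) => -[h1 h2 h3 h4]; split => //.
- by apply/forallP.
- by move=> i; apply/forallP; apply: (forallP h3).
- move=> i j ij; apply/disjointP => v; rewrite !inE => vi vj.
  by have /forallP/(_ j)/implyP/(_ ij)/hasPn/(_ v vj)/negP/(_ vi) := forallP h4 i.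
- exact/forallP.
- by apply/forallP => i; apply/forallP.
- apply/forallP => i; apply/forallP => j; apply/implyP => ij; apply/hasPn => v vj.
  by apply/negP => vi; have /disjointP/(_ v) := h4 i j ij; rewrite !inE => /(_ vi vj).
Qed.

Lemma gadget_set_neq0 w : (0 < r)%N -> gadget_set w != set0.
Proof.
move=> r0; apply/set0Pn; exists (w.1 (Ordinal r0)); apply/bigcupP; exists (Ordinal r0) => //.
by rewrite setU11.
Qed.

Lemma card_gadget_set w : (#|gadget_set w| <= r * k.+1)%N.
Proof.
rewrite /gadget_set.
have h (F : 'I_r -> {set V}) : (#|\bigcup_i F i| <= \sum_i #|F i|)%N.
  by elim/big_rec2: _ => [|i x B _ hx]; rewrite ?cards0 // (leq_trans (leq_card_setU _ _)) // leq_add2l.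
apply: (leq_trans (h _)); apply: leq_trans (_ : \sum_(i < r) k.+1 <= _)%N; last first.
  by rewrite sum_nat_const card_ord.
apply: leq_sum => i _; apply: (leq_trans (leq_card_setU _ _)); rewrite cards1 add1n ltnS.
by rewrite cardsE (leq_trans (card_size _)) // size_tuple.
Qed.

Lemma absorbs_idle q w : absorbs q w -> packable (gadget_set w).
Proof.
move/absorbsP => [c1 l2 d3 d4].
have inj := copy_inj tourT irrG c1.
have -> : gadget_set w = \bigcup_(i in [set: 'I_r]) (w.1 i |: [set z in w.2 i]).
  by apply: eq_bigl => i; rewrite in_setT.
apply: packable_bigcup => [i _|i j _ _ ij].
  by have := l2 i; rewrite inE => /andP[_ /and4P[]].
apply/disjointP => v; rewrite !inE => /orP[/eqP->|vi] /orP[/eqP e|vj].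
- by move/inj: e => e; rewrite e eqxx in ij.
- by move: (d3 i j); rewrite vj.
- by move: (d3 j i); rewrite -e vi.
- by have /disjointP/(_ v) := d4 i j ij; rewrite !inE => /(_ vi vj).
Qed.

Lemma absorbs_active q w : absorbs q w -> injective q ->
  [disjoint [set q i | i in 'I_r] & gadget_set w] ->
  packable (gadget_set w :|: [set q i | i in 'I_r]).
Proof.
move=> /absorbsP[c1 l2 d3 d4] injq dq.
have qN i j v : v = q i -> v \in w.1 j |: [set z in w.2 j] -> False.
  move=> -> vj; move/disjointP: dq => /(_ (q i)); apply; first by apply/imsetP; exists i.
  by apply/bigcupP; exists j.
rewrite (_ : _ :|: _ = [set w.1 i | i in 'I_r] :|: \bigcup_(i in [set: 'I_r]) (q i |: [set z in w.2 i])).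
  apply: packableU; last 1 first.
  - apply: packable_bigcup => [i _|i j _ _ ij].
      by have := l2 i; rewrite inE => /andP[_ /and4P[]].
    apply/disjointP => v; rewrite in_setU1 [in X in _ -> X]in_setU1 => /orP[/eqP->|vi] /orP[/eqP e|vj].
    + by move/injq: e => e; rewrite e eqxx in ij.
    + by apply: (qN i j (q i)) => //; rewrite in_setU1 vj orbT.
    + by apply: (qN j i v) => //; rewrite in_setU1 vi orbT.
    + by have /disjointP/(_ v vi vj) := d4 i j ij.
  - apply/disjointP => v /imsetP[i _ ->] /bigcupP[j _]; rewrite !inE => /orP[/eqP e|h].
      by apply: (qN j i (w.1 i)) => //; rewrite !inE eqxx.
    by move: (d3 i j); rewrite h.
  - exact: packable_copy.
apply/setP => v; rewrite !inE; apply/orP/orP.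
  case=> [/bigcupP[i _]|/imsetP[i _ ->]].
    rewrite !inE => /orP[/eqP->|h]; first by left; apply/imsetP; exists i.
    by right; apply/bigcupP; exists i; rewrite ?inE // h orbT.
  by right; apply/bigcupP; exists i; rewrite ?inE // eqxx.
case=> [/imsetP[i _ ->]|/bigcupP[i _]].
  by left; apply/bigcupP; exists i; rewrite ?inE // eqxx.
rewrite !inE => /orP[/eqP->|h]; first by right; apply/imsetP; exists i.
by left; apply/bigcupP; exists i; rewrite ?inE // h orbT.
Qed.

Lemma absorb_all (F : {set gadget}) (W : {set V}) l : #|W| = (r * l)%N ->
  (forall w, w \in F -> exists q, absorbs q w) ->
  (forall w w', w \in F -> w' \in F -> w != w' -> [disjoint gadget_set w & gadget_set w']) ->
  (forall q, l <= #|[set w in F | absorbs q w]|)%N ->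
  [disjoint W & \bigcup_(w in F) gadget_set w] ->
  packable (\bigcup_(w in F) gadget_set w :|: W).
Proof.
elim: l F W => [|l IH] F W cW FA dF many dW.
  move/eqP: cW; rewrite muln0 cards_eq0 => /eqP->; rewrite setU0.
  by apply: packable_bigcup => // w /FA[q]; apply: absorbs_idle.
have [W0 [sW cW0]] : exists W0 : {set V}, W0 \subset W /\ #|W0| = r.
  have [|W0 sW cW0] := @subset_of_size _ W r; first by rewrite cW leq_pmulr.
  by exists W0.
pose q : {ffun 'I_r -> V} := [ffun i => enum_val (cast_ord (esym cW0) i)].
have injq : injective q.
  by move=> i j; rewrite !ffunE => /enum_val_inj /cast_ord_inj.
have qW : [set q i | i in 'I_r] = W0.
  apply/eqP; rewrite eqEcard card_imset // card_ord cW0 leqnn andbT.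
  by apply/subsetP => v /imsetP[i _ ->]; rewrite ffunE; apply: enum_valP.
have [w] : exists w, w \in [set w in F | absorbs q w].
  by apply/set0Pn; rewrite -card_gt0; apply: leq_trans (many q).
rewrite inE => /andP[wF aw].
have W0d : [disjoint W0 & gadget_set w].
  apply/disjointP => v vW vw; move/disjointP: dW => /(_ v (subsetP sW _ vW)); apply.
  by apply/bigcupP; exists w.
have -> : \bigcup_(w in F) gadget_set w :|: W =
    (gadget_set w :|: W0) :|: (\bigcup_(z in F :\ w) gadget_set z :|: (W :\: W0)).
  have eW : W = W0 :|: (W :\: W0) by rewrite -{1}(setID W W0) (setIidPr sW).
  by rewrite (big_setD1 w) //= [in LHS]eW [LHS]setUACA.
apply: packableU.
- apply/disjointP => v; rewrite [v \in _ :|: W0]inE [v \in _ :|: (_ :\: _)]inE [v \in W :\: _]inE.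
  case/orP => [vw|vW0] /orP[/bigcupP[w']|/andP[nW0 vW]].
  + rewrite !inE => /andP[ne w'F] vw'; by have /disjointP/(_ v vw' vw) := dF w' w w'F wF ne.
  + move/disjointP: dW => /(_ v vW); apply; by apply/bigcupP; exists w.
  + rewrite !inE => /andP[_ w'F] vw'; move/disjointP: dW => /(_ v (subsetP sW _ vW0)); apply.
    by apply/bigcupP; exists w'.
  + by rewrite vW0 in nW0.
- by rewrite -qW; apply: (absorbs_active aw) => //; rewrite qW.
apply: IH.
- by rewrite cardsD (setIidPr sW) cW cW0 mulnS addKn.
- by move=> w'; rewrite inE => /andP[_ /FA].
- by move=> w1 w2; rewrite !inE => /andP[_ h1] /andP[_ h2]; apply: dF.
- move=> q'; have := many q'; rewrite (cardsD1 w).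
  rewrite (_ : [set w in F | absorbs q' w] :\ w = [set w0 in F :\ w | absorbs q' w0]).
    by case: (_ \in _); rewrite ?add1n ?add0n // => /ltnW.
  by apply/setP => z; rewrite !inE andbA.
- apply/disjointP => v; rewrite inE => /andP[_ vW] /bigcupP[w']; rewrite !inE => /andP[_ w'F] vw'.
  move/disjointP: dW => /(_ v vW); apply; by apply/bigcupP; exists w'.
Qed.

Variable R : realType.
Local Notation n := (#|V|%:R : R).

Lemma absorbs_card (c : R) (U : {set V}) (q : {ffun 'I_r -> V}) : 0 < n -> 0 <= c ->
  c * n ^+ r <= #|[set f | copy f]|%:R ->
  (forall x y, c * n ^+ k <= #|links x y|%:R) ->
  ((r + k) * (#|U| + r * k.+1))%:R <= c / 2 * n ->
  (c / 2) ^+ r.+1 * #|{: gadget}|%:R <=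
    #|[set w in [set w | absorbs q w] | [disjoint gadget_set w & U]]|%:R.
Proof.
move=> n0 c0 hcopy hlinks big; have c20 : 0 <= c / 2 by rewrite divr_ge0.
have bigU m (F : {set V}) : (m <= r + k)%N -> (#|F| <= #|U| + r * k.+1)%N -> m%:R * #|F|%:R <= c / 2 * n.
  by move=> h1 h2; apply: le_trans big; rewrite -natrM ler_nat leq_mul.
pose tup (f : {ffun 'I_r -> V}) : r.-tuple V := [tuple f i | i < r].
have tinj : injective tup.
  move=> f g e; apply/ffunP => i; have := congr1 (fun t => tnth t i) e.
  by rewrite !tnth_mktuple.
pose C := [set f | copy f && [disjoint [set f i | i in 'I_r] & U]].
have cC : c / 2 * n ^+ r <= #|C|%:R.
  apply: le_trans (_ : #|[set t in tup @: [set f | copy f] | ~~ has (mem U) t]|%:R <= _).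
    apply: avoiding_card => //; first by rewrite card_imset.
    by apply: bigU; rewrite ?leq_addr.
  rewrite -(card_imset C tinj); apply/lecard/subsetP => t; rewrite inE => /andP[/imsetP[f]].
  rewrite inE => cf -> /hasPn hU; apply/imsetP; exists f => //; rewrite inE cf.
  apply/disjointP => v /imsetP[i _ ->] vU; have := hU (f i).
  by rewrite -[f i](tnth_mktuple (fun i => f i)) mem_tnth => /(_ isT); rewrite tnth_mktuple; move/negP.
pose B f := [set s : {ffun 'I_r -> k.-tuple V} | absorbs q (f, s) && [disjoint gadget_set (f, s) & U]].
have cB f : f \in C -> (c / 2) ^+ r * #|{ffun 'I_r -> k.-tuple V}|%:R <= #|B f|%:R.
  rewrite inE => /andP[cf dfU].
  pose ok (s : {ffun 'I_r -> k.-tuple V}) i := (s i \in links (q i) (f i))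
     && ~~ has (mem (U :|: [set f j | j in 'I_r])) (s i).
  pose P (L : {set 'I_r}) (s : {ffun 'I_r -> k.-tuple V}) := [forall i in L, ok s i] &&
    [forall i in L, forall j in L, (i != j) ==> ~~ has (mem (s i)) (s j)].
  have tn : 0 < #|{: k.-tuple V}|%:R :> R by rewrite card_tuple natrX exprn_gt0.
  have h0 : 0 <= c / 2 * #|{: k.-tuple V}|%:R by rewrite mulr_ge0.
  have := @greedy_set _ _ R P set0 setT _ h0 (sub0set _); rewrite setD0 cardsT card_ord => gs.
  have {gs} := gs _.
  have -> : [set s | P set0 s] = setT.
    apply/setP => s; rewrite !inE; apply/andP; split; first by apply/forall_inP => i; rewrite inE.
    by apply/forall_inP => i; rewrite inE.
  rewrite cardsT exprMn => gs.
  apply: le_trans (_ : #|[set s | P setT s]|%:R <= _).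
    rewrite -(ler_pM2r (exprn_gt0 r tn)) [X in X <= _]mulrAC; apply: gs => L i s _ _ _ iL /andP[/forall_inP sok /forall_inP sdis].
    pose F := U :|: [set f j | j in 'I_r] :|: \bigcup_(j in L) [set z in s j].
    have cF : (#|F| <= #|U| + r * k.+1)%N.
      apply: (leq_trans (leq_card_setU _ _)); rewrite mulnS addnA leq_add //.
        apply: (leq_trans (leq_card_setU _ _)); rewrite leq_add2l.
        by apply: leq_trans (leq_imset_card _ _) _; rewrite card_ord.
      apply: leq_trans (_ : \sum_(j in L) #|[set z in s j]| <= _)%N.
        by elim/big_rec2: _ => [|j x D _ hx]; rewrite ?cards0 // (leq_trans (leq_card_setU _ _)) // leq_add2l.
      apply: leq_trans (_ : \sum_(j in L) k <= _)%N.
        by apply: leq_sum => j _; rewrite cardsE (leq_trans (card_size _)) // size_tuple.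
      by rewrite sum_nat_const leq_mul2r -[X in (_ <= X)%N]card_ord max_card orbT.
    rewrite card_tuple natrX.
    apply: le_trans (avoiding_card n0 (hlinks (q i) (f i)) (bigU k F (leq_addl _ _) cF)) _.
    apply/lecard/subsetP => t; rewrite inE => /andP[tl tF]; rewrite inE.
    have tF' v : v \in t -> v \notin F by move=> vt; apply: (hasPn tF).
    apply/andP; split.
      apply/forall_inP => j; rewrite in_setU1 /ok updE; case: eqVneq => [-> _|_ /= /sok//].
      rewrite tl /=; apply/hasPn => v /tF'; apply: contra => /= vv.
      by rewrite inE vv.
    apply/forall_inP => j1; rewrite in_setU1 => j1L; apply/forall_inP => j2; rewrite in_setU1 => j2L.
    apply/implyP => j12; rewrite !updE; move: j1L j2L j12.
    case: (eqVneq j1 i) => [->|n1]; case: (eqVneq j2 i) => [->|n2] //=.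
    - move=> _ j2L _; apply/hasPn => v vj; apply/negP => /tF'; rewrite inE negb_or => /andP[_ /negP]; apply.
      by apply/bigcupP; exists j2; rewrite ?inE.
    - move=> j1L _ _; apply/hasPn => v /tF' vF; apply: contra vF => vj.
      by rewrite inE; apply/orP; right; apply/bigcupP; exists j1; rewrite ?inE.
    - by move=> j1L j2L j12; have /forall_inP/(_ j2 j2L)/implyP := sdis j1 j1L; apply.
  apply/lecard/subsetP => s; rewrite inE => /andP[/forall_inP sok /forall_inP sdis]; rewrite inE.
  have avoid i v : v \in s i -> v \notin U /\ v \notin [set f j | j in 'I_r].
    have /andP[_ /hasPn h] := sok i (in_setT i) => /h; rewrite /= inE negb_or => /andP[] //.
  apply/andP; split.
    apply/and4P; split => //=.
    - by apply/forallP => i; have /andP[] := sok i (in_setT i).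
    - apply/forallP => i; apply/forallP => j; apply/negP => /avoid[_ /negP]; apply.
      by apply/imsetP; exists i.
    - apply/forallP => i; apply/forallP => j.
      by have /forall_inP/(_ j (in_setT j)) := sdis i (in_setT i).
  apply/disjointP => v /bigcupP[i _]; rewrite !inE => /orP[/eqP->|/avoid[/negP h _]] // vU.
  by move/disjointP: dfU => /(_ (f i)); apply=> //; apply/imsetP; exists i.
set D := [set w in _ | _].
apply: le_trans (_ : \sum_(f in C) #|B f|%:R <= _).
  apply: le_trans (_ : \sum_(f in C) (c / 2) ^+ r * #|{ffun 'I_r -> k.-tuple V}|%:R <= _).
    rewrite sumr_const -[X in _ <= X]mulr_natl card_prod natrM exprS.
    have -> : #|{ffun 'I_r -> V}|%:R = n ^+ r by rewrite card_ffun card_ord natrX.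
    by rewrite mulrACA ler_wpM2r // mulr_ge0 ?exprn_ge0.
  by apply: ler_sum.
rewrite sum_card_fst natr_sum [X in X <= _]big_mkcond; apply: ler_sum => f _; case: ifP => // _.
by apply/lecard/subsetP => s; rewrite !inE.
Qed.

End Absorbers.

Lemma exprn_small (R : realType) (x y : R) : 0 < x -> x < 1 -> 0 < y -> exists b, x ^+ b <= y.
Proof.
move=> x0 x1 y0; pose d := x^-1 - 1.
have d0 : 0 < d by rewrite subr_gt0 invf_gt1.
have bern b : 1 + b%:R * d <= x^-1 ^+ b.
  elim: b => [|b IH]; first by rewrite mul0r addr0 expr0.
  have bd : 0 <= b%:R * d * d by rewrite !mulr_ge0 // ltW.
  have := ler_wpM2l (_ : 0 <= x^-1) IH; rewrite invr_ge0 ltW // => /(_ isT); rewrite -exprS.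
  apply: le_trans; rewrite (_ : x^-1 = 1 + d); last by rewrite /d; ring.
  by rewrite -[b.+1%:R]natr1; move: bd; clear; lra.
have [N HN] := eventually_ge y^-1 d0; exists N.
rewrite -lef_pV2 ?posrE ?exprn_gt0 // -exprVn; apply: le_trans (bern N).
by apply: le_trans (HN N (leqnn N)) _; rewrite mulrC lerDr.
Qed.

Lemma expn_lt_exp2n (r L : nat) : (0 < r)%N -> (0 < L)%N ->
  exists N, forall n, (N <= n)%N -> (n ^ r < 2 ^ (n %/ L))%N.
Proof.
move=> r0 L0; pose C := (L * (2 * r))%N; exists (C * C)%N => n nN.
pose d := (n %/ L %/ (2 * r))%N.
have C0 : (0 < C)%N by rewrite !muln_gt0 L0 r0.
have n1 : (n < C * d.+1)%N.
  have h2 : (n < L * (n %/ L).+1)%N by rewrite mulnC ltn_ceil.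
  have h3 : (n %/ L < (2 * r) * d.+1)%N by rewrite mulnC ltn_ceil // muln_gt0.
  by apply: (leq_trans h2); rewrite /C -mulnA leq_pmul2l.
have Cd : (C <= d.+1)%N by rewrite -(leq_pmul2l C0) (leq_trans nN) // ltnW.
have d2 : (d.+1 <= 2 ^ d)%N by apply: ltn_expl.
have n2 : (n < 2 ^ (2 * d))%N.
  apply: (leq_trans n1); rewrite mul2n -addnn expnD; apply: leq_mul => //.
  exact: leq_trans Cd d2.
apply: leq_trans (_ : 2 ^ (2 * d * r) <= _)%N; first by rewrite expnM ltn_exp2r.
by rewrite leq_pexp2l // mulnAC mulnC leq_trunc_div.
Qed.

Lemma absorbing_set (R : realType) (r : nat) (gam mu : R) : (3 <= r)%N -> 0 < gam -> gam <= 1 -> 0 < mu ->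
  exists theta nu : R, [/\ 0 < theta, 0 < nu & exists N, forall (T : rel 'I_r) (V : finType) (G : rel V),
    (forall i j, i != j -> T i j (+) T j i) -> irreflexive T -> irreflexive G ->
    (exists w, forks T w) -> (N <= #|V|)%N -> robust r G theta gam ->
    exists M : {set V}, [/\ #|M|%:R <= mu * #|V|%:R, packable T G M &
      forall W : {set V}, [disjoint W & M] -> (r %| #|W|)%N -> #|W|%:R <= nu * #|V|%:R ->
      packable T G (M :|: W)]].
Proof.
move=> r3 gam0 gam1 mu0; have r0 : (0 < r)%N by apply: leq_trans r3.
have [theta [c1 [th0 c10 [N1 HN1]]]] := links_many r3 gam0 gam1.
pose k := (5 * r).-1; pose m := (r * k.+1)%N.
pose c := Num.min c1 1; have c0 : 0 < c by rewrite lt_min c10 ltr01.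
have [cc1 cc2] : c <= c1 /\ c <= 1 by rewrite !ge_min !lexx orbT.
pose a := (c / 2) ^+ r.+1; have a0 : 0 < a by rewrite exprn_gt0 // divr_gt0.
have a1 : a <= 1.
  apply: exprn_ile1; first by rewrite divr_ge0 // ltW.
  by move: cc2; clear; lra.
have [b hb] : exists b, (1 - a / 2) ^+ b <= 4^-1.
  by apply: exprn_small; move: a0 a1; clear; lra.
have [L [L0 hL1 hL2]] : exists L : nat, [/\ (0 < L)%N, (m * b)%:R <= mu * L%:R
    & ((r + k) * m * b)%:R <= c / 4 * L%:R].
  have [N2 HN2] := eventually_ge (m * b)%:R mu0.
  have [N3 HN3] := eventually_ge ((r + k) * m * b)%:R (divr_gt0 c0 (ltr0Sn R 3)).
  exists (N2 + N3).+1; split => //; [apply: HN2 | apply: HN3]; apply: leqW; [exact: leq_addr | exact: leq_addl].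
exists theta, (L * 2)%:R^-1; split => //; first by rewrite invr_gt0 ltr0n muln_gt0 L0.
have [N4 HN4] := eventually_ge ((r + k) * m)%:R (divr_gt0 c0 (ltr0Sn R 3)).
have [N5 HN5] := expn_lt_exp2n r0 L0.
exists (N1 + N4 + N5 + 2 * L)%N => T V G tourT irT irG fT nN rob.
have [nN1 nN4 nN5 nL] : [/\ (N1 <= #|V|)%N, (N4 <= #|V|)%N, (N5 <= #|V|)%N & (2 * L <= #|V|)%N].
  by split; move: nN; clear; lia.
have [hcopy hlinks] := HN1 T V G tourT irT irG fT nN1 rob.
have n0 : 0 < #|V|%:R :> R by rewrite ltr0n (leq_trans _ nL) // muln_gt0.
have [x0 _] : exists x0 : V, true by move: n0; rewrite ltr0n => /card_gt0P[x]; exists x.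
pose j := (#|V| %/ L)%N; pose p := (b * j)%N.
have jn : j%:R * L%:R <= #|V|%:R :> R by rewrite -natrM ler_nat leq_trunc_div.
have L0R : 0 < L%:R :> R by rewrite ltr0n.
have small (x : R) s : s%:R <= x * L%:R -> (s * j)%:R <= x * #|V|%:R.
  move=> h; have x0' : 0 <= x by rewrite -(pmulr_lge0 _ L0R) (le_trans _ h).
  rewrite natrM; apply: le_trans (ler_wpM2r (ler0n R j) h) _.
  by rewrite -mulrA [L%:R * _]mulrC ler_wpM2l.
pose q0 : {ffun 'I_r -> V} := [ffun=> x0].
pose A (q : {ffun 'I_r -> V}) := [set w : gadget r V k | absorbs T G q w].
have gad0 : (0 < #|{: gadget r V k}|)%N.
  by apply/card_gt0P; exists (q0, [ffun=> [tuple x0 | i < k]]).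
have [F [cF FA dF pot]] : exists F : {set gadget r V k}, [/\ (#|F| <= p)%N,
    forall w, w \in F -> exists q, w \in A q,
    forall w w', w \in F -> w' \in F -> w != w' -> [disjoint gadget_set w & gadget_set w']
  & \sum_q 2^-1 ^+ #|F :&: A q| <= (1 - a / 2) ^+ p * #|{ffun 'I_r -> V}|%:R :> R].
  apply: (@disjoint_hitting R _ _ _ A (@gadget_set r V k) a m p q0) => //.
  - by move=> w; apply: gadget_set_neq0.
  - exact: card_gadget_set.
  move=> U q cU; apply: absorbs_card => //; first exact: ltW.
  - by apply: le_trans hcopy; rewrite ler_wpM2r ?exprn_ge0.
  - by move=> x y; apply: le_trans (hlinks x y); rewrite ler_wpM2r ?exprn_ge0.
  have h1 := small _ _ hL2; have h2 := HN4 _ nN4.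
  have h3 : ((r + k) * (#|U| + r * k.+1) <= (r + k) * m * b * j + (r + k) * m)%N.
    apply: (@leq_trans ((r + k) * (m * p + m))); first by rewrite leq_mul2l leq_add2r cU orbT.
    by rewrite mulnDr /p !mulnA.
  have : ((r + k) * (#|U| + r * k.+1))%:R <= ((r + k) * m * b * j)%:R + ((r + k) * m)%:R :> R.
    by rewrite -natrD ler_nat.
  by move/le_trans; apply; apply: (le_trans (lerD h1 h2)); rewrite -mulrDl ler_wpM2r ?(ltW n0) //; move: c0; clear; lra.
have many q : (j <= #|[set w in F | absorbs T G q w]|)%N.
  have -> : [set w in F | absorbs T G q w] = F :&: A q by apply/setP => w; rewrite !inE.
  rewrite leqNgt; apply/negP => lt.
  have h1 : 2^-1 ^+ j <= 4^-1 ^+ j * (#|V| ^ r)%:R :> R.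
    apply: le_trans (_ : 2^-1 ^+ #|F :&: A q| <= _).
      have h2 : 2^-1 <= 1 :> R by lra.
      by rewrite ler_wiXn2l ?invr_ge0 // ltnW.
    apply: le_trans (_ : \sum_q 2^-1 ^+ #|F :&: A q| <= _).
      by rewrite [X in _ <= X](bigD1 q) //= lerDl sumr_ge0 // => q' _; rewrite exprn_ge0 ?invr_ge0.
    apply: (le_trans pot); rewrite card_ffun card_ord ler_wpM2r // exprM.
    by apply: lerXn2r => //; rewrite ?nnegrE ?exprn_ge0 ?invr_ge0 //; move: a1; clear; lra.
  have := HN5 _ nN5; rewrite -/j -(ltr_nat R) ltNge => /negP; apply.
  have e : 4^-1 ^+ j = 2^-1 ^+ j * 2^-1 ^+ j :> R by rewrite -exprMn; congr (_ ^+ _); field.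
  move: h1; rewrite e -mulrA ler_pMr ?exprn_gt0 ?invr_gt0 // exprVn mulrC -ler_pdivrMr ?invrK ?mul1r ?natrX //.
  by rewrite invr_gt0 exprn_gt0.
exists (\bigcup_(w in F) gadget_set w); split.
- have h : (#|\bigcup_(w in F) gadget_set w| <= m * b * j)%N.
    apply: leq_trans (_ : \sum_(w in F) #|gadget_set w| <= _)%N.
      by elim/big_rec2: _ => [|w x B _ hx]; rewrite ?cards0 // (leq_trans (leq_card_setU _ _)) // leq_add2l.
    apply: leq_trans (_ : \sum_(w in F) m <= _)%N; first by apply: leq_sum => w _; apply: card_gadget_set.
    by rewrite sum_nat_const mulnC -mulnA leq_mul2l cF orbT.
  by apply: le_trans (small _ _ hL1); rewrite ler_nat.
- apply: packable_bigcup => // w /FA[q]; rewrite inE; exact: absorbs_idle.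
move=> W dW /dvdnP[l eW] cW.
have lj : (l <= j)%N.
  rewrite leq_divRL //.
  have : (#|W| * (L * 2) <= #|V|)%N.
    by rewrite -(ler_nat R) natrM -ler_pdivlMr ?ltr0n ?muln_gt0 ?L0 // mulrC.
  by apply: leq_trans; rewrite leq_mul ?leq_pmulr // eW leq_pmulr.
apply: (absorb_all tourT irG (l := l)) => //.
- by rewrite eW mulnC.
- by move=> w /FA[q]; rewrite inE; exists q.
- by move=> q; apply: leq_trans lj (many q).
Qed.

(** * Perfect packings *)

Lemma packable_image (r : nat) (T : rel 'I_r) (V V' : finType) (G : rel V) (h : V' -> V)
    (P : {set {ffun 'I_r -> V'}}) : injective h ->
  packing T (fun x y => G (h x) (h y)) P -> packable T G (h @: covered P).
Proof.
move=> injh /packingP[cP dP]; pose H (f : {ffun 'I_r -> V'}) := [ffun i => h (f i)].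
apply/existsP; exists (H @: P); apply/andP; split.
  apply/packingP; split => [f|f g i j] /imsetP[f0 f0P ->].
    apply/partialP => i j iT jT ij; rewrite !ffunE.
    by have /partialP/(_ i j iT jT ij) := cP f0 f0P.
  move=> /imsetP[g0 g0P ->]; rewrite !ffunE => /injh e.
  by rewrite (dP f0 g0 i j).
apply/eqP/setP => v; apply/coveredP/imsetP => [[f [i [/imsetP[f0 f0P ->] ->]]]|[v' /coveredP[f [i [fP ->]]] ->]].
  by rewrite ffunE; exists (f0 i) => //; apply/coveredP; exists f0, i.
by exists (H f), i; rewrite imset_f // ffunE.
Qed.

Section Restrict.
Variables (R : realType) (r : nat) (V : finType) (G : rel V) (M : {set V}).
Local Notation V' := {x : V | x \notin M}.
Local Notation n := (#|V|%:R : R).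
Local Notation n' := (#|{: V'}|%:R : R).

Lemma card_outside : #|{: V'}| = #|~: M|.
Proof. by rewrite card_sig; apply: eq_card => x; rewrite !inE. Qed.

Lemma robust_outside (theta theta' gam gam' mu : R) : (0 < r)%N ->
  0 <= mu -> mu <= 1 -> 0 <= theta' -> 0 <= gam' ->
  theta + mu * (1 + theta') <= theta' -> gam' + mu <= gam ->
  #|M|%:R <= mu * n -> robust r G theta gam ->
  robust r (fun x y : V' => G (val x) (val y)) theta' gam'.
Proof.
move=> r0 mu0 mu1 th0 g0 hth hg hM [r1 r2 r3].
have n0 : 0 <= n by [].
have cn' : (1 - mu) * n <= n' by rewrite card_outside; have := cardR_C R M; move: hM; lra.
have cn : n' <= n by rewrite card_outside ler_nat max_card.
have q0 : 0 <= r%:R^-1 :> R by rewrite invr_ge0.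
have q1 : r%:R^-1 <= 1 :> R by rewrite invf_le1 ?ler1n ?ltr0n.
have degree (X : {set V}) (Y : {set V'}) : (forall y, y \in Y -> val y \in X) ->
    #|X|%:R <= (r%:R^-1 + theta) * n -> #|Y|%:R <= (r%:R^-1 + theta') * n'.
  move=> YX hX; have hY : #|Y|%:R <= #|X|%:R :> R.
    rewrite -(card_imset Y val_inj); apply/lecard/subsetP => v /imsetP[y yY ->]; exact: YX.
  apply: (le_trans hY); apply: (le_trans hX).
  apply: le_trans (_ : (r%:R^-1 + theta') * ((1 - mu) * n) <= _); last by rewrite ler_wpM2l // addr_ge0.
  rewrite mulrA ler_wpM2r //.
  have : mu * r%:R^-1 <= mu by rewrite ler_piMr.
  by move: hth; move: (r%:R^-1 : R) => q; lra.
split.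
- by move=> x; apply: (degree (nonout G (val x))) => // y; rewrite !inE.
- by move=> x; apply: (degree (nonin G (val x))) => // y; rewrite !inE.
move=> S hS.
have cS : #|val @: S| = #|S| by rewrite card_imset //; apply: val_inj.
have h1 : (r%:R^-1 - gam) * n <= #|val @: S|%:R.
  rewrite cS; apply: le_trans hS; rewrite !mulrBl.
  have e1 : r%:R^-1 * ((1 - mu) * n) <= r%:R^-1 * n' by rewrite ler_wpM2l.
  have e2 : gam' * n' <= gam' * n by rewrite ler_wpM2l.
  have e3 : r%:R^-1 * (mu * n) <= mu * n by rewrite ler_piMl // mulr_ge0.
  have e4 : (gam' + mu) * n <= gam * n by rewrite ler_wpM2r.
  by move: e1 e2 e3 e4; move: (r%:R^-1 : R) => q; lra.
have h2 := r3 _ h1.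
apply: le_trans (_ : gam * n ^+ 2 <= _).
  apply: ler_pM => //; [by rewrite exprn_ge0 | by move: hg mu0; lra | ].
  by rewrite lerXn2r ?nnegrE.
apply: (le_trans h2).
rewrite -(card_imset [set p : V' * V' | _] (_ : injective (fun p : V' * V' => (val p.1, val p.2)))); last first.
  by move=> [x y] [x' y'] [/val_inj-> /val_inj->].
apply/lecard/subsetP => -[u v]; rewrite inE /= => /and3P[/imsetP[x xS ->] /imsetP[y yS ->] Gxy].
by apply/imsetP; exists (x, y); rewrite // inE /= xS yS.
Qed.

End Restrict.

Lemma robustW (R : realType) (r : nat) (V : finType) (G : rel V) (theta theta' gam : R) :
  theta <= theta' -> robust r G theta gam -> robust r G theta' gam.
Proof.
move=> tt [h1 h2 h3]; split => // x; [apply: le_trans (h1 x) _ | apply: le_trans (h2 x) _];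
by rewrite ler_wpM2r // lerD2l.
Qed.

Lemma robust_packable (R : realType) (r : nat) (gam : R) : (3 <= r)%N -> 0 < gam -> gam <= 1 ->
  exists theta : R, 0 < theta /\ exists N, forall (T : rel 'I_r) (V : finType) (G : rel V),
    (forall i j, i != j -> T i j (+) T j i) -> irreflexive T -> irreflexive G ->
    (exists w, forks T w) -> (N <= #|V|)%N -> (r %| #|V|)%N -> robust r G theta gam ->
    packable T G setT.
Proof.
case: r => // r r3 gam0 gam1.
have [th1 th10 almost] := @almost_packing R r (gam / 2) (ltnW r3) (divr_gt0 gam0 (ltr0Sn R 1)) ltac:(lra).
pose mu := Num.min (1 / 2) (Num.min (gam / 2) (th1 / (2 * (1 + th1)))).
have t0 : 0 < 1 + th1 by lra.
have mu0 : 0 < mu by rewrite !lt_min !divr_gt0 ?mulr_gt0.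
have [mu1 mug mut] : [/\ mu <= 1 / 2, mu <= gam / 2 & mu <= th1 / (2 * (1 + th1))].
  by rewrite /mu !ge_min !lexx !orbT.
clearbody mu.
have mut2 : mu * (1 + th1) <= th1 / 2.
  by move: mut; rewrite ler_pdivlMr ?mulr_gt0 //; lra.
have [th2 [nu [th20 nu0 [N1 HN1]]]] := absorbing_set r3 gam0 gam1 mu0.
pose theta := Num.min (th1 / 2) th2.
have [le1 le2] : theta <= th1 / 2 /\ theta <= th2 by rewrite /theta !ge_min !lexx orbT.
have [N2 HN2] := almost nu nu0.
have theta0 : 0 < theta by rewrite lt_min th20 divr_gt0.
clearbody theta; exists theta; split => //.
exists (N1 + 2 * N2)%N => T V G tourT irT irG fT nN rV rob.
have [nN1 nN2] : (N1 <= #|V|)%N /\ (2 * N2 <= #|V|)%N.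
  by split; [apply: leq_trans nN; rewrite leq_addr | apply: leq_trans nN; rewrite leq_addl].
have [M [cM pM absM]] := HN1 T V G tourT irT irG fT nN1 (robustW le2 rob).
pose V' := {x : V | x \notin M}; pose G' (x y : V') := G (val x) (val y).
have rob' : robust r.+1 G' th1 (gam / 2).
  apply: (robust_outside (mu := mu) (theta := theta) (gam := gam)) => //.
  - exact: ltW.
  - by move: mu1; clear; lra.
  - exact: ltW.
  - by rewrite divr_ge0 // ltW.
  - by move: le1 mut2; clear; lra.
  - by move: mug; clear; lra.
have rM : (r.+1 %| #|M|)%N.
  have /existsP[P /andP[packP /eqP <-]] := pM.
  by rewrite (card_covered tourT irG packP) dvdn_mull.
have cV' : #|{: V'}| = (#|V| - #|M|)%N by rewrite card_outside cardsCs setCK.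
have MV : (#|M| <= #|V|)%N by apply: max_card.
have rV' : (r.+1 %| #|{: V'}|)%N by rewrite cV' dvdn_sub.
have nN' : (N2 <= #|{: V'}|)%N.
  rewrite -(ler_nat R) cV' natrB //; move: nN2; rewrite -(ler_nat R) natrM => nN2.
  have : mu * #|V|%:R <= 1 / 2 * #|V|%:R by rewrite ler_wpM2r.
  by move: cM nN2; lra.
have irG' : irreflexive G' by move=> x; apply: irG.
have [P packP cP] := HN2 T V' G' tourT irG' nN' rV' rob'.
pose C := [set val x | x in covered P].
have injv : injective (val : V' -> V) by apply: val_inj.
have pC : packable T G C by apply: packable_image packP.
have cC : #|C| = (#|P| * r.+1)%N by rewrite /C card_imset // (card_covered tourT irG' packP).
have CM : [disjoint C & M].
  by apply/disjointP => v /imsetP[x _ ->]; apply/negP; apply: (valP x).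
pose W := ~: (M :|: C).
have cMC : #|M :|: C| = (#|M| + #|C|)%N.
  by rewrite cardsU (_ : M :&: C = set0) ?cards0 ?subn0 //; apply/eqP; rewrite setI_eq0 disjoint_sym.
have cW : #|W| = (#|{: V'}| - #|P| * r.+1)%N by rewrite /W cardsCs setCK cMC cC cV' subnDA.
have cP' : (#|P| * r.+1 <= #|{: V'}|)%N by rewrite -(card_covered tourT irG' packP) max_card.
have pMW : packable T G (M :|: W).
  apply: absM.
  - by apply/disjointP => v; rewrite !inE negb_or => /andP[/negP].
  - by rewrite cW dvdn_sub // dvdn_mull.
  - rewrite cW natrB // natrM; move: cP; rewrite [r.+1%:R * _]mulrC.
    have : nu * #|{: V'}|%:R <= nu * #|V|%:R by rewrite ler_wpM2l ?(ltW nu0) // ler_nat cV' leq_subr.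
    by lra.
have -> : [set: V] = C :|: (M :|: W).
  by apply/setP => v; rewrite !inE; case: (v \in M); case: (v \in C).
apply: packableU => //; apply/disjointP => v vC.
rewrite in_setU => /orP[vM|]; first by move/disjointP: CM => /(_ v vC vM).
by rewrite !inE vC orbT.
Qed.

Lemma robust_of_semidegree (R : realType) (r : nat) (gam eps : R) (V : finType) (G : digraph V) :
  0 < gam -> (0 < r)%N -> (r %| #|V|)%N ->
  (1 - r%:R^-1 - eps) * #|V|%:R <= (min_semidegree G)%:R ->
  ~ (exists S : {set V}, gamma_independent G gam S /\ #|V|%:R / r%:R <= #|S|%:R :> R) ->
  robust r G eps (gam / 3).
Proof.
move=> gam0 r0 rV hdeg hind.
have minle x : (min_semidegree G <= minn (outdeg G x) (indeg G x))%N.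
  rewrite /min_semidegree; have := mem_index_enum x; elim: (index_enum _) => // y s IH.
  rewrite inE big_cons => /predU1P[<-|/IH h]; first exact: geq_minl.
  exact: leq_trans (geq_minr _ _) h.
have degs x : (1 - r%:R^-1 - eps) * #|V|%:R <= (outdeg G x)%:R /\
    (1 - r%:R^-1 - eps) * #|V|%:R <= (indeg G x)%:R.
  by split; apply: (le_trans hdeg); rewrite ler_nat (leq_trans (minle x)) // (geq_minl, geq_minr).
split.
- move=> x; have [h _] := degs x; rewrite /nonout (_ : [set _ | _] = ~: [set y | G x y]).
    by have := cardR_C R [set y | G x y]; move: h; rewrite /outdeg; move: (r%:R^-1 : R) => q; lra.
  by apply/setP => y; rewrite !inE.
- move=> x; have [_ h] := degs x; rewrite /nonin (_ : [set _ | _] = ~: [set y | G y x]).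
    by have := cardR_C R [set y | G y x]; move: h; rewrite /indeg; move: (r%:R^-1 : R) => q; lra.
  by apply/setP => y; rewrite !inE.
move=> S hS.
have [S' [sS' cS' cD]] : exists S' : {set V}, [/\ S \subset S', #|V|%:R / r%:R <= #|S'|%:R :> R
    & #|S' :\: S|%:R <= gam / 3 * #|V|%:R].
  have [h|h] := leqP (#|V| %/ r) #|S|.
    exists S; split => //; last by rewrite setDv cards0 mulr_ge0 // divr_ge0 // ltW.
    by rewrite ler_pdivrMr ?ltr0n // -natrM ler_nat -leq_divLR.
  have [|D sD cD] := @subset_of_size _ (~: S) (#|V| %/ r - #|S|).
    by rewrite [X in (_ <= X)%N]cardsCs setCK leq_sub2r // leq_div.
  have dD : S :&: D = set0.
    by apply/eqP; rewrite setI_eq0 disjoint_sym disjoints_subset.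
  have e1 : (#|V| %/ r)%:R = #|V|%:R / r%:R :> R.
    apply: (@mulIf _ r%:R); first by rewrite pnatr_eq0 -lt0n.
    by rewrite -natrM divnK // divfK // pnatr_eq0 -lt0n.
  exists (S :|: D); split; first exact: subsetUl.
    by rewrite cardsU dD cards0 subn0 cD subnKC ?(ltnW h) // e1.
  rewrite setDUl setDv set0U (setDidPl _) ?cD; last by rewrite -setI_eq0 setIC dD.
  by rewrite natrB ?(ltnW h) // e1; move: hS; rewrite mulrBl [r%:R^-1 * _]mulrC; lra.
have h1 : gam * #|V|%:R ^+ 2 < (edges_in G S')%:R.
  rewrite ltNge; apply/negP => h; apply: hind; exists S'; split => //.
pose E := [set p : V * V | [&& p.1 \in S, p.2 \in S & G p.1 p.2]].
have sub : [set p : V * V | [&& p.1 \in S', p.2 \in S' & G p.1 p.2]] \subset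
    E :|: (setX (S' :\: S) setT :|: setX setT (S' :\: S)).
  apply/subsetP => -[x y]; rewrite !inE /= => /and3P[-> -> ->].
  by case: (x \in S); case: (y \in S).
have h2 : (edges_in G S')%:R <= #|E|%:R + (#|S' :\: S|%:R * #|V|%:R + #|V|%:R * #|S' :\: S|%:R) :> R.
  rewrite /edges_in; apply: (le_trans (lecard R sub)); apply: (le_trans (cardR_U R _ _)); rewrite lerD2l.
  by apply: (le_trans (cardR_U R _ _)); rewrite !cardsX cardsT !natrM.
have h3 : #|S' :\: S|%:R * #|V|%:R <= gam / 3 * #|V|%:R ^+ 2.
  by rewrite expr2 mulrA ler_wpM2r.
rewrite -/E; move: h1 h2 h3; rewrite [#|V|%:R * _]mulrC.
by move: (#|V|%:R ^+ 2) (#|S' :\: S|%:R * #|V|%:R) (#|E|%:R : R) ((edges_in G S')%:R : R) => a b c d; clear; lra.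
Qed.

Lemma C3_or_forks (W : finType) (T : digraph W) (h : 'I_3 -> W) : bijective h ->
  is_tournament T -> ~ digraph_iso T C3 ->
  exists w, forks (fun i j => T (h i) (h j)) w.
Proof.
move=> bh tourT niso; apply: contrapT => /forallNP nof.
have injh := bij_inj bh; have [h' hK h'K] := bh.
have tour i j : i != j -> T (h i) (h j) (+) T (h j) (h i).
  by move=> ij; apply: tourT; apply: contra_neq ij; apply: injh.
have nofork i j k : j != k -> T (h i) (h j) -> T (h i) (h k) -> False.
  move=> jk Tj Tk; apply: (nof i); rewrite /forks; apply/card_gt1P.
  by exists j, k; rewrite !inE.
have cyc i j k : i != j -> j != k -> i != k -> T (h i) (h j) ->
    [/\ T (h j) (h k), T (h k) (h i), ~~ T (h j) (h i), ~~ T (h k) (h j) & ~~ T (h i) (h k)].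
  move=> ij jk ik Tij.
  have Tik : T (h i) (h k) = false by apply/negP => /(nofork i j k jk Tij).
  have Tki : T (h k) (h i) by have := tour i k ik; rewrite Tik.
  have Tkj : T (h k) (h j) = false by apply/negP => /(nofork k i j ij Tki).
  have Tjk : T (h j) (h k) by have := tour j k jk; rewrite Tkj addbF.
  have Tji : T (h j) (h i) = false.
    by apply/negP => /(nofork j k i _ Tjk); apply; rewrite eq_sym.
  by rewrite Tjk Tki Tji Tkj Tik.
pose i0 : 'I_3 := ord0; pose i1 : 'I_3 := Ordinal (isT : 1 < 3)%N; pose i2 : 'I_3 := Ordinal (isT : 2 < 3)%N.
have iso (s : 'I_3 -> 'I_3) : involutive s -> T (h (s i0)) (h (s i1)) -> False.
  move=> sK T01; apply: niso; exists (s \o h'); split.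
    by exists (h \o s) => x /=; rewrite ?sK ?h'K // hK sK.
  have ns x y : x != y -> s x != s y by apply: contra_neq => /(can_inj sK).
  have [e1 e2 e3 e4 e5] := cyc (s i0) (s i1) (s i2) (ns i0 i1 isT) (ns i1 i2 isT) (ns i0 i2 isT) T01.
  have all : forall i j, C3_edge i j = T (h (s i)) (h (s j)).
    have e i : i \in [:: i0; i1; i2] by case: i => [[|[|[|m]]]] Hm; rewrite !inE.
    move=> i j; move: (e i) (e j); rewrite !inE.
    by case/or3P => /eqP->; case/or3P => /eqP->; rewrite ?edge_irr ?T01 ?e1 ?e2 ?(negbTE e3) ?(negbTE e4) ?(negbTE e5).
  by move=> x y; rewrite [LHS]all /= !sK !h'K.
case T01 : (T (h i0) (h i1)); first exact: (iso id).
have T10 : T (h i1) (h i0) by have := tour i0 i1 isT; rewrite T01.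
apply: (iso (fun i => if i == i0 then i1 else if i == i1 then i0 else i)) => //.
by case=> [[|[|[|m]]]] Hm //; apply: val_inj.
Qed.

Theorem theorem10p1 (R : realType) (r : nat) (hr : (3 <= r)%N) :
  exists gamma0 : R, 0 < gamma0 /\
  forall gamma : R, 0 < gamma -> gamma <= gamma0 ->
  exists eps0 : R, 0 < eps0 /\
  forall eps : R, 0 < eps -> eps <= eps0 ->
  exists n0 : nat, (0 < n0)%N /\
  forall n : nat, (n0 <= n)%N -> (r %| n)%N ->
  forall (W : finType) (T : digraph W), #|W| = r ->
    is_tournament T -> ~ digraph_iso T C3 ->
  forall (V : finType) (G : digraph V), #|V| = n ->
    (1 - r%:R^-1 - eps) * n%:R <= (min_semidegree G)%:R ->
    ~ (exists S : {set V},
         gamma_independent G gamma S /\ n%:R / r%:R <= #|S|%:R :> R) ->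
  exists P : {set {ffun W -> V}}, perfect_packing T G P.
Proof.
exists 1; split => // gamma g0 g1.
have [||theta [th0 [N HN]]] := @robust_packable R r (gamma / 3) hr; [lra|lra|].
exists theta; split => // eps e0 eth; exists N.+1; split => // n nN rn W T cW tourT nC3 V G cV hdeg hind.
subst n; have r0 : (0 < r)%N by apply: leq_trans hr.
pose h (i : 'I_r) : W := enum_val (cast_ord (esym cW) i).
pose h' (w : W) : 'I_r := cast_ord cW (enum_rank w).
have hK : cancel h h' by move=> i; rewrite /h /h' enum_valK cast_ordKV.
have h'K : cancel h' h by move=> w; rewrite /h /h' cast_ordK enum_rankK.
pose T' (i j : 'I_r) := T (h i) (h j).
have tourT' i j : i != j -> T' i j (+) T' j i.
  by move=> ij; apply: tourT; apply: contra_neq ij; apply: (can_inj hK).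
have irT' : irreflexive T' by move=> i; apply: edge_irr.
have fT : exists w, forks T' w.
  have [e3|n3] := eqVneq r 3%N; last first.
    by apply: tournament_forks => //; rewrite ltn_neqAle eq_sym n3.
  rewrite /T'; clearbody h h'; clear -tourT nC3 hK h'K e3; subst r.
  by apply: C3_or_forks => //; exists h'.
have rob : robust r G theta (gamma / 3).
  by apply: robustW eth _; apply: robust_of_semidegree.
have /existsP[P /andP[/packingP[cP dP] /eqP covP]] := HN T' V G tourT' irT' (@edge_irr _ G) fT (ltnW nN) rn rob.
pose H (f : {ffun 'I_r -> V}) : {ffun W -> V} := [ffun w => f (h' w)].
exists (H @: P); split.
- move=> f /imsetP[f0 /cP c0 ->]; split.
    move=> x y; rewrite !ffunE => /(copy_inj tourT' (@edge_irr _ G) c0); exact: (can_inj h'K).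
  move=> x y Txy; rewrite !ffunE.
  have xy : h' x != h' y.
    by apply: contraTneq Txy => /(can_inj h'K) ->; rewrite edge_irr.
  have /partialP/(_ (h' x) (h' y) (in_setT _) (in_setT _) xy) := c0.
  by rewrite compat_out // /T' !h'K.
- move=> f g /imsetP[f1 f1P ->] /imsetP[f2 f2P ->] ne.
  rewrite disjoint_subset; apply/subsetP => v /codomP[w ->]; rewrite inE; apply/negP => /codomP[w'].
  rewrite !ffunE => e; move: ne; rewrite (dP _ _ _ _ f1P f2P e) eqxx //.
- move=> v; have : v \in covered P by rewrite covP inE.
  move/coveredP => [f [i [fP ->]]]; exists (H f); first exact: imset_f.
  by apply/codomP; exists (h i); rewrite ffunE hK.
Qed.
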